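(* Let $\mathcal{A}\in\mathbb{R}^{I\times J\times K}$, let the positive integer $R$ be an upper bound of $\mathrm{rank}(\mathcal{A})$, let $\lambda>0$ and $s>1$, and let $\bm{\omega}^n=(\mathbf{X}^n,\mathbf{Y}^n,\mathbf{Z}^n,\bm{\alpha}^n)$, $n\in\mathbb{N}$, be a sequence generated by the LRAT algorithm with parameters $R,\lambda,s$ from a starting point $\bm{\omega}^0$. Then the sequence $\{\bm{\omega}^n\}_{n\in\mathbb{N}}$ converges to a critical point $\bm{\omega}^*$ of $\Psi$, i.e. to a point $\bm{\omega}^*$ with $\mathbf{0}\in\partial\Psi(\bm{\omega}^* )$.
   Context: Notation. For $\mathbf{X}=(\mathbf{x}_1,\dots,\mathbf{x}_R)\in\mathbb{R}^{I\times R}$, $\mathbf{Y}=(\mathbf{y}_1,\dots,\mathbf{y}_R)\in\mathbb{R}^{J\times R}$, $\mathbf{Z}=(\mathbf{z}_1,\dots,\mathbf{z}_R)\in\mathbb{R}^{K\times R}$ and a row vector $\bm{\alpha}=(\alpha_1,\dots,\alpha_R)\in\mathbb{R}^R$, set $[\bm{\alpha};\mathbf{X},\mathbf{Y},\mathbf{Z}]_R=\sum_{r=1}^R\alpha_r\,\mathbf{x}_r\circ\mathbf{y}_r\circ\mathbf{z}_r$, where $\mathbf{x}\circ\mathbf{y}\circ\mathbf{z}$ is the tensor with entries $x_iy_jz_k$. The rank of $\mathcal{A}$ is the minimal number of such outer products summing to $\mathcal{A}$. $\|\cdot\|_F$ is the Frobenius norm (Euclidean norm for vectors), $\|\bm{\alpha}\|_1=\sum_r|\alpha_r|$.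 Let $S_1,S_2,S_3$ be the sets of matrices in $\mathbb{R}^{I\times R},\mathbb{R}^{J\times R},\mathbb{R}^{K\times R}$, respectively, all of whose columns have Euclidean norm one, and $\delta_S$ the indicator function ($0$ on $S$, $+\infty$ off $S$). Put $f(\mathbf{X},\mathbf{Y},\mathbf{Z},\bm{\alpha})=\frac12\|\mathcal{A}-[\bm{\alpha};\mathbf{X},\mathbf{Y},\mathbf{Z}]_R\|_F^2$, $g(\bm{\alpha})=\lambda\|\bm{\alpha}\|_1$ and, for $\bm{\omega}=(\mathbf{X},\mathbf{Y},\mathbf{Z},\bm{\alpha})$, $$\Psi(\bm{\omega})=f(\mathbf{X},\mathbf{Y},\mathbf{Z},\bm{\alpha})+g(\bm{\alpha})+\delta_{S_1}(\mathbf{X})+\delta_{S_2}(\mathbf{Y})+\delta_{S_3}(\mathbf{Z}).$$ Subdifferential. For a proper lower semicontinuous $h:\mathbb{R}^m\to(-\infty,+\infty]$ and $x\in\mathrm{dom}\,h$, the Fréchet subdifferential $\hat\partial h(x)$ is the set of $u$ with $\liminf_{y\to x,\,y\neq x}\frac{h(y)-h(x)-\langle u,y-x\rangle}{\|y-x\|}\geq0$, and the (limiting) subdifferential $\partial h(x)$ is the set of $u$ for which there are $x_k\to x$ with $h(x_k)\to h(x)$ and $u_k\in\hat\partial h(x_k)$ with $u_k\to u$. The Khatri-Rao product is $\mathbf{X}\odot\mathbf{Y}=(\mathbf{x}_1\otimes\mathbf{y}_1,\dots,\mathbf{x}_R\otimes\mathbf{y}_R)$ with $\otimes$ the Kronecker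 product. With $\mathbf{D}_{\bm\alpha}=\mathrm{diag}(\alpha_1,\dots,\alpha_R)$, put $\mathbf{U}=\mathbf{D}_{\bm\alpha}(\mathbf{Z}\odot\mathbf{Y})^T$, $\mathbf{V}=\mathbf{D}_{\bm\alpha}(\mathbf{Z}\odot\mathbf{X})^T$, $\mathbf{W}=\mathbf{D}_{\bm\alpha}(\mathbf{Y}\odot\mathbf{X})^T$, and let $\mathbf{Q}\in\mathbb{R}^{R\times IJK}$ be the matrix whose $r$-th row is the vectorization of $\mathbf{x}_r\circ\mathbf{y}_r\circ\mathbf{z}_r$. LRAT algorithm. Input: $\mathcal{A}$, $R$ (upper bound of $\mathrm{rank}(\mathcal{A})$), $\lambda$, $s>1$. Start from $\bm{\omega}^0=(\mathbf{X}^0,\mathbf{Y}^0,\mathbf{Z}^0,\bm{\alpha}^0)$ with $\mathbf{X}^0\in S_1$, $\mathbf{Y}^0\in S_2$, $\mathbf{Z}^0\in S_3$. For $n=0,1,2,\dots$: (1) $\mathbf{U}^n$ is $\mathbf{U}$ computed from $(\bm{\alpha}^n,\mathbf{Y}^n,\mathbf{Z}^n)$, $d_n=\max\{\|\mathbf{U}^n{\mathbf{U}^n}^T\|_F,1\}$, $\mathbf{D}^n=\mathbf{X}^n-\frac{1}{sd_n}\nabla_{\mathbf{X}}f(\mathbf{X}^n,\mathbf{Y}^n,\mathbf{Z}^n,\bm{\alpha}^n)$, and $\mathbf{X}^{n+1}$ is obtained from $\mathbf{D}^n$ by dividing each column by its Euclidean norm. (2) $\mathbf{V}^n$ is $\mathbf{V}$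 computed from $(\bm{\alpha}^n,\mathbf{X}^{n+1},\mathbf{Z}^n)$, $e_n=\max\{\|\mathbf{V}^n{\mathbf{V}^n}^T\|_F,1\}$, $\mathbf{E}^n=\mathbf{Y}^n-\frac{1}{se_n}\nabla_{\mathbf{Y}}f(\mathbf{X}^{n+1},\mathbf{Y}^n,\mathbf{Z}^n,\bm{\alpha}^n)$, and $\mathbf{Y}^{n+1}$ is obtained from $\mathbf{E}^n$ by dividing each column by its norm. (3) $\mathbf{W}^n$ is $\mathbf{W}$ computed from $(\bm{\alpha}^n,\mathbf{X}^{n+1},\mathbf{Y}^{n+1})$, $f_n=\max\{\|\mathbf{W}^n{\mathbf{W}^n}^T\|_F,1\}$, $\mathbf{F}^n=\mathbf{Z}^n-\frac{1}{sf_n}\nabla_{\mathbf{Z}}f(\mathbf{X}^{n+1},\mathbf{Y}^{n+1},\mathbf{Z}^n,\bm{\alpha}^n)$, and $\mathbf{Z}^{n+1}$ is obtained from $\mathbf{F}^n$ by dividing each column by its norm. (4) $\mathbf{Q}^{n+1}$ is $\mathbf{Q}$ computed from $(\mathbf{X}^{n+1},\mathbf{Y}^{n+1},\mathbf{Z}^{n+1})$, $\eta_n=\max\{\|\mathbf{Q}^{n+1}{\mathbf{Q}^{n+1}}^T\|_F,1\}$, $\bm{\beta}^{n+1}=\bm{\alpha}^n-\frac{1}{s\eta_n}\nabla_{\bm{\alpha}}f(\mathbf{X}^{n+1},\mathbf{Y}^{n+1},\mathbf{Z}^{n+1},\bm{\alpha}^n)$, and $\bm{\alpha}^{n+1}=\mathcal{S}_{\lambda/(s\eta_n)}(\bm{\beta}^{n+1})$,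 where $\mathcal{S}_\tau$ is componentwise soft thresholding, $\mathcal{S}_\tau(t)=\mathrm{sgn}(t)\max\{|t|-\tau,0\}$. A sequence generated by the algorithm is understood to be one for which all columns of $\mathbf{D}^n,\mathbf{E}^n,\mathbf{F}^n$ are nonzero, so that the normalizations are defined. *)

(* Defs.v *)
From HB Require Import structures.
From mathcomp Require Import all_boot all_order all_algebra.
From mathcomp Require Import all_classical all_reals all_analysis.
From mathcomp Require Export mxtens.
Set Implicit Arguments.
Unset Strict Implicit.
Unset Printing Implicit Defensive.
Import Order.TTheory GRing.Theory Num.Theory.
Import numFieldNormedType.Exports.
Local Open Scope classical_set_scope.
Local Open Scope ring_scope.

Definition tensor (R : realType) (I J K : nat) :=
  {ffun 'I_I * 'I_J * 'I_K -> R}.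

Definition outer (R : realType) (I J K : nat)
    (x : 'cV[R]_I) (y : 'cV[R]_J) (z : 'cV[R]_K) : tensor R I J K :=
  [ffun p => x p.1.1 0 * y p.1.2 0 * z p.2 0].

Definition sum_of_outer (R : realType) (I J K : nat) (A : tensor R I J K)
    (n : nat) : Prop :=
  exists (x : 'I_n -> 'cV[R]_I) (y : 'I_n -> 'cV[R]_J) (z : 'I_n -> 'cV[R]_K),
    A = \sum_(c < n) outer (x c) (y c) (z c).

Lemma ex_sum_of_outer (R : realType) (I J K : nat) (A : tensor R I J K) :
  exists n, `[< sum_of_outer A n >].
Proof.
pose T := ('I_I * 'I_J * 'I_K)%type.
exists #|{: T}|; apply/asboolP.
exists (fun c => A (enum_val c) *: delta_mx (enum_val c).1.1 0),
  (fun c => delta_mx (enum_val c).1.2 0), (fun c => delta_mx (enum_val c).2 0).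
apply/ffunP => q; rewrite sum_ffunE.
rewrite (bigD1 (enum_rank q)) //= big1 => [|c cq].
  by rewrite ffunE enum_rankK !mxE !eqxx !mulr1 addr0.
rewrite ffunE !mxE !eqxx !andbT -!mulrA -!natrM !mulnb andbA.
case: eqP => [e1|] /=; last by rewrite mulr0.
case: eqP => [e2|] /=; last by rewrite mulr0.
case: eqP => [e3|] /=; last by rewrite mulr0.
have qe : q = enum_val c.
  by case: q e1 e2 e3 {cq} => [[? ?] ?]; case: (enum_val c) => [[? ?] ?] /= -> -> ->.
by rewrite qe enum_valK eqxx in cq.
Qed.

Definition tensor_rank (R : realType) (I J K : nat) (A : tensor R I J K) : nat :=
  ex_minn (ex_sum_of_outer A).

(* [a; X, Y, Z]_r *)
Definition cp (R : realType) (I J K r : nat) (a : 'rV[R]_r)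
    (X : 'M[R]_(I, r)) (Y : 'M[R]_(J, r)) (Z : 'M[R]_(K, r)) : tensor R I J K :=
  \sum_(c < r) a 0 c *: outer (col c X) (col c Y) (col c Z).

(* The library norm on matrices is the maximum norm; it induces the same
   topology, but the Euclidean quantities below are needed explicitly. *)
Definition frob (R : realType) (m n : nat) (M : 'M[R]_(m, n)) : R :=
  Num.sqrt (\sum_i \sum_j M i j ^+ 2).

Definition tensor_frob (R : realType) (I J K : nat) (T : tensor R I J K) : R :=
  Num.sqrt (\sum_p T p ^+ 2).

Definition norm1 (R : realType) (r : nat) (a : 'rV[R]_r) : R :=
  \sum_c `|a 0 c|.

Definition unit_cols (R : realType) (m r : nat) : set 'M[R]_(m, r) :=
  [set M | forall c, frob (col c M) = 1].

Definition indicator (R : realType) (T : Type) (S : set T) (x : T) : \bar R :=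
  if `[< S x >] then 0%E else +oo%E.

(* The space of the variables omega = (X, Y, Z, alpha). *)
Definition var_space (R : realType) (I J K r : nat) : normedModType R :=
  ('M[R]_(I, r) * 'M[R]_(J, r) * 'M[R]_(K, r) * 'rV[R]_r)%type.

Definition objective (R : realType) (I J K r : nat) (A : tensor R I J K)
    (X : 'M[R]_(I, r)) (Y : 'M[R]_(J, r)) (Z : 'M[R]_(K, r)) (a : 'rV[R]_r) : R :=
  2^-1 * tensor_frob (A - cp a X Y Z) ^+ 2.

Definition Psi (R : realType) (I J K r : nat) (A : tensor R I J K) (lambda : R)
    (w : var_space R I J K r) : \bar R :=
  let: (X, Y, Z, a) := w in
  ((objective A X Y Z a)%:E + (lambda * norm1 a)%:E
   + indicator R (@unit_cols R I r) X + indicator R (@unit_cols R J r) Y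
   + indicator R (@unit_cols R K r) Z)%E.

Definition frob_dot (R : realType) (m n : nat) (M N : 'M[R]_(m, n)) : R :=
  \sum_i \sum_j M i j * N i j.

Definition point_dot (R : realType) (I J K r : nat) (v w : var_space R I J K r) : R :=
  let: (X, Y, Z, a) := v in let: (X', Y', Z', a') := w in
  frob_dot X X' + frob_dot Y Y' + frob_dot Z Z' + frob_dot a a'.

(* Subdifferentials on a finite-dimensional space V with inner product dot;
   the quotient uses the Euclidean norm associated with dot. *)
Definition frechet_subdiff (R : realType) (V : normedModType R)
    (dot : V -> V -> R) (h : V -> \bar R) (x : V) : set V :=
  [set u | h x \is a fin_num /\
    (0 <= limf_einf (fun y : V =>
            (h y - h x - (dot u (y - x))%:E)
            * ((Num.sqrt (dot (y - x) (y - x)))^-1)%:E) x^')%E].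

Definition limiting_subdiff (R : realType) (V : normedModType R)
    (dot : V -> V -> R) (h : V -> \bar R) (x : V) : set V :=
  [set u | h x \is a fin_num /\
    exists (xs us : nat -> V),
      [/\ xs @ \oo --> x, (fun k => h (xs k)) @ \oo --> h x,
          (forall k, frechet_subdiff dot h (xs k) (us k)) & us @ \oo --> u]].

Definition critical_point (R : realType) (V : normedModType R)
    (dot : V -> V -> R) (h : V -> \bar R) (x : V) : Prop :=
  limiting_subdiff dot h x 0.

Definition khatri_rao (R : realType) (m n r : nat)
    (X : 'M[R]_(m, r)) (Y : 'M[R]_(n, r)) : 'M[R]_(m * n, r) :=
  \matrix_(i, c) (col c X *t col c Y) i 0.

(* U, V, W are Umat a Y Z, Umat a X Z, Umat a X Y. *)
Definition Umat (R : realType) (m n r : nat) (a : 'rV[R]_r)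
    (Y : 'M[R]_(m, r)) (Z : 'M[R]_(n, r)) : 'M[R]_(r, n * m) :=
  diag_mx a *m (khatri_rao Z Y)^T.

(* Entries are listed in lexicographic order of (i, j, k). *)
Definition vect (R : realType) (I J K : nat) (T : tensor R I J K) :
    'rV[R]_(I * J * K) :=
  \row_t let p := mxtens_unindex t in
         let q := mxtens_unindex p.1 in T (q.1, q.2, p.2).

Definition Qmat (R : realType) (I J K r : nat)
    (X : 'M[R]_(I, r)) (Y : 'M[R]_(J, r)) (Z : 'M[R]_(K, r)) :
    'M[R]_(r, I * J * K) :=
  \matrix_(c < r) vect (outer (col c X) (col c Y) (col c Z)).

Definition grad (R : realType) (m n : nat) (h : 'M[R]_(m, n) -> R)
    (M : 'M[R]_(m, n)) : 'M[R]_(m, n) :=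
  \matrix_(i, j) 'D_(delta_mx i j) h M.

Definition step_const (R : realType) (m n : nat) (M : 'M[R]_(m, n)) : R :=
  Num.max (frob (M *m M^T)) 1.

Definition grad_step (R : realType) (m n : nat) (s d : R)
    (h : 'M[R]_(m, n) -> R) (M : 'M[R]_(m, n)) : 'M[R]_(m, n) :=
  M - (s * d)^-1 *: grad h M.

Definition nonzero_cols (R : realType) (m r : nat) (M : 'M[R]_(m, r)) : Prop :=
  forall c, col c M != 0.

Definition normalize_cols (R : realType) (m r : nat) (M : 'M[R]_(m, r)) :
    'M[R]_(m, r) :=
  \matrix_(i, c) (M i c / frob (col c M)).

Definition soft_threshold (R : realType) (tau t : R) : R :=
  Num.sg t * Num.max (`|t| - tau) 0.

Definition lrat_step (R : realType) (I J K r : nat) (A : tensor R I J K)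
    (lambda s : R) (w w' : var_space R I J K r) : Prop :=
  let: (X, Y, Z, a) := w in let: (X', Y', Z', a') := w' in
  let D := grad_step s (step_const (Umat a Y Z))
             (fun M => objective A M Y Z a) X in
  let E := grad_step s (step_const (Umat a X' Z))
             (fun M => objective A X' M Z a) Y in
  let F := grad_step s (step_const (Umat a X' Y'))
             (fun M => objective A X' Y' M a) Z in
  let eta := step_const (Qmat X' Y' Z') in
  let beta := grad_step s eta (fun b => objective A X' Y' Z' b) a in
  [/\ nonzero_cols D /\ X' = normalize_cols D,
      nonzero_cols E /\ Y' = normalize_cols E,
      nonzero_cols F /\ Z' = normalize_cols F
    & a' = map_mx (soft_threshold (lambda / (s * eta))) beta].

Definition lrat_sequence (R : realType) (I J K r : nat) (A : tensor R I J K)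
    (lambda s : R) (w : nat -> var_space R I J K r) : Prop :=
  (let: (X, Y, Z, _) := w 0%N in
   [/\ unit_cols X, unit_cols Y & unit_cols Z])
  /\ forall n, lrat_step A lambda s (w n) (w n.+1).

(* Main.v *)
(** The sequence decreases [Psi] by a multiple of the squared step length, and
    the step length bounds a subgradient of [Psi] at the next iterate. By
    telescoping it converges, with finite length, as soon as [Psi] satisfies a
    Kurdyka-Lojasiewicz inequality on the bounded region visited.

    That inequality is obtained on each stratum where the signs of [alpha] are
    fixed, so that [Psi] is a polynomial [F] on a compact semialgebraic set.
    Among the points of level [t] one selects, lexicographically, a point [x(t)]
    of least slope. By quantifier elimination the curve [x] is semialgebraic,
    hence its coordinates and its slope are monotone near [0]; the length of the
    curve is then a desingularizing function [phi], because over short intervals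
    the growth of [F] along the curve is at most slope times length. *)
Require Import Defs.
From HB Require Import structures.
From mathcomp Require Import all_boot all_order all_algebra.
From mathcomp Require Import all_classical all_reals all_analysis.
From mathcomp Require ordered_qelim qe_rcf polyrcf.
From mathcomp Require Import ring lra.
Set Implicit Arguments.
Unset Strict Implicit.
Unset Printing Implicit Defensive.
Import Order.TTheory GRing.Theory Num.Theory.
Import numFieldNormedType.Exports.
Local Open Scope classical_set_scope.
Local Open Scope ring_scope.

(** The inequality is kept in the integrated form [F x - a <= g * (phi (F x) - phi a)]. This is
    exactly what telescopes along the iterates, so [phi] need be neither differentiable nor concave,
    and no semialgebraic function is ever differentiated. Slopes carry a quadratic error [L]. The
    error is forced by the constraints: a displacement between two points of a sphere is tangential
    only to second order, so the multiplier part of a subgradient is invisible only up to that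
    order. The same error absorbs the Taylor remainder of the objective. It is removed along the
    selected curve by bisection, because the estimate there may be applied to arbitrarily short
    intervals. Since all coordinates of the curve are monotone, its length in the sum norm is a
    signed sum of coordinates, and no rectifiability argument is needed. Fixing signs makes the l1
    norm linear. The strata are closed and may overlap; being finitely many, their functions [phi]
    are simply added. The reference level is the infimum of the values along the sequence, and the
    inequality is uniform on a bounded region, so no cluster point has to be selected beforehand. *)

Module ord := ordered_qelim.ord.

(** * Semialgebraic predicates *)

Inductive polyfun (R : realType) : ((nat -> R) -> R) -> Prop :=
| polyfun_var i : polyfun (fun v => v i)
| polyfun_const c : polyfun (fun=> c)
| polyfunD p q : polyfun p -> polyfun q -> polyfun (fun v => p v + q v)
| polyfunM p q : polyfun p -> polyfun q -> polyfun (fun v => p v * q v).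

(** Quantifier-free formulas with real parameters, read as predicates on infinite environments.
    Quantifiers are left out on purpose: induction then reduces every germ to signs of polynomials,
    and closure under quantifiers becomes a theorem. *)
Inductive definable (R : realType) : ((nat -> R) -> Prop) -> Prop :=
| definable_gt0 p : polyfun p -> definable (fun v => 0 < p v)
| definable_and P Q : definable P -> definable Q ->
    definable (fun v => P v /\ Q v)
| definable_not P : definable P -> definable (fun v => ~ P v).

Definition cons_env (R : realType) (a : R) (v : nat -> R) : nat -> R :=
  fun i => if i is j.+1 then v j else a.

Section Definable.
Variable R : realType.
Implicit Types (p q : (nat -> R) -> R) (P Q : (nat -> R) -> Prop) (v : nat -> R).

Lemma eq_polyfun p q : (forall v, p v = q v) -> polyfun p -> polyfun q.
Proof. by move=> /funext ->. Qed.

Lemma eq_definable P Q : (forall v, P v <-> Q v) -> definable P -> definable Q.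
Proof. by move=> PQ; rewrite (_ : P = Q) //; apply/funext => v; apply/propext. Qed.

Lemma polyfunN p : polyfun p -> polyfun (fun v => - p v).
Proof.
move=> pp; apply: (eq_polyfun (p := fun v => -1 * p v)) => [v|].
  by rewrite mulN1r.
by apply: polyfunM => //; apply: polyfun_const.
Qed.

Lemma polyfunB p q : polyfun p -> polyfun q -> polyfun (fun v => p v - q v).
Proof. by move=> pp qq; apply: polyfunD => //; apply: polyfunN. Qed.

Lemma polyfunX p n : polyfun p -> polyfun (fun v => p v ^+ n).
Proof.
move=> pp; elim: n => [|n ih]; first exact: (polyfun_const 1).
apply: eq_polyfun (polyfunM pp ih) => v; by rewrite exprS.
Qed.

Lemma polyfun_sum (T : Type) (s : seq T) (C : pred T) (p : T -> (nat -> R) -> R) :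
  (forall i, C i -> polyfun (p i)) -> polyfun (fun v => \sum_(i <- s | C i) p i v).
Proof.
move=> pp; elim: s => [|i s ih].
  by apply: eq_polyfun (polyfun_const 0) => v; rewrite big_nil.
case: (boolP (C i)) => Ci.
  by apply: eq_polyfun (polyfunD (pp i Ci) ih) => v; rewrite big_cons Ci.
by apply: eq_polyfun ih => v; rewrite big_cons (negbTE Ci).
Qed.

Lemma definable_or P Q : definable P -> definable Q ->
  definable (fun v => P v \/ Q v).
Proof.
move=> dP dQ; apply: (eq_definable (P := fun v => ~ (~ P v /\ ~ Q v))) => [v|].
  by split; [move=> /not_andP[] /contrapT; [left|right]|move=> [?|?] []].
by apply: definable_not; apply: definable_and; apply: definable_not.
Qed.

Lemma definable_imp P Q : definable P -> definable Q ->
  definable (fun v => P v -> Q v).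
Proof.
move=> dP dQ; apply: (eq_definable (P := fun v => ~ P v \/ Q v)) => [v|].
  split; first by case=> // ? ?.
  by move=> PQ; have [/PQ|] := pselect (P v); [right|left].
by apply: definable_or => //; apply: definable_not.
Qed.

Lemma definable_lt p q : polyfun p -> polyfun q -> definable (fun v => p v < q v).
Proof.
move=> pp qq; apply: eq_definable (definable_gt0 (polyfunB qq pp)) => v.
by rewrite subr_gt0.
Qed.

Lemma definable_le p q : polyfun p -> polyfun q -> definable (fun v => p v <= q v).
Proof.
move=> pp qq; apply: eq_definable (definable_not (definable_lt qq pp)) => v.
by rewrite leNgt; split=> /negP.
Qed.

Lemma definable_eq p q : polyfun p -> polyfun q -> definable (fun v => p v = q v).
Proof.
move=> pp qq.
apply: eq_definable (definable_and (definable_le pp qq) (definable_le qq pp)) => v.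
by split=> [[? ?]|->//]; apply/eqP; rewrite eq_le; apply/andP.
Qed.

Lemma definable_true : definable (fun _ : nat -> R => True).
Proof.
apply: eq_definable (definable_gt0 (polyfun_const 1)) => v.
by rewrite ltr01.
Qed.

Lemma definable_cst (B : Prop) : definable (fun _ : nat -> R => B).
Proof.
have [b|nb] := pselect B; first by apply: eq_definable definable_true.
by apply: eq_definable (definable_not definable_true).
Qed.

Lemma definable_all (T : finType) (P : T -> (nat -> R) -> Prop) :
  (forall i, definable (P i)) -> definable (fun v => forall i, P i v).
Proof.
move=> dP.
suff : forall s : seq T, definable (fun v => forall i, i \in s -> P i v).
  move=> /(_ (enum T)); apply: eq_definable => v.
  by split=> h i; [apply: h; rewrite mem_enum|move=> _; apply: h].
elim=> [|j s ih]; first by apply: eq_definable definable_true.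
apply: eq_definable (definable_and (dP j) ih) => v; split.
  by move=> [h1 h2] i; rewrite inE => /orP[/eqP ->//|/h2].
by move=> h; split=> [|i si]; apply: h; rewrite inE ?eqxx// si orbT.
Qed.

Lemma polyfun_subst (s : nat -> (nat -> R) -> R) p :
  (forall i, polyfun (s i)) -> polyfun p -> polyfun (fun v => p (fun i => s i v)).
Proof.
move=> ss; elim=> [i|c|p1 p2 _ h1 _ h2|p1 p2 _ h1 _ h2].
- exact: ss.
- exact: polyfun_const.
- exact: polyfunD.
- exact: polyfunM.
Qed.

Lemma definable_subst (s : nat -> (nat -> R) -> R) P :
  (forall i, polyfun (s i)) -> definable P ->
  definable (fun v => P (fun i => s i v)).
Proof.
move=> ss; elim=> [p pp|P1 P2 _ h1 _ h2|P1 _ h1].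
- by apply: definable_gt0; apply: polyfun_subst.
- exact: definable_and.
- exact: definable_not.
Qed.

Lemma polyfun_term p : polyfun p -> exists (t : GRing.term R) (b : nat),
  GRing.rterm t /\ forall v (n : nat), (b <= n)%N -> GRing.eval (mkseq v n) t = p v.
Proof.
elim=> [i|c|p1 p2 _ [t1 [b1 [r1 h1]]] _ [t2 [b2 [r2 h2]]]
  |p1 p2 _ [t1 [b1 [r1 h1]]] _ [t2 [b2 [r2 h2]]]].
- exists (GRing.Var _ i), i.+1; split=> // v n lt_in.
  by rewrite /= nth_mkseq.
- by exists (GRing.Const c), 0%N.
- exists (GRing.Add t1 t2), (maxn b1 b2); split=> [|v n]; first exact/andP.
  by rewrite geq_max => /andP[? ?] /=; rewrite h1 ?h2.
- exists (GRing.Mul t1 t2), (maxn b1 b2); split=> [|v n]; first exact/andP.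
  by rewrite geq_max => /andP[? ?] /=; rewrite h1 ?h2.
Qed.

Lemma definable_formula P : definable P -> exists (f : ord.formula R) (b : nat),
  [/\ ord.qf_form f, ord.rformula f &
    forall v (n : nat), (b <= n)%N -> ord.holds (mkseq v n) f <-> P v].
Proof.
elim=> [p /polyfun_term[t [b [rt ht]]]|P1 P2 _ [f1 [b1 [q1 r1 h1]]]
   _ [f2 [b2 [q2 r2 h2]]]|P1 _ [f1 [b1 [q1 r1 h1]]]].
- exists (ord.Lt (GRing.Const 0) t), b; split=> // v n bn /=.
  by rewrite ht.
- exists (ord.And f1 f2), (maxn b1 b2); split=> [||v n]; try exact/andP.
  by rewrite geq_max => /andP[? ?] /=; rewrite h1 // h2.
- exists (ord.Not f1), b1; split=> // v n bn /=; by rewrite h1.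
Qed.

Lemma polyfun_eval (e : (nat -> R) -> seq R) (t : GRing.term R) :
  (forall i, polyfun (fun v => (e v)`_i)) -> GRing.rterm t ->
  polyfun (fun v => GRing.eval (e v) t).
Proof.
move=> pe; elim: t => //=.
- by move=> c _; apply: polyfun_const.
- by move=> n _; apply: polyfun_const.
- by move=> t1 h1 t2 h2 /andP[/h1 ? /h2 ?]; apply: polyfunD.
- by move=> t1 h1 /h1; apply: polyfunN.
- move=> t1 h1 n /h1 p1.
  apply: eq_polyfun (polyfunM p1 (polyfun_const n%:R)) => v.
  by rewrite mulr_natr.
- by move=> t1 h1 t2 h2 /andP[/h1 ? /h2 ?]; apply: polyfunM.
- by move=> t1 h1 n /h1; apply: polyfunX.
Qed.

Lemma definable_holds (e : (nat -> R) -> seq R) (f : ord.formula R) :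
  (forall i, polyfun (fun v => (e v)`_i)) -> ord.qf_form f -> ord.rformula f ->
  definable (fun v => ord.holds (e v) f).
Proof.
move=> pe; elim: f => //=.
- by move=> b _ _; apply: definable_cst.
- by move=> t1 t2 _ /andP[r1 r2]; apply: definable_eq; apply: polyfun_eval.
- by move=> t1 t2 _ /andP[r1 r2]; apply: definable_lt; apply: polyfun_eval.
- by move=> t1 t2 _ /andP[r1 r2]; apply: definable_le; apply: polyfun_eval.
- by move=> f1 h1 f2 h2 /andP[? ?] /andP[? ?]; apply: definable_and; auto.
- by move=> f1 h1 f2 h2 /andP[? ?] /andP[? ?]; apply: definable_or; auto.
- by move=> f1 h1 f2 h2 /andP[? ?] /andP[? ?]; apply: definable_imp; auto.
- by move=> f1 h1 ? ?; apply: definable_not; auto.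
Qed.

(** This is where quantifier elimination over real closed fields enters. The bound variable has
    index 0 and the free ones are shifted by one. *)
Lemma definable_ex_env P : definable P ->
  definable (fun v => exists a, P (cons_env a v)).
Proof.
move=> /definable_formula[f [b [qf rf hf]]].
pose g := ord.quantifier_elim (fun n s => qe_rcf.qfr_to_formula (@qe_rcf.wproj R n s)) (ord.Exists 0 f).
have rE : ord.rformula (ord.Exists 0 f) by [].
have /andP[qg rg] : ord.qf_form g && ord.rformula g.
  exact: (ord.quantifier_elim_wf (@qe_rcf.wf_QE_wproj R) rE).
(* The leading 0 only reserves the slot that [Exists 0] overwrites. *)
pose e v : seq R := 0 :: mkseq v b.
have pe i : polyfun (fun v => (e v)`_i).
  rewrite /e; case: i => [|i] /=; first exact: polyfun_const.
  have [ib|bi] := ltnP i b.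
    by apply: eq_polyfun (polyfun_var R i) => v; rewrite nth_mkseq.
  apply: eq_polyfun (polyfun_const 0) => v.
  by rewrite nth_default // size_mkseq.
apply: eq_definable (definable_holds pe qg rg) => v.
have gP : ord.holds (e v) g <-> ord.holds (e v) (ord.Exists 0 f).
  split.
    move=> /(ord.qf_evalP _ qg) h.
    exact/(ord.quantifier_elim_rformP (@qe_rcf.wf_QE_wproj R) (@qe_rcf.valid_QE_wproj R) _ rE).
  move=> h; apply/(ord.qf_evalP _ qg).
  exact/(ord.quantifier_elim_rformP (@qe_rcf.wf_QE_wproj R) (@qe_rcf.valid_QE_wproj R) _ rE).
rewrite gP /=.
have envE a : a :: mkseq v b = mkseq (cons_env a v) b.+1.
  by rewrite /mkseq /= (iotaDl 1 0) -map_comp.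
by split=> -[a]; rewrite ?envE => h; exists a; move: h; rewrite ?envE hf.
Qed.

Lemma definable_ex (Q : (nat -> R) -> R -> Prop) :
  definable (fun w => Q (fun i => w i.+1) (w 0%N)) ->
  definable (fun v => exists y, Q v y).
Proof. by move=> /definable_ex_env. Qed.

Lemma definable_forall (Q : (nat -> R) -> R -> Prop) :
  definable (fun w => Q (fun i => w i.+1) (w 0%N)) ->
  definable (fun v => forall y, Q v y).
Proof.
move=> /definable_not dQ.
apply: eq_definable (definable_not (definable_ex (Q := fun v y => ~ Q v y) dQ)) => v.
by split=> [h y|h [y]//]; apply: contrapT => nQ; apply: h; exists y.
Qed.

Lemma definable_ex_row N (Q : (nat -> R) -> 'rV[R]_N -> Prop) :
  definable (fun w => Q (fun i => w (N + i)%N) (\row_(k < N) w k)) ->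
  definable (fun v => exists x, Q v x).
Proof.
(* A whole sequence [y] is quantified although only its first [n] entries are read; the induction
   can then peel off one variable at a time. *)
suff aux n P : definable P -> definable (fun v => exists y : nat -> R,
    P (fun i => if (i < n)%N then y i else v (i - n)%N)).
  move=> /(aux N); apply: eq_definable => v; split=> [[y]|[x Qx]].
    rewrite (_ : (fun i => _) = v); last first.
      by apply/funext => i; rewrite ltnNge leq_addr /= addKn.
    by exists (\row_(k < N) (if (k < N)%N then y k else v (k - N)%N)).
  exists (fun i => if insub i is Some k then x 0 k else 0).
  rewrite (_ : (fun i => _) = v); last first.
    by apply/funext => i; rewrite ltnNge leq_addr /= addKn.
  rewrite (_ : \row_k _ = x) //; apply/rowP => k; rewrite mxE ltn_ord.
  by rewrite valK.
elim: n P => [|n ih] P dP.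
  apply: eq_definable dP => v; split.
    by move=> Pv; exists v; move: Pv; congr P; apply/funext => i; rewrite ltn0 subn0.
  by case=> y; congr P; apply/funext => i; rewrite ltn0 subn0.
have := ih _ (definable_ex_env dP); apply: eq_definable => v; split.
  case=> y [a Pa]; exists (cons_env a y).
  by move: Pa; congr P; apply/funext => -[|i] //=.
case=> y Py; exists (fun i => y i.+1), (y 0%N).
by move: Py; congr P; apply/funext => -[|i] //=.
Qed.

Lemma definable_forall_row N (Q : (nat -> R) -> 'rV[R]_N -> Prop) :
  definable (fun w => Q (fun i => w (N + i)%N) (\row_(k < N) w k)) ->
  definable (fun v => forall x, Q v x).
Proof.
move=> /definable_not dQ.
apply: eq_definable (definable_not (definable_ex_row (Q := fun v y => ~ Q v y) dQ)) => v.
by split=> [h y|h [y]//]; apply: contrapT => nQ; apply: h; exists y.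
Qed.

Lemma polyfun_poly p (e : R -> nat -> R) :
  (forall i, exists q : {poly R}, forall h, e h i = q.[h]) -> polyfun p ->
  exists q : {poly R}, forall h, p (e h) = q.[h].
Proof.
move=> pe; elim=> [i|c|p1 p2 _ [q1 h1] _ [q2 h2]|p1 p2 _ [q1 h1] _ [q2 h2]].
- exact: pe.
- by exists c%:P => h; rewrite hornerC.
- by exists (q1 + q2) => h; rewrite hornerD h1 h2.
- by exists (q1 * q2) => h; rewrite hornerM h1 h2.
Qed.

(** A nonzero polynomial keeps one sign to the right of 0 up to its next root, the search being cut
    off at 1. *)
Lemma poly_gt0_germ (q : {poly R}) :
  (exists2 d, 0 < d & forall h, 0 < h < d -> 0 < q.[h]) \/
  (exists2 d, 0 < d & forall h, 0 < h < d -> ~ 0 < q.[h]).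
Proof.
have [->|q0] := eqVneq q 0.
  by right; exists 1 => // h _; rewrite horner0 ltxx.
have [y] := polyrcf.neighpr_wit (ltr01 : 0 < 1 :> R) q0.
rewrite /polyrcf.neighpr in_itv /= => /andP[y0 yd].
have d0 := lt_trans y0 yd.
have qE h : 0 < h < polyrcf.next_root q 0 1 ->
    (0 < q.[h]) = (0 < polyrcf.sgp_right q 0).
  by move=> hd; rewrite -(@polyrcf.sgr_neighpr _ 1 q 0 h) ?sgr_gt0// in_itv.
have [s0|s0] := boolP (0 < polyrcf.sgp_right q 0); [left|right];
  by exists (polyrcf.next_root q 0 1) => // h /qE ->; rewrite ?s0//; apply/negP.
Qed.

(** Along a polynomial curve an atomic condition is the sign of one polynomial in [h], which settles
    near 0; conjunction and negation preserve the alternative. This is o-minimality in one variable: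
    no oscillation at 0. *)
Lemma definable_germ P (e : R -> nat -> R) :
  (forall i, exists q : {poly R}, forall h, e h i = q.[h]) -> definable P ->
  (exists2 d, 0 < d & forall h, 0 < h < d -> P (e h)) \/
  (exists2 d, 0 < d & forall h, 0 < h < d -> ~ P (e h)).
Proof.
move=> pe; elim=> [p /(polyfun_poly pe)[q pq]|P1 P2 _ [[d1 d10 h1]|[d1 d10 h1]]
   _ [[d2 d20 h2]|[d2 d20 h2]]|P1 _ [|]].
- have [[d d0 h]|[d d0 h]] := poly_gt0_germ q; [left|right].
    by exists d => // k /h; rewrite pq.
  by exists d => // k /h; rewrite pq.
- left; exists (Num.min d1 d2); first by rewrite lt_min d10.
  by move=> h; rewrite lt_min => /and3P[? ? ?]; split; [apply: h1|apply: h2]; apply/andP.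
- by right; exists d2 => // h /h2 n2 [].
- by right; exists d1 => // h /h1 n1 [].
- by right; exists d1 => // h /h1 n1 [].
- by case=> d d0 h; right; exists d => // k /h Pk; apply.
- by left.
Qed.

End Definable.

(** * Monotonicity of semialgebraic functions *)

Definition definable_fun (R : realType) (g : R -> R) :=
  definable (fun v : nat -> R => v 1%N = g (v 0%N)).

Definition near0 (R : realType) (P : R -> Prop) :=
  exists d, 0 < d /\ forall t, 0 < t -> t < d -> P t.

Section Monotone.
Variable R : realType.
Implicit Types (P Q : R -> Prop) (g : R -> R).

Lemma definable_fun_id : definable_fun (@id R).
Proof. by apply: definable_eq; apply: polyfun_var. Qed.

Lemma definable_graph g i j : definable_fun g ->
  definable (fun v : nat -> R => v j = g (v i)).
Proof.
move=> dg.
by apply: (definable_subst (s := fun k v => if k is 0%N then v i else v j) _ dg)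
  => -[|k]; apply: polyfun_var.
Qed.

(** Values of definable functions are not polynomials, so they are named by quantified variables
    tied to the graphs. *)
Lemma definable_rel (P : R -> R -> Prop) g h i j :
  definable_fun g -> definable_fun h ->
  definable (fun w : nat -> R => P (w 0%N) (w 1%N)) ->
  definable (fun v : nat -> R => P (g (v i)) (h (v j))).
Proof.
move=> dg dh dP.
apply: (eq_definable (P := fun v => exists y z,
   (z = g (v i) /\ y = h (v j)) /\ P z y)) => [v|].
  by split=> [[y [z [[-> ->]]]]//|Pgh]; exists (h (v j)), (g (v i)).
do 2 apply: definable_ex; apply: definable_and => //.
by apply: definable_and; apply: (definable_graph _ _ _).
Qed.

Lemma definable_fun_lt g h i j : definable_fun g -> definable_fun h ->
  definable (fun v : nat -> R => g (v i) < h (v j)).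
Proof.
move=> dg dh; apply: (definable_rel (P := fun x y => x < y)) => //.
by apply: definable_lt; apply: polyfun_var.
Qed.

Lemma definable_fun_le g h i j : definable_fun g -> definable_fun h ->
  definable (fun v : nat -> R => g (v i) <= h (v j)).
Proof.
move=> dg dh; apply: (definable_rel (P := fun x y => x <= y)) => //.
by apply: definable_le; apply: polyfun_var.
Qed.

Lemma definable_funN g : definable_fun g -> definable_fun (fun t => - g t).
Proof.
move=> dg.
apply: (definable_rel (P := fun x y => x = - y) 1 0 definable_fun_id dg).
by apply: definable_eq; [|apply: polyfunN]; apply: polyfun_var.
Qed.

Lemma definable_near0 (P : (nat -> R) -> R -> Prop) :
  definable (fun w => P (fun i => w i.+1) (w 0%N)) ->
  definable (fun v => near0 (P v)).
Proof.
move=> dP; apply: definable_ex; apply: definable_and.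
  by apply: definable_lt; [apply: polyfun_const|apply: polyfun_var].
apply: definable_forall; apply: definable_imp.
  by apply: definable_lt; [apply: polyfun_const|apply: polyfun_var].
apply: definable_imp; first by apply: definable_lt; apply: polyfun_var.
apply: (definable_subst (s := fun k v => if k is k'.+1 then v k'.+2 else v 0%N) _ dP).
by case=> [|k]; apply: polyfun_var.
Qed.

Lemma germ_right P (a : R) : definable (fun v => P (v 0%N)) ->
  (exists d, 0 < d /\ forall t, a < t -> t < a + d -> P t) \/
  (exists d, 0 < d /\ forall t, a < t -> t < a + d -> ~ P t).
Proof.
move=> dP.
have [|[d d0 h]|[d d0 h]] := definable_germ (e := fun h => cons_env (a + h) (fun=> 0)) _ dP.
- case=> [|i]; last by exists 0 => h; rewrite horner0.
  by exists (a%:P + 'X) => h; rewrite hornerD hornerC hornerX.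
- left; exists d; split=> // t at_ td.
  by have := h (t - a); rewrite /= subrKC; apply; rewrite subr_gt0 at_ ltrBlDl.
- right; exists d; split=> // t at_ td.
  by have := h (t - a); rewrite /= subrKC; apply; rewrite subr_gt0 at_ ltrBlDl.
Qed.

Lemma near0_dichotomy P : definable (fun v => P (v 0%N)) ->
  near0 P \/ near0 (fun t => ~ P t).
Proof.
by move=> /(germ_right 0)[] [d [d0 h]]; [left|right]; exists d; split=> // t t0 td;
  apply: h => //; rewrite add0r.
Qed.

Lemma near0_and P Q : near0 P -> near0 Q -> near0 (fun t => P t /\ Q t).
Proof.
move=> [d [d0 hP]] [e [e0 hQ]]; exists (Num.min d e); split=> [|t t0].
  by rewrite lt_min d0.
by rewrite lt_min => /andP[td te]; split; [apply: hP|apply: hQ].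
Qed.

Lemma near0_impl P Q : (forall t, 0 < t -> P t -> Q t) -> near0 P -> near0 Q.
Proof. by move=> PQ [d [d0 h]]; exists d; split=> // t t0 /h Pt; apply/PQ/Pt. Qed.

Lemma near0_ex P : near0 P -> exists t, 0 < t /\ P t.
Proof.
move=> [d [d0 h]]; exists (d / 2); split; first by rewrite divr_gt0.
by apply: h; rewrite ?divr_gt0// ltr_pdivrMr// ltr_pMr// ltr1n.
Qed.

Lemma near0_all (T : finType) (P : T -> R -> Prop) :
  (forall i, near0 (P i)) -> near0 (fun t => forall i, P i t).
Proof.
move=> nP.
suff : forall s : seq T, near0 (fun t => forall i, i \in s -> P i t).
  by move=> /(_ (enum T)); apply: near0_impl => t _ h i; apply: h; rewrite mem_enum.
elim=> [|j s ih]; first by exists 1; split.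
apply: near0_impl (near0_and (nP j) ih) => t _ [h1 h2] i.
by rewrite inE => /orP[/eqP ->//|/h2].
Qed.

(* The jump at [u] is witnessed by rationals [q] above [g u] and [p] to the
   right of [u], and a pair [(q, p)] serves at most one [u]. *)
Lemma jumps_countable (g : R -> R) (d : R) :
  0 < d ->
  (forall u, 0 < u -> u < d -> exists c, g u < c /\
     exists e, 0 < e /\ forall t, u < t -> t < u + e -> c <= g t) -> False.
Proof.
move=> d0 jump.
have wit u : exists qp : rat * rat, 0 < u -> u < d ->
    [/\ g u < ratr qp.1, u < ratr qp.2 &
      forall t, u < t -> t < ratr qp.2 -> ratr qp.1 < g t].
  have [/andP[u0 ud]|nu] := boolP (0 < u < d); last first.
    by exists (0, 0) => u0 ud; rewrite u0 ud in nu.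
  have [c [gc [e [e0 h]]]] := jump u u0 ud.
  have [q] := rat_in_itvoo gc; rewrite in_itv /= => /andP[q1 q2].
  have ue : u < u + e by rewrite ltrDl.
  have [p] := rat_in_itvoo ue.
  rewrite in_itv /= => /andP[p1 p2].
  exists (q, p) => _ _; split=> //= t ut tp.
  by apply: (lt_le_trans q2); apply: h => //; exact: lt_trans tp p2.
have [f fP] := choice wit.
have inj : {in `]0%R, d[%classic &, injective f}.
  move=> u v; rewrite !inE /= !in_itv /= => /andP[u0 ud] /andP[v0 vd] fuv.
  have [u1 u2 u3] := fP u u0 ud; have [v1 v2 v3] := fP v v0 vd.
  have [uv|vu|//] := ltgtP u v.
    have := u3 v uv; rewrite fuv => /(_ v2) /lt_trans/(_ v1).
    by rewrite ltxx.
  have := v3 u vu; rewrite -fuv => /(_ u2) /lt_trans/(_ u1).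
  by rewrite ltxx.
have cnt : countable `]0%R, d[%classic.
  apply/countable_injP.
  by exists (pickle \o f) => u v uI vI /= /(pcan_inj pickleK); apply: inj.
have := countable_lebesgue_measure0 cnt.
rewrite lebesgue_measure_itv /= lte_fin d0 sube0 => -[] /eqP.
by rewrite gt_eqF.
Qed.

(* Otherwise, by the dichotomy, no [s] near [0] is a record of [g]; then below
   each [s] there is an upward jump, so that every point near [0] is a jump. *)
Lemma near0_increasing g : definable_fun g ->
  near0 (fun s => near0 (fun t => g t < g s)) ->
  near0 (fun s => forall t, 0 < t -> t < s -> g t < g s).
Proof.
move=> dg [d1 [d10 hA]].
have did := definable_fun_id.
pose D s := forall t, 0 < t -> t < s -> g t < g s.
have dD : definable (fun v : nat -> R => D (v 0%N)).
  apply: definable_forall; apply: definable_imp.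
    by apply: definable_lt; [apply: polyfun_const|apply: polyfun_var].
  apply: definable_imp; first by apply: definable_lt; apply: polyfun_var.
  exact: definable_fun_lt.
have [//|[d2 [d20 hD]]] := near0_dichotomy (P := D) dD.
pose J u := exists c, g u < c /\
  exists e, 0 < e /\ forall t, u < t -> t < u + e -> c <= g t.
have dJ : definable (fun v : nat -> R => J (v 0%N)).
  apply: definable_ex; apply: definable_and; first exact: (definable_fun_lt 1 0 dg did).
  apply: definable_ex; apply: definable_and.
    by apply: definable_lt; [apply: polyfun_const|apply: polyfun_var].
  apply: definable_forall; apply: definable_imp.
    by apply: definable_lt; apply: polyfun_var.
  apply: definable_imp; last exact: (definable_fun_le 2 0 did dg).
  by apply: definable_lt; [|apply: polyfunD]; apply: polyfun_var.
have [[d [d0 hJ]]|[d3 [d30 hJ]]] := near0_dichotomy (P := J) dJ.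
  by case: (jumps_countable d0 hJ).
exfalso.
pose d := Num.min d1 (Num.min d2 d3).
have d0 : 0 < d by rewrite !lt_min d10 d20.
pose s0 := d / 2.
have s00 : 0 < s0 by rewrite divr_gt0.
have : s0 < d by rewrite ltr_pdivrMr// ltr_pMr// ltr1n.
rewrite !lt_min => /and3P[s01 s02 s03].
have [a [a0 ha]] := hA s0 s00 s01.
(* The times at which [g] reaches the level [g s0]. By hypothesis they stay away from 0, and their
   infimum [u] will turn out to be a jump. *)
pose E : set R := [set t | [/\ 0 < t, t <= s0 & g s0 <= g t]].
have Es0 : E s0 by [].
have Elb : lbound E a.
  move=> t [t0 _ gt]; rewrite leNgt; apply/negP => ta.
  by have := ha t t0 ta; rewrite ltNge gt.
have hE : has_inf E by split; [exists s0|exists a].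
pose u := inf E.
have au : a <= u by apply: lb_le_inf => //; exists s0.
have u0 : 0 < u by apply: lt_le_trans au.
have us0 : u <= s0 by apply: ge_inf => //; exists a.
(* If [u] were in [E], then, not being a record, it would have an earlier point with a value at
   least as large, hence an element of [E] below its infimum. *)
have nEu : ~ E u.
  move=> [_ _ gu].
  have /existsNP[t] := hD u u0 (le_lt_trans us0 s02).
  move=> /not_implyP[t0] /not_implyP[tu] /negP; rewrite -leNgt => gut.
  have : u <= t.
    apply: ge_inf; first by exists a.
    by split=> //; [apply: ltW; apply: lt_le_trans us0|apply: le_trans gut].
  by rewrite leNgt tu.
have gus : g u < g s0 by rewrite ltNge; apply/negP => h; apply: nEu.
have us : u < s0.
  by rewrite lt_neqAle us0 andbT; apply: contraTneq gus => ->; rewrite ltxx.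
have dE : definable (fun v : nat -> R => g s0 <= g (v 0%N)).
  apply: (eq_definable (P := fun v => exists y, y = g s0 /\ y <= g (v 0%N))) => [v|].
    by split=> [[y [->]]//|h]; exists (g s0).
  apply: definable_ex; apply: definable_and; last exact: (definable_fun_le 0 1 did dg).
  by apply: definable_eq; [apply: polyfun_var|apply: polyfun_const].
(* Just after [u], either [g] stays at or above [g s0], and [u] is an upward jump since
   [g u < g s0], or it stays below, and [E] has no elements close to its infimum. *)
have [[e [e0 he]]|[e [e0 he]]] := germ_right (P := fun t => g s0 <= g t) u dE.
  apply: (hJ u u0 (le_lt_trans us0 s03)).
  by exists (g s0); split=> //; exists e.
pose e' := Num.min e (s0 - u).
have e'0 : 0 < e' by rewrite lt_min e0 subr_gt0.
have [t [t0 ts gt] tu] := inf_adherent e'0 hE.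
rewrite -/u in tu.
have ut : u < t.
  rewrite lt_neqAle; apply/andP; split.
    by apply/eqP => ut; apply: nEu; rewrite ut.
  by apply: ge_inf => //; exists a.
apply: (he t ut _ gt); apply: lt_le_trans tu _.
by rewrite lerD2l ge_min lexx.
Qed.

(** For a fixed small [s] the sign of [g t - g s] settles as [t] tends to 0, and the case that
    occurs settles as [s] tends to 0. Values below give an increasing function, values above are the
    same case for the opposite of [g], and equality gives a constant. *)
Lemma definable_fun_monotone g : definable_fun g ->
  exists d, 0 < d /\
  ((forall s t, 0 < s -> s < t -> t < d -> g s <= g t) \/
   (forall s t, 0 < s -> s < t -> t < d -> g t <= g s)).
Proof.
move=> dg.
have dlt i j := definable_fun_lt i j dg dg.
have dA : definable (fun v : nat -> R => near0 (fun t => g t < g (v 0%N))).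
  by apply: (definable_near0 (P := fun v t => g t < g (v 0%N))); apply: dlt.
have dC : definable (fun v : nat -> R => near0 (fun t => g (v 0%N) < g t)).
  by apply: (definable_near0 (P := fun v t => g (v 0%N) < g t)); apply: dlt.
have [/(near0_increasing dg)[d [d0 h]]|nA] :=
    near0_dichotomy (P := fun s => near0 (fun t => g t < g s)) dA.
  exists d; split=> //; left => s t s0 st td.
  by apply/ltW/h => //; apply: lt_trans st.
have [hC|nC] :=
    near0_dichotomy (P := fun s => near0 (fun t => g s < g t)) dC.
  have [|d [d0 h]] := near0_increasing (definable_funN dg).
    by apply: near0_impl hC => s _; apply: near0_impl => t _; rewrite ltrN2.
  exists d; split=> //; right => s t s0 st td; rewrite -lerN2.
  by apply/ltW/h => //; apply: lt_trans st.
have [d [d0 hd]] : near0 (fun s => near0 (fun t => g t = g s)).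
  apply: near0_impl (near0_and nA nC) => s _ [nAs nCs].
  have d1 : definable (fun v : nat -> R => g (v 0%N) < g s).
    apply: (eq_definable (P := fun v => exists y, y = g s /\ g (v 0%N) < y)) => [v|].
      by split=> [[y [->]]//|h]; exists (g s).
    apply: definable_ex; apply: definable_and.
      by apply: definable_eq; [apply: polyfun_var|apply: polyfun_const].
    exact: (definable_fun_lt 1 0 dg definable_fun_id).
  have d2 : definable (fun v : nat -> R => g s < g (v 0%N)).
    apply: (eq_definable (P := fun v => exists y, y = g s /\ y < g (v 0%N))) => [v|].
      by split=> [[y [->]]//|h]; exists (g s).
    apply: definable_ex; apply: definable_and.
      by apply: definable_eq; [apply: polyfun_var|apply: polyfun_const].
    exact: (definable_fun_lt 0 1 definable_fun_id dg).
  have [//|n1] := near0_dichotomy (P := fun t => g t < g s) d1; have [//|n2] := near0_dichotomy (P := fun t => g s < g t) d2.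
  apply: near0_impl (near0_and n1 n2) => t _ [/negP + /negP].
  by rewrite -!leNgt => ? ?; apply/eqP; rewrite eq_le; apply/andP.
(* Both values are compared through a third point [a], close enough to 0 that [g a] equals each of
   them. *)
exists d; split=> //; left => s t s0 st td.
have [a [_ [<- <-]]//] := near0_ex (near0_and (hd s s0 (lt_trans st td)) (hd t (lt_trans s0 st) td)).
Qed.

End Monotone.

(** * Semialgebraic choice *)

Definition definable_family (R : realType) (N : nat) (S : R -> set 'rV[R]_N) :=
  definable (fun w : nat -> R => S (w 0%N) (\row_(k < N) w k.+1)).

Lemma closed_le_fun (R : realType) (T : topologicalType) (f g : T -> R) :
  continuous f -> continuous g -> closed [set x | f x <= g x].
Proof.
move=> cf cg.
rewrite (_ : [set x | _] = (f - g) @^-1` [set y | y <= 0]); last first.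
  by apply/seteqP; split=> x /=; rewrite /GRing.add /= subr_le0.
apply: preimage_closed; last exact: closed_le.
by move=> x _; apply: continuousB; [exact: cf|exact: cg].
Qed.

Section Choice.
Variables (R : realType) (N : nat).
Implicit Types (S : R -> set 'rV[R]_N).

Lemma definable_family_subst S p (q : 'I_N -> (nat -> R) -> R) :
  definable_family S -> polyfun p -> (forall k, polyfun (q k)) ->
  definable (fun w => S (p w) (\row_k q k w)).
Proof.
move=> dS pp qq.
pose s i := if i is j.+1 then if insub j is Some k then q k else fun=> 0 else p.
have ss i : polyfun (s i).
  case: i => [//|j] /=; case: insubP => [k _ _|_]; first exact: qq.
  exact: polyfun_const.
apply: eq_definable (definable_subst ss dS) => w /=.
suff -> : \row_(k < N) s k.+1 w = \row_k q k w by [].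
by apply/rowP => k; rewrite !mxE /= valK.
Qed.

Definition coord_min S (j : 'I_N) t : set 'rV[R]_N :=
  [set x | S t x /\ forall y, S t y -> x 0 j <= y 0 j].

Lemma definable_coord_min S j :
  definable_family S -> definable_family (coord_min S j).
Proof.
move=> dS; apply: definable_and => //.
pose Q (w : nat -> R) (y : 'rV[R]_N) := S (w 0%N) y -> w j.+1 <= y 0 j.
apply: (eq_definable (P := fun w => forall y, Q w y)) => [w|].
  by split=> h y /h; rewrite mxE.
apply: definable_forall_row; apply: definable_imp.
  by apply: (definable_family_subst (q := fun k w => w k)) => // *; apply: polyfun_var.
apply: (eq_definable (P := fun w => w (N + j.+1)%N <= w j)) => [w|].
  by rewrite mxE.
by apply: definable_le; apply: polyfun_var.
Qed.

Lemma coord_min_ex S j t : compact (S t) -> (exists x, S t x) ->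
  exists x, coord_min S j t x.
Proof.
move=> cS [x Sx].
have [||c cS' cmin] := compact_EVT_min (f := fun x : 'rV[R]_N => x 0 j) _ cS.
- by exists x.
- by apply: continuous_subspaceT; apply: coord_continuous.
exists c; split; first exact/set_mem.
by move=> y Sy; apply: cmin; apply/mem_set.
Qed.

Lemma compact_coord_min S j t : compact (S t) -> compact (coord_min S j t).
Proof.
move=> cS.
have [[x Sx]|nS] := pselect (exists x, S t x); last first.
  rewrite (_ : coord_min S j t = set0); first exact: compact0.
  by apply/seteqP; split=> // x [Sx _]; apply: nS; exists x.
have [c [Sc cmin]] := coord_min_ex j cS (ex_intro _ x Sx).
rewrite (_ : coord_min S j t = S t `&` [set x | x 0 j <= c 0 j]).
  apply: compact_closedI => //.
  apply: closed_le_fun; [exact: coord_continuous|exact: cst_continuous].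
apply/seteqP; split=> y [Sy h]; split=> //; first exact: h.
by move=> y' /cmin; apply: le_trans.
Qed.

(** One coordinate is minimized after another. Compactness survives each step and provides the next
    minimizer, while a coordinate already minimized is constant on what remains. *)
Lemma lexicographic_min S (s : seq 'I_N) : definable_family S ->
  (forall t, compact (S t)) -> exists S',
  [/\ definable_family S', forall t, S' t `<=` S t,
    forall t, (exists x, S t x) -> exists x, S' t x &
    forall t x y i, i \in s -> S' t x -> S' t y -> x 0 i = y 0 i].
Proof.
elim: s S => [|j s ih] S dS cS; first by exists S; split=> [//|t x //|t //|t x y i]; rewrite in_nil.
have [|S' [dS' sS' eS' uS']] := ih (coord_min S j) (definable_coord_min j dS).
  by move=> t; apply: compact_coord_min.
exists S'; split=> // [t x /sS'[]//|t h|t x y i].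
  by apply: eS'; apply: coord_min_ex.
rewrite inE => /orP[/eqP -> /sS'[Sx xm] /sS'[Sy ym]|]; last exact: uS'.
by apply/eqP; rewrite eq_le xm// ym.
Qed.

(** Minimizing the coordinate [j] first and then all coordinates leaves at most one point for each
    [t], so the selected point is described by a formula. The coordinate [j] is later the slope. *)
Lemma definable_choice S j : definable_family S -> (forall t, compact (S t)) ->
  exists z : R -> 'rV[R]_N,
  [/\ forall i, definable_fun (fun t => z t 0 i),
    forall t x, S t x -> S t (z t) &
    forall t x, S t x -> z t 0 j <= x 0 j].
Proof.
move=> dS cS.
have [|S' [dS' sS' eS' uS']] := lexicographic_min (enum 'I_N) (definable_coord_min j dS).
  by move=> t; apply: compact_coord_min.
(* Where [S t] is empty the value is 0; emptiness is itself definable, so this default does not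
   spoil the graph. *)
have /choice[z zP] t : exists x, if `[< exists x, S' t x >] then S' t x else x = 0.
  by case: asboolP => // _; exists 0.
have zS t x : S t x -> S' t (z t).
  move=> Sx; have := zP t; case: asboolP => // -[]; apply: eS'.
  by apply: coord_min_ex => //; exists x.
have S'u t x y : S' t x -> S' t y -> x = y.
  by move=> hx hy; apply/rowP => i; apply: (uS' t) => //; rewrite mem_enum.
exists z; split=> [i|t x /zS/sS'[]//|t x Sx]; last first.
  by have /sS'[_] := zS _ _ Sx; apply.
pose Q (w : nat -> R) (x : 'rV[R]_N) := S' (w 0%N) x /\ w 1%N = x 0 i.
pose Q' (w : nat -> R) (x : 'rV[R]_N) := S' (w 0%N) x.
have dQ' : definable (fun w => exists x, Q' w x).
  apply: definable_ex_row.
  by apply: (definable_family_subst (q := fun k w => w k)) => // *; apply: polyfun_var.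
apply: (eq_definable (P := fun w => (exists x, Q w x) \/
    (~ (exists x, Q' w x) /\ w 1%N = 0))) => [w|].
  have := zP (w 0%N); case: asboolP => [[x Sx] Sz|nS ->].
    split=> [[[y [Sy ->]]|[+ _]]|h].
    - by rewrite (S'u _ _ _ Sy Sz).
    - by case; exists x.
    - by left; exists (z (w 0%N)).
  rewrite mxE; split=> [[[y [Sy _]]|[]//]|h].
    by case: nS; exists y.
  by right.
apply: definable_or.
  apply: definable_ex_row; apply: definable_and.
    by apply: (definable_family_subst (q := fun k w => w k)) => // *; apply: polyfun_var.
  apply: (eq_definable (P := fun w => w (N + 1)%N = w i)) => [w|].
    by rewrite mxE.
  by apply: definable_eq; apply: polyfun_var.
apply: definable_and; first exact: definable_not.
by apply: definable_eq; [apply: polyfun_var|apply: polyfun_const].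
Qed.

End Choice.

(** * The Kurdyka-Lojasiewicz inequality *)

Lemma le_mx_norm (R : realType) m n (M : 'M[R]_(m, n)) (e : R) : 0 <= e ->
  (`|M| <= e <-> forall i j, `|M i j| <= e).
Proof.
move=> e0; rewrite /Num.norm /= mx_normrE; split=> [h i j|h].
  by apply: le_trans h; apply: (le_bigmax _ _ (i, j)).
by apply/bigmax_leP; split=> // -[i j] _; apply: h.
Qed.

Lemma mx_norm_entry (R : realType) m n (M : 'M[R]_(m, n)) i j : `|M i j| <= `|M|.
Proof. by have /(le_mx_norm M)[+ _] := normr_ge0 M; apply. Qed.

(* Halving an interval on which [b - a > 2 M (psi b - psi a)] produces
   arbitrarily short intervals with the same property; on those the quadratic
   term of the hypothesis is negligible. *)
Lemma le_of_local_le (R : realType) (psi : R -> R) (a b M L : R) :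
  0 <= M -> 0 <= L -> a < b ->
  (forall t t', a <= t -> t < t' -> t' <= b -> psi t <= psi t' /\
     t' - t <= M * (psi t' - psi t) + L * (psi t' - psi t) ^+ 2) ->
  b - a <= 2 * M * (psi b - psi a).
Proof.
move=> M0 L0 ab h.
have [pab _] := h a b (lexx _) ab (lexx _).
(* A strictly positive [M'] is needed to bound the increment of [psi] by a multiple of the interval
   length; [M] itself may be 0 and is reached by letting [e] tend to 0. *)
suff H M' : 0 < M' -> M <= M' -> b - a <= 2 * M' * (psi b - psi a).
  apply/ler_addgt0Pr => e e0.
  have v0 : 0 < psi b - psi a + 1 by rewrite ltr_wpDl// subr_ge0.
  have := H (M + e / 2 / (psi b - psi a + 1)).
  have e1 : 0 < e / 2 / (psi b - psi a + 1) by rewrite !divr_gt0.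
  rewrite ltr_wpDl// lerDl ltW// => /(_ isT isT) /le_trans; apply.
  have : e / 2 / (psi b - psi a + 1) * (psi b - psi a) <= e / 2.
    rewrite mulrAC ler_pdivrMr//; nra.
  nra.
move=> M'0 MM'; rewrite leNgt; apply/negP => H.
(* Bisection: the two halves have equal length and the increments of [psi] add up, so one half
   inherits the strict inequality. *)
have step k : exists t t', [/\ a <= t, t < t', t' <= b,
    t' - t = (b - a) / 2 ^+ k & 2 * M' * (psi t' - psi t) < t' - t].
  elim: k => [|k [t [t' [at_ tt tb tk th]]]].
    by exists a, b; rewrite expr0 divr1.
  pose m := (t + t') / 2.
  have tm : t < m by rewrite /m; lra.
  have mt : m < t' by rewrite /m; lra.
  have ek : (b - a) / 2 ^+ k.+1 = (t' - t) / 2.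
    by rewrite tk exprS invfM mulrA mulrAC.
  have [h1|h1] := ltP (2 * M' * (psi m - psi t)) (m - t).
    exists t, m; split=> //; first by rewrite (le_trans (ltW mt)).
    by rewrite ek /m; lra.
  exists m, t'; split=> //; first by rewrite (le_trans at_)// ltW.
    by rewrite ek /m; lra.
  have : m - t = t' - m by rewrite /m; lra.
  nra.
(* The interval becomes shorter than [2 * M' ^+ 2 / L], written without division since [L] may be 0.
   The quadratic term is then at most half of its length. *)
have [k kP] : exists k : nat, L * (b - a) < 2 ^+ k * (2 * M' ^+ 2).
  have c0 : 0 < 2 * M' ^+ 2 by rewrite mulr_gt0// exprn_gt0.
  have x0 : 0 <= L * (b - a) / (2 * M' ^+ 2).
    by rewrite !mulr_ge0 ?invr_ge0 ?subr_ge0 ?sqr_ge0// ltW.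
  exists (Num.bound (L * (b - a) / (2 * M' ^+ 2))).
  rewrite -ltr_pdivrMr//.
  apply: lt_trans (archi_boundP x0) _.
  by rewrite -natrX ltr_nat ltn_expl.
have [t [t' [at_ tt tb tk th]]] := step k.
have [p0] := h t t' at_ tt tb.
set d := psi t' - psi t in th *; set l := t' - t in tk th *.
have d0 : 0 <= d by rewrite subr_ge0.
have l0 : 0 < l by rewrite subr_gt0.
have lL : L * l < 2 * M' ^+ 2.
  by rewrite tk mulrA ltr_pdivrMr ?exprn_gt0// mulrC mulrC [ltRHS]mulrC.
apply/negP; rewrite -ltNge.
have h1 : M * d <= M' * d by rewrite ler_wpM2r.
suff : L * d ^+ 2 <= l / 2 by nra.
have h2 : (2 * M' * d) ^+ 2 <= l ^+ 2 by rewrite ler_pXn2r ?nnegrE ?mulr_ge0// ltW.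
have h3 : L * (2 * M' * d) ^+ 2 <= L * l ^+ 2 by rewrite ler_wpM2l.
have h4 : L * l ^+ 2 <= (2 * M' ^+ 2) * l by rewrite expr2 mulrA ler_wpM2r// ltW.
have : (2 * M' ^+ 2) * (2 * (L * d ^+ 2)) <= (2 * M' ^+ 2) * l.
  by apply: le_trans h4; apply: le_trans h3; rewrite le_eqVlt; apply/orP; left; apply/eqP; ring.
rewrite ler_pM2l; first by rewrite ler_pdivlMr// mulrC.
by rewrite mulr_gt0// exprn_gt0.
Qed.

(* A first-order substitute for a bound [g] on the gradient of [F] along [K],
   so that slopes are definable without differentiating. *)
Definition slope (R : realType) n (K : set 'rV[R]_n) (F : 'rV[R]_n -> R) (L : R)
    (g : R) (x : 'rV[R]_n) :=
  K x /\ forall x', K x' -> F x' - F x <= g * `|x' - x| + L * `|x' - x| ^+ 2.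

(** Slope and point are packed into one row, the slope first, so that the choice of a point of least
    slope minimizes a coordinate. The cap [B] makes the set compact. *)
Definition slope_graph (R : realType) n (K : set 'rV[R]_n) (F : 'rV[R]_n -> R)
    (L B : R) (t : R) : set 'rV[R]_(1 + n) :=
  [set y : 'rV[R]_(1 + n) | [/\ 0 <= y 0 (@lshift 1 n ord0), y 0 (@lshift 1 n ord0) <= B,
    slope K F L (y 0 (@lshift 1 n ord0)) (rsubmx y) & F (rsubmx y) = t]].

Section Desingularization.
Variables (R : realType) (n : nat) (K : set 'rV[R]_n) (F : 'rV[R]_n -> R) (L B : R).
Hypothesis cK : compact K.
Hypothesis dK : definable (fun w : nat -> R => K (\row_k w k)).
Hypothesis cF : continuous F.
Hypothesis pF : polyfun (fun w => F (\row_k w k)).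
Hypothesis L0 : 0 <= L.

(** The maximum norm is not a polynomial. It is replaced by every [r] that bounds the coordinate
    differences, which is equivalent because the right-hand side is nondecreasing in [r] when the
    slope and [L] are nonnegative. *)
Lemma definable_slope_graph : definable_family (slope_graph K F L B).
Proof.
pose x (w : nat -> R) : 'rV[R]_n := \row_k w k.+2.
apply: (eq_definable (P := fun w => (0 <= w 1%N /\ w 1%N <= B) /\
   ((K (x w) /\ forall x' r, (0 <= r /\ K x') /\
     (forall k, x' 0 k - w k.+2 <= r /\ w k.+2 - x' 0 k <= r) ->
     F x' - F (x w) <= w 1%N * r + L * r ^+ 2) /\ F (x w) = w 0%N))) => [w|].
  have yE : rsubmx (\row_(k < 1 + n) w k.+1) = x w.
    by apply/rowP => k; rewrite !mxE.
  rewrite /slope_graph /= yE mxE /=; split.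
    move=> [[g0 gB] [[Kx h] Fx]]; split=> //; split=> // x' Kx'.
    apply: h; split=> // k.
    have := mx_norm_entry (x' - x w) 0 k; rewrite !mxE ler_norml => /andP[h1 h2].
    by split=> //; rewrite lerNl opprB in h1.
  move=> [g0 gB [Kx h] Fx]; split=> //; split=> //; split=> // x' r [[r0 Kx'] hr].
  apply: le_trans (h x' Kx') _.
  have xr : `|x' - x w| <= r.
    apply/le_mx_norm => // i j; rewrite ord1 !mxE ler_norml.
    by have [h1 h2] := hr j; rewrite h1 andbT lerNl opprB.
  by apply: lerD; rewrite ler_wpM2l// ler_pXn2r// nnegrE.
have dv i : polyfun (fun w : nat -> R => w i) by apply: polyfun_var.
have dc c : polyfun (fun w : nat -> R => c) by apply: polyfun_const.
have pFx : polyfun (fun w => F (x w)).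
  exact: (polyfun_subst (s := fun i w => w i.+2) _ pF).
apply: definable_and; first by apply: definable_and; apply: definable_le.
apply: definable_and; last by apply: definable_eq.
apply: definable_and; first exact: (definable_subst (s := fun i w => w i.+2) _ dK).
apply: definable_forall_row; apply: definable_forall.
apply: definable_imp.
  apply: definable_and.
    apply: definable_and; first exact: definable_le.
    exact: (definable_subst (s := fun i w => w i.+1) _ dK).
  apply: definable_all => k.
  apply: (eq_definable (P := fun w => w k.+1 - w (n + k.+2).+1 <= w 0%N /\
    w (n + k.+2).+1 - w k.+1 <= w 0%N)) => [w|]; first by rewrite mxE.
  by apply: definable_and; apply: definable_le => //; apply: polyfunB.
apply: definable_le.
  apply: polyfunB; first exact: (polyfun_subst (s := fun i w => w i.+1) _ pF).
  exact: (polyfun_subst (s := fun i w => w (n + i).+1) _ pFx).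
apply: polyfunD; apply: polyfunM => //.
exact: polyfunX.
Qed.

Lemma compact_slope_graph t : compact (slope_graph K F L B t).
Proof.
apply: bounded_closed_compact.
  have [M [_ hM]] := compact_bounded cK.
  have := hM (Num.max M 0 + 1); rewrite ltr_pwDr ?le_max ?lexx// => /(_ isT) KM.
  exists (Num.max (Num.max M 0 + 1) B); split=> [|e]; first exact: num_real.
  rewrite gt_max => /andP[Me Be] y [g0 gB [Kx _] _] /=.
  apply/le_mx_norm; first by apply: ltW; apply: le_lt_trans Me; rewrite addr_ge0// le_max lexx orbT.
  move=> i j; rewrite ord1 {i}.
  case: (split_ordP j) => k ->.
    by rewrite ord1 ger0_norm//; apply: ltW; apply: le_lt_trans Be.
  have -> : y 0 (rshift 1 k) = rsubmx y 0 k by rewrite mxE.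
  apply: le_trans (mx_norm_entry _ _ _) _; apply: ltW; apply: le_lt_trans Me.
  exact: KM.
have cr : continuous (rsubmx : 'rV[R]_(1 + n) -> 'rV[R]_n) by exact: continuous_rsubmx.
have cg : continuous (fun y : 'rV[R]_(1 + n) => y 0 (@lshift 1 n ord0)).
  exact: coord_continuous.
have cFr : continuous (fun y : 'rV[R]_(1 + n) => F (rsubmx y)).
  by move=> y; apply: continuous_comp; [exact: cr|exact: cF].
have cc (c : R) : continuous (fun _ : 'rV[R]_(1 + n) => c) by exact: cst_continuous.
rewrite (_ : slope_graph K F L B t =
  ([set y : 'rV[R]_(1 + n) | 0 <= y 0 (@lshift 1 n ord0)] `&` [set y : 'rV[R]_(1 + n) | y 0 (@lshift 1 n ord0) <= B]) `&`
  ((rsubmx @^-1` K `&` \bigcap_(x' in K) [set y | F x' - F (rsubmx y) <=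
     y 0 (@lshift 1 n ord0) * `|x' - rsubmx y| + L * `|x' - rsubmx y| ^+ 2]) `&`
  ([set y | F (rsubmx y) <= t] `&` [set y | t <= F (rsubmx y)]))); last first.
  apply/seteqP; split=> y.
    by move=> [g0 gB [Kx h] Ft]; do !split=> //=; rewrite Ft.
  move=> [[g0 gB] [[Kx h] [h1 h2]]]; split=> //.
  by apply/eqP; rewrite eq_le; apply/andP.
apply: closedI; first by apply: closedI; apply: closed_le_fun.
apply: closedI; last by apply: closedI; apply: closed_le_fun.
apply: closedI.
  apply: preimage_closed; first by move=> y _; exact: cr.
  by apply: compact_closed => //; exact: norm_hausdorff.
apply: closed_bigI => x' Kx'.
have cn : continuous (fun y : 'rV[R]_(1 + n) => `|x' - rsubmx y|).
  move=> y; apply: (continuous_comp (f := fun y => x' - rsubmx y) (g := fun v : 'rV[R]_n => `|v|)).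
    by apply: continuousB; [exact: cst_continuous|exact: cr].
  exact: norm_continuous.
apply: closed_le_fun => y.
  by apply: continuousB; [exact: cc|exact: cFr].
apply: (@cvgD _ _ _ (nbhs y)); first by apply: cvgM; [exact: cg|exact: cn].
apply: cvgM; first exact: cc.
by rewrite expr2; under eq_fun do rewrite expr2; apply: cvgM; exact: cn.
Qed.

(** The least slope [m] is monotone near 0. If it increases, [m] on the levels below [F x] is at
    most the slope at [x], and the length of the curve serves as [phi]. If it decreases, slopes are
    bounded away from 0 and a linear [phi] suffices. *)
Lemma desingularization : exists t0 phi,
  [/\ 0 < t0, forall t, 0 < t -> t < t0 -> 0 <= phi t,
    forall a b, 0 < a -> a <= b -> b < t0 -> phi a <= phi b &
    forall x g a, slope K F L g x -> 0 <= g -> g <= B ->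
      0 < a -> a <= F x -> F x < t0 -> F x - a <= g * (phi (F x) - phi a)].
Proof.
have dS := definable_slope_graph.
have slopeS x g : slope K F L g x -> 0 <= g -> g <= B ->
    slope_graph K F L B (F x) (row_mx (const_mx g) x).
  by move=> sx g0 gB; rewrite /slope_graph /= row_mxKr row_mxEl mxE.
have [z [dz zS zmin]] := definable_choice (@lshift 1 n ord0) dS compact_slope_graph.
pose mono i t := (forall s s', 0 < s -> s < s' -> s' < t -> z s 0 i <= z s' 0 i) \/
  (forall s s', 0 < s -> s < s' -> s' < t -> z s' 0 i <= z s 0 i).
have nmono i : near0 (mono i).
  have [d [d0 h]] := definable_fun_monotone (dz i).
  exists d; split=> // t _ td.
  by case: h => h; [left|right] => s s' s0 ss st; apply: h => //; apply: lt_trans td.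
have dD : definable (fun w : nat -> R => exists y, slope_graph K F L B (w 0%N) y).
  apply: definable_ex_row.
  by apply: (definable_family_subst (q := fun k w => w k)) => // *; apply: polyfun_var.
have [nD|[d [d0 hd]]] := near0_dichotomy
    (P := fun t => exists y, slope_graph K F L B t y) dD; last first.
  (* Levels near 0 carry no point of slope at most [B], so the inequality is vacuous. *)
  exists d, (fun=> 0); split=> // x g a sx g0 gB a0 aF Fd.
  case: (hd (F x)) => //; first exact: lt_le_trans aF.
  by exists (row_mx (const_mx g) x); apply: slopeS.
have [d [d0 [hm hD]]] : exists d, 0 < d /\ (forall i, mono i d) /\
    forall t, 0 < t -> t < d -> exists y, slope_graph K F L B t y.
  have [e [e0 he]] := near0_and (near0_all nmono) nD.
  exists (e / 2); split; first by rewrite divr_gt0.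
  have ee : e / 2 < e by rewrite ltr_pdivrMr// ltr_pMr// ltr1n.
  split=> [|t t0 te]; last by have [] := he t t0 (lt_trans te ee).
  by have [] := he (e / 2) (divr_gt0 e0 (ltr0n _ 2)) ee.
pose m t := z t 0 (@lshift 1 n ord0); pose x t := rsubmx (z t).
have zP t : 0 < t -> t < d -> [/\ 0 <= m t, m t <= B, slope K F L (m t) (x t) & F (x t) = t].
  by move=> t0 td; have [y /zS[]] := hD t t0 td.
(* [e i] is the direction, 1 or -1, in which coordinate [i] of the curve moves. The signed sum [psi]
   thus measures length in the sum norm, which dominates the maximum norm. *)
have /choice[e eP] (i : 'I_n) : exists e : R, `|e| <= 1 /\
    forall s s', 0 < s -> s < s' -> s' < d ->
      `|x s' 0 i - x s 0 i| = e * x s' 0 i - e * x s 0 i.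
  have [h|h] := hm (rshift 1 i); [exists 1|exists (-1)].
    rewrite normr1; split=> // s s' s0 ss sd; rewrite !mul1r ger0_norm// subr_ge0.
    by rewrite !mxE h.
  rewrite normrN1; split=> // s s' s0 ss sd; rewrite !mulN1r ler0_norm; first ring.
  by rewrite subr_le0 !mxE h.
pose psi t := \sum_i e i * x t 0 i.
have psiE s s' : 0 < s -> s < s' -> s' < d ->
    psi s' - psi s = \sum_i `|x s' 0 i - x s 0 i|.
  move=> s0 ss sd; rewrite /psi -sumrB; apply: eq_bigr => i _.
  by have [_ ->] := eP i.
have le_psi s s' : 0 < s -> s <= s' -> s' < d -> psi s <= psi s'.
  rewrite le_eqVlt => s0 /orP[/eqP -> //|ss] sd.
  by rewrite -subr_ge0 psiE// sumr_ge0.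
have norm_psi s s' : 0 < s -> s < s' -> s' < d -> `|x s' - x s| <= psi s' - psi s.
  move=> s0 ss sd; apply/le_mx_norm; first by rewrite subr_ge0 le_psi// ltW.
  move=> i j; rewrite ord1 psiE// (bigD1 j)//= mxE [X in _ + X]mxE.
  by rewrite lerDl sumr_ge0.
(* The curve is parametrized by the level, so the growth of [F] between two of its points is the
   difference of parameters; the slope inequality at the earlier point is the local hypothesis of
   [le_of_local_le]. *)
have core a b M : 0 <= M -> 0 < a -> a < b -> b < d ->
    (forall t, a <= t -> t <= b -> m t <= M) -> b - a <= 2 * M * (psi b - psi a).
  move=> M0 a0 ab bd mM; apply: (le_of_local_le M0 L0 ab) => t t' at_ tt tb.
  have t0 : 0 < t by apply: lt_le_trans at_.
  have t'd : t' < d by apply: le_lt_trans bd.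
  have [mt0 _ [_ h] Ft] := zP t t0 (lt_trans tt t'd).
  have [_ _ [Kx' _] Ft'] := zP t' (lt_trans t0 tt) t'd.
  have := h _ Kx'; rewrite Ft Ft' => ht.
  split; first by rewrite le_psi// ltW.
  have np := norm_psi t t' t0 tt t'd.
  apply: le_trans ht _; apply: lerD.
    by apply: ler_pM => //; apply: mM => //; apply: ltW; apply: lt_le_trans tb.
  by apply: ler_wpM2l => //; rewrite ler_pXn2r ?nnegrE// (le_trans _ np).
(* Compactness of [K] bounds [psi] below; adding [C] makes [phi] nonnegative. *)
have [C psiC] : exists C, forall t, 0 < t -> t < d -> - C <= psi t.
  have [M [_ hM]] := compact_bounded cK.
  have M1 : M < M + 1 by rewrite ltrDl.
  have KM := hM (M + 1) M1.
  exists (\sum_(i < n) (M + 1)) => t t0 td.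
  have [_ _ [Kx _] _] := zP t t0 td.
  have := KM _ Kx => /= xM.
  suff : `|psi t| <= \sum_(i < n) (M + 1) by rewrite ler_norml => /andP[].
  apply: le_trans (ler_norm_sum _ _ _) _; apply: ler_sum => i _.
  rewrite normrM -[leRHS]mul1r; apply: ler_pM => //; first by have [] := eP i.
  exact: le_trans (mx_norm_entry _ _ _) xM.
have m_min y g : slope K F L g y -> 0 <= g -> g <= B -> m (F y) <= g.
  move=> sy g0 gB; have := zmin _ _ (slopeS _ _ sy g0 gB).
  by rewrite row_mxEl mxE.
have [minc|mdec] := hm (@lshift 1 n ord0).
  exists d, (fun t => 2 * (psi t + C)); split=> //.
  - by move=> t tt td; rewrite mulr_ge0// -lerBlDr sub0r psiC.
  - by move=> a b a0 ab bd; rewrite ler_pM2l// lerD2r le_psi.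
  move=> y g a sy g0 gB a0; rewrite le_eqVlt => /orP[/eqP ->|aF] Fd.
    by rewrite !subrr mulr0.
  have F0 := lt_trans a0 aF.
  have [mF0 _ _ _] := zP _ F0 Fd.
  have mle t : a <= t -> t <= F y -> m t <= m (F y).
    move=> at_; rewrite le_eqVlt => /orP[/eqP ->//|tF].
    by apply: minc => //; apply: lt_le_trans at_.
  have := core a (F y) (m (F y)) mF0 a0 aF Fd mle => /le_trans; apply.
  have := m_min _ _ sy g0 gB; have := le_psi _ _ a0 (ltW aF) Fd; nra.
pose t0 := d / 2.
have t00 : 0 < t0 by rewrite divr_gt0.
have t0d : t0 < d by rewrite /t0; lra.
have [mt0 _ _ _] := zP _ t00 t0d.
(* If [m t0] vanished, [m] would vanish on a whole interval of levels to the right of [t0], and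
   [core] with [M = 0] would force that interval to be trivial. *)
have mu0 : 0 < m t0.
  rewrite lt_neqAle mt0 andbT; apply/eqP => me0.
  pose b := 3 / 4 * d.
  have t0b : t0 < b by rewrite /t0 /b; lra.
  have bd : b < d by rewrite /b; lra.
  have := core t0 b 0 (lexx _) t00 t0b bd.
  rewrite mulr0 mul0r leNgt subr_gt0 t0b => /(_ _)/negP; apply=> // t.
  rewrite le_eqVlt => /orP[/eqP <- _|tt tb]; first by rewrite -me0.
  by rewrite me0; apply: mdec => //; apply: le_lt_trans bd.
exists t0, (fun t => t / m t0); split=> //.
- by move=> t tt _; rewrite divr_ge0// ltW.
- by move=> a b a0 ab _; rewrite ler_pM2r// invr_gt0.
move=> y g a sy g0 gB a0 aF Ft0.
have F0 := lt_le_trans a0 aF.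
have mF : m t0 <= g.
  by apply: le_trans (m_min _ _ sy g0 gB); apply: mdec.
rewrite -mulrBl mulrA mulrAC ler_peMl ?subr_ge0//.
by rewrite ler_pdivlMr// mul1r.
Qed.

End Desingularization.

(** * Taylor expansions *)

Section Taylor.
Variables (R : realType) (V : normedModType R).
Implicit Types (g : V -> R) (dg : V -> V -> R).

(** A second-order expansion with constants uniform on bounded sets. The bounds on [g] and on [dg]
    are included because the product rule needs them. *)
Definition taylor g dg := forall B : R, exists C : R, 0 <= C /\
  forall x y, `|x| <= B -> `|y| <= B ->
  [/\ `|g x| <= C, `|dg x (y - x)| <= C * `|y - x| &
      `|g y - g x - dg x (y - x)| <= C * `|y - x| ^+ 2].

Lemma eq_taylor g dg g' dg' : (forall x, g x = g' x) ->
  (forall x h, dg x h = dg' x h) -> taylor g dg -> taylor g' dg'.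
Proof.
move=> /funext -> dgE tg B; have [C [C0 h]] := tg B.
exists C; split=> // x y xB yB; rewrite -dgE; exact: h.
Qed.

Lemma taylor_const c : taylor (fun=> c) (fun _ _ => 0).
Proof.
move=> B; exists `|c|; split=> // x y _ _.
by rewrite subrr subr0 normr0; split=> //; rewrite mulr_ge0// exprn_ge0.
Qed.

Lemma taylor_linear (l : V -> R) : (forall x, `|l x| <= `|x|) ->
  (forall x y, l (y - x) = l y - l x) -> taylor l (fun _ h => l h).
Proof.
move=> lb lD B; exists (1 + `|B|); split; first by rewrite addr_ge0.
move=> x y xB yB; split.
- apply: le_trans (lb x) _; apply: le_trans xB _.
  by rewrite (le_trans (ler_norm _))// lerDr.
- by apply: le_trans (lb _) _; rewrite ler_peMl// lerDl.
- by rewrite lD subrr normr0 mulr_ge0 ?exprn_ge0// addr_ge0.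
Qed.

Lemma taylorD g1 d1 g2 d2 : taylor g1 d1 -> taylor g2 d2 ->
  taylor (fun x => g1 x + g2 x) (fun x h => d1 x h + d2 x h).
Proof.
move=> t1 t2 B; have [C1 [C10 h1]] := t1 B; have [C2 [C20 h2]] := t2 B.
exists (C1 + C2); split; first exact: addr_ge0.
move=> x y xB yB; have [a1 b1 c1] := h1 x y xB yB; have [a2 b2 c2] := h2 x y xB yB.
split; rewrite ?mulrDl.
- by apply: le_trans (ler_normD _ _) _; apply: lerD.
- by apply: le_trans (ler_normD _ _) _; apply: lerD.
- rewrite (_ : _ - _ = (g1 y - g1 x - d1 x (y - x)) + (g2 y - g2 x - d2 x (y - x))).
    by apply: le_trans (ler_normD _ _) _; apply: lerD.
  by ring.
Qed.

Lemma taylorM g1 d1 g2 d2 : taylor g1 d1 -> taylor g2 d2 ->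
  taylor (fun x => g1 x * g2 x) (fun x h => d1 x h * g2 x + g1 x * d2 x h).
Proof.
move=> t1 t2 B; have [C1 [C10 h1]] := t1 B; have [C2 [C20 h2]] := t2 B.
(* The remainder of a product has three quadratic terms and a cubic one, the latter reduced by
   [|y - x| <= 2 * |B|]. The factors 4 are generous. *)
exists (C1 * C2 *+ 4 + C1 * C2 *+ 4 * `|B|); split.
  by rewrite addr_ge0 ?mulrn_wge0 ?mulr_ge0 ?mulrn_wge0 ?mulr_ge0.
move=> x y xB yB; have [a1 b1 c1] := h1 x y xB yB; have [a2 b2 c2] := h2 x y xB yB.
have [a2' _ _] := h2 y x yB xB.
set e := `|y - x| in b1 c1 b2 c2 *.
have e0 : 0 <= e by exact: normr_ge0.
have eB : e <= 2 * `|B|.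
  apply: le_trans (ler_normB _ _) _; rewrite mulr_natl mulr2n.
  by apply: lerD; apply: le_trans (ler_norm B).
have B0 : 0 <= `|B| by exact: normr_ge0.
move: a1 b1 c1 a2 b2 c2 a2'.
set u1 := g1 x; set v1 := g1 y; set w1 := d1 x _.
set u2 := g2 x; set v2 := g2 y; set w2 := d2 x _.
move=> a1 b1 c1 a2 b2 c2 a2'.
have P0 : 0 <= C1 * C2 by exact: mulr_ge0.
have PB : 0 <= C1 * C2 * `|B| by exact: mulr_ge0.
split.
- rewrite normrM; apply: le_trans (ler_pM _ _ a1 a2) _ => //.
  lra.
- apply: le_trans (ler_normD _ _) _; rewrite !normrM.
  have p1 : `|w1| * `|u2| <= C1 * e * C2 by apply: ler_pM.
  have p2 : `|u1| * `|w2| <= C1 * (C2 * e) by apply: ler_pM.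
  have q1 : 0 <= C1 * C2 * e by rewrite mulr_ge0.
  have q2 : 0 <= C1 * C2 * `|B| * e by rewrite mulr_ge0.
  lra.
- rewrite (_ : _ - _ = (v1 - u1 - w1) * v2 + u1 * (v2 - u2 - w2) +
      w1 * (v2 - u2 - w2) + w1 * w2); last by ring.
  have p1 : `|(v1 - u1 - w1) * v2| <= C1 * e ^+ 2 * C2.
    by rewrite normrM; apply: ler_pM.
  have p2 : `|u1 * (v2 - u2 - w2)| <= C1 * (C2 * e ^+ 2).
    by rewrite normrM; apply: ler_pM.
  have p3 : `|w1 * (v2 - u2 - w2)| <= C1 * e * (C2 * e ^+ 2).
    by rewrite normrM; apply: ler_pM.
  have p4 : `|w1 * w2| <= C1 * e * (C2 * e).
    by rewrite normrM; apply: ler_pM.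
  have q0 : 0 <= C1 * C2 * e ^+ 2 by rewrite mulr_ge0 ?exprn_ge0.
  have q1 : C1 * C2 * e ^+ 2 * e <= C1 * C2 * e ^+ 2 * (2 * `|B|).
    by rewrite ler_wpM2l.
  apply: le_trans (ler_normD _ _) _.
  have := ler_normD ((v1 - u1 - w1) * v2 + u1 * (v2 - u2 - w2)) (w1 * (v2 - u2 - w2)).
  have := ler_normD ((v1 - u1 - w1) * v2) (u1 * (v2 - u2 - w2)).
  have r3 : C1 * e * (C2 * e ^+ 2) = C1 * C2 * e ^+ 2 * e by ring.
  have r4 : (C1 * C2 *+ 4 + C1 * C2 *+ 4 * `|B|) * e ^+ 2 =
     4 * (C1 * C2 * e ^+ 2) + 2 * (C1 * C2 * e ^+ 2 * (2 * `|B|)) by ring.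
  have q2 : 0 <= C1 * C2 * e ^+ 2 * (2 * `|B|) by rewrite !mulr_ge0.
  have r1 : C1 * e ^+ 2 * C2 = C1 * C2 * e ^+ 2 by ring.
  have r2 : C1 * (C2 * e ^+ 2) = C1 * C2 * e ^+ 2 by ring.
  have r5 : C1 * e * (C2 * e) = C1 * C2 * e ^+ 2 by ring.
  lra.
Qed.

Lemma taylorZ c g dg : taylor g dg ->
  taylor (fun x => c * g x) (fun x h => c * dg x h).
Proof.
move=> /(taylorM (taylor_const c)); apply: eq_taylor => // x h.
by rewrite mul0r add0r.
Qed.

Lemma taylor_sum (T : finType) (g : T -> V -> R) (dg : T -> V -> V -> R) :
  (forall i, taylor (g i) (dg i)) ->
  taylor (fun x => \sum_i g i x) (fun x h => \sum_i dg i x h).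
Proof.
move=> tg.
suff H (s : seq T) : taylor (fun x => \sum_(i <- s) g i x)
    (fun x h => \sum_(i <- s) dg i x h) by exact: H.
elim: s => [|i s ih].
  by apply: eq_taylor (taylor_const 0) => *; rewrite big_nil.
by apply: eq_taylor (taylorD (tg i) ih) => *; rewrite big_cons.
Qed.

Definition tame g := exists dg, taylor g dg.

Lemma tame_lipschitz g : tame g -> forall B : R, exists C : R, 0 <= C /\
  forall x y, `|x| <= B -> `|y| <= B -> `|g x| <= C /\ `|g y - g x| <= C * `|y - x|.
Proof.
move=> [dg tg] B; have [C [C0 h]] := tg B.
exists (C + C * (2 * `|B|)); split; first by rewrite addr_ge0 ?mulr_ge0.
move=> x y xB yB; have [a b c] := h x y xB yB; split.
  by apply: le_trans a _; rewrite lerDl !mulr_ge0.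
have eB : `|y - x| <= 2 * `|B|.
  apply: le_trans (ler_normB _ _) _; rewrite mulr_natl mulr2n.
  by apply: lerD; apply: le_trans (ler_norm B).
rewrite -(subrK (dg x (y - x)) (_ - _)).
apply: le_trans (ler_normD _ _) _; rewrite mulrDl addrC; apply: lerD => //.
apply: le_trans c _; rewrite expr2 mulrA ler_wpM2r// ler_wpM2l//.
Qed.

Lemma tameD g1 g2 : tame g1 -> tame g2 -> tame (fun x => g1 x + g2 x).
Proof. by move=> [d1 t1] [d2 t2]; eexists; apply: taylorD t1 t2. Qed.

Lemma tameM g1 g2 : tame g1 -> tame g2 -> tame (fun x => g1 x * g2 x).
Proof. by move=> [d1 t1] [d2 t2]; eexists; apply: taylorM t1 t2. Qed.

Lemma tame_const c : tame (fun=> c).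
Proof. by eexists; apply: taylor_const. Qed.

Lemma tameN g : tame g -> tame (fun x => - g x).
Proof.
move=> [d t]; exists (fun x h => -1 * d x h).
by apply: eq_taylor (taylorZ (-1) t) => // x; rewrite mulN1r.
Qed.

Lemma tame_sum (T : finType) (g : T -> V -> R) :
  (forall i, tame (g i)) -> tame (fun x => \sum_i g i x).
Proof. by move=> /choice[dg h]; exists (fun x h => \sum_i dg i x h); apply: taylor_sum. Qed.

Lemma tame_linear (l : V -> R) : (forall x, `|l x| <= `|x|) ->
  (forall x y, l (y - x) = l y - l x) -> tame l.
Proof. by move=> h1 h2; eexists; apply: taylor_linear. Qed.

End Taylor.

(** * Exact expansion of the objective in a single block *)

Section QuadraticBlock.
Variables (R : realType) (m n : nat) (P : finType).
Variables (A : P -> R) (T : 'M[R]_(m, n) -> P -> R) (h : 'M[R]_(m, n) -> R).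
Hypothesis linT : forall k M N p, T (k *: M + N) p = k * T M p + T N p.
Hypothesis hE : forall M, h M = 2^-1 * \sum_p (A p - T M p) ^+ 2.

(** The block enters the residual linearly, so the objective is exactly quadratic in it: the descent
    estimate will need no bound on a Taylor remainder. *)
Lemma quadratic_expansion M H k :
  h (M + k *: H) = h M - k * (\sum_p (A p - T M p) * T H p)
    + k ^+ 2 * (2^-1 * \sum_p T H p ^+ 2).
Proof.
rewrite !hE !mulr_sumr -sumrB -big_split /=; apply: eq_bigr => p _.
by rewrite [M + _]addrC linT; field.
Qed.

Lemma derive_quadratic M H : 'D_H h M = - \sum_p (A p - T M p) * T H p.
Proof.
rewrite /derive; apply/cvg_lim => //.
pose b := - \sum_p (A p - T M p) * T H p; pose c := 2^-1 * \sum_p T H p ^+ 2.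
have lim : (fun k : R => b + k * c) @ (0 : R)^' --> b.
  rewrite -[X in _ --> X](addr0 b) -[X in _ --> b + X](mul0r c).
  apply: cvgD; first exact: cvg_cst.
  by apply: cvgM; [exact: nbhs_dnbhs|exact: cvg_cst].
have E : {near (0 : R)^', (fun k : R => b + k * c) =1
    (fun k => k^-1 *: ((h \o shift M) (k *: H) - h M))}.
  near=> k.
  have k0 : k != 0 by near: k; exact: nbhs_dnbhs_neq.
  rewrite /= [_ + M]addrC quadratic_expansion /GRing.scale /= /b /c.
  by field.
exact: (cvg_trans (near_eq_cvg E) lim).
Unshelve. all: by end_near.
Qed.

Lemma linT_sum M p : T M p = \sum_i \sum_j M i j * T (delta_mx i j) p.
Proof.
have T0 : T 0 p = 0.
  by have := linT 1 0 0 p; rewrite scaler0 addr0 mul1r; lra.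
have TD M1 M2 : T (M1 + M2) p = T M1 p + T M2 p.
  by have := linT 1 M1 M2 p; rewrite scale1r mul1r.
rewrite {1}(matrix_sum_delta M) (big_morph (fun N => T N p) TD T0).
apply: eq_bigr => i _; rewrite (big_morph (fun N => T N p) TD T0).
apply: eq_bigr => j _.
by have := linT (M i j) (delta_mx i j) 0 p; rewrite addr0 T0 addr0.
Qed.

Lemma frob_dot_grad_quadratic M H :
  frob_dot (grad h M) H = - \sum_p (A p - T M p) * T H p.
Proof.
rewrite (eq_bigr (fun p => \sum_i \sum_j (A p - T M p) * (H i j * T (delta_mx i j) p))).
  rewrite exchange_big -sumrN; apply: eq_bigr => i _ /=.
  rewrite exchange_big -sumrN; apply: eq_bigr => j _ /=.
  rewrite mxE derive_quadratic mulNr mulr_suml; congr (- _); apply: eq_bigr => p _.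
  ring.
move=> p _; rewrite (linT_sum H) mulr_sumr; apply: eq_bigr => i _.
by rewrite mulr_sumr.
Qed.

Lemma quadratic_step M M' :
  h M' = h M + frob_dot (grad h M) (M' - M) + 2^-1 * \sum_p T (M' - M) p ^+ 2.
Proof.
have := quadratic_expansion M (M' - M) 1.
by rewrite scale1r subrKC mul1r expr1n mul1r frob_dot_grad_quadratic.
Qed.

End QuadraticBlock.

Lemma cauchy_schwarz (R : realType) (T : finType) (a b : T -> R) :
  \sum_i a i * b i <= Num.sqrt (\sum_i a i ^+ 2) * Num.sqrt (\sum_i b i ^+ 2).
Proof.
set p := \sum_i a i ^+ 2; set q := \sum_i b i ^+ 2.
have p0 : 0 <= p by apply: sumr_ge0 => i _; exact: sqr_ge0.
have q0 : 0 <= q by apply: sumr_ge0 => i _; exact: sqr_ge0.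
set x := Num.sqrt p; set y := Num.sqrt q.
have px : p = x ^+ 2 by rewrite sqr_sqrtr.
have qy : q = y ^+ 2 by rewrite sqr_sqrtr.
have x0 : 0 <= x by exact: sqrtr_ge0.
have y0 : 0 <= y by exact: sqrtr_ge0.
(* With [x] and [y] the norms of [a] and [b], this is the sum of the squares of [y * a i - x * b i].
   Dividing by [x * y] requires the degenerate case to be treated apart. *)
have key : 0 <= y ^+ 2 * p - 2 * (x * y) * (\sum_i a i * b i) + x ^+ 2 * q.
  rewrite !mulr_sumr -sumrB -big_split /=; apply: sumr_ge0 => i _.
  have -> : y ^+ 2 * a i ^+ 2 - 2 * (x * y) * (a i * b i) + x ^+ 2 * b i ^+ 2 =
    (y * a i - x * b i) ^+ 2 by ring.
  exact: sqr_ge0.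
have [xy0|xy0] := eqVneq (x * y) 0.
  rewrite xy0 le_eqVlt; apply/orP; left; apply/eqP.
  have /eqP := xy0; rewrite mulf_eq0 => /orP[] /eqP z0.
    apply: big1 => i _; have /eqP := px; rewrite z0 expr0n /= psumr_eq0 => [|j _]; last exact: sqr_ge0.
    by move=> /allP/(_ i (mem_index_enum i)); rewrite sqrf_eq0 => /eqP ->; rewrite mul0r.
  apply: big1 => i _; have /eqP := qy; rewrite z0 expr0n /= psumr_eq0 => [|j _]; last exact: sqr_ge0.
  by move=> /allP/(_ i (mem_index_enum i)); rewrite sqrf_eq0 => /eqP ->; rewrite mulr0.
have xy : 0 < x * y by rewrite lt_neqAle eq_sym xy0 mulr_ge0.
rewrite -(ler_pM2l xy); move: key; rewrite px qy; set S := \sum_i _; nra.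
Qed.

Lemma frob_ge0 (R : realType) m n (M : 'M[R]_(m, n)) : 0 <= frob M.
Proof. exact: sqrtr_ge0. Qed.

Lemma sqr_frob (R : realType) m n (M : 'M[R]_(m, n)) :
  frob M ^+ 2 = \sum_i \sum_j M i j ^+ 2.
Proof.
by rewrite sqr_sqrtr//; apply: sumr_ge0 => i _; apply: sumr_ge0 => j _; exact: sqr_ge0.
Qed.

(** Each row [h] of [H] contributes the pairing of the Gram matrix [U *m U^T] with the outer square
    of [h], whose Frobenius norm is the squared norm of [h]. This explains the Frobenius norm of a
    Gram matrix in the step constants. *)
Lemma frob_mulmx (R : realType) m r q (H : 'M[R]_(m, r)) (U : 'M[R]_(r, q)) :
  \sum_i \sum_t (H *m U) i t ^+ 2 <= frob (U *m U^T) * frob H ^+ 2.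
Proof.
rewrite sqr_frob mulr_sumr; apply: ler_sum => i _.
set G := U *m U^T.
have -> : \sum_t (H *m U) i t ^+ 2 = \sum_p G p.1 p.2 * (H i p.1 * H i p.2).
  rewrite -(pair_bigA _ (fun c d => G c d * (H i c * H i d))) /=.
  under eq_bigr do rewrite expr2 !mxE mulr_suml.
  rewrite exchange_big; apply: eq_bigr => c _ /=.
  under eq_bigr do rewrite mulr_sumr.
  rewrite exchange_big; apply: eq_bigr => d _ /=.
  rewrite mxE mulr_suml; apply: eq_bigr => t _; rewrite mxE; ring.
apply: le_trans (cauchy_schwarz _ _) _.
rewrite /frob pair_bigA /=; apply: ler_wpM2l; first exact: sqrtr_ge0.
rewrite -(pair_bigA _ (fun c d => (H i c * H i d) ^+ 2)) /=.
under eq_bigr do under eq_bigr do rewrite exprMn.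
under eq_bigr do rewrite -mulr_sumr.
rewrite -mulr_suml -expr2 sqrtr_sqr ger0_norm//.
by apply: sumr_ge0 => j _; exact: sqr_ge0.
Qed.

(** * The blocks of the objective *)

Section Blocks.
Variables (R : realType) (I J K r : nat).
Implicit Types (X : 'M[R]_(I, r)) (Y : 'M[R]_(J, r)) (Z : 'M[R]_(K, r))
  (a : 'rV[R]_r) (A : tensor R I J K).

Definition cp_entry a X Y Z (p : 'I_I * 'I_J * 'I_K) : R :=
  \sum_c a 0 c * (X p.1.1 c * Y p.1.2 c * Z p.2 c).

Lemma cpE a X Y Z p : cp a X Y Z p = cp_entry a X Y Z p.
Proof.
rewrite /cp sum_ffunE; apply: eq_bigr => c _.
by rewrite !ffunE /= !mxE.
Qed.

Lemma objectiveE A X Y Z a :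
  objective A X Y Z a = 2^-1 * \sum_p (A p - cp_entry a X Y Z p) ^+ 2.
Proof.
rewrite /objective sqr_sqrtr; last by apply: sumr_ge0 => p _; exact: sqr_ge0.
by congr (_ * _); apply: eq_bigr => p _; rewrite !ffunE cpE.
Qed.

Lemma cp_entry_linX a Y Z k X X' p :
  cp_entry a (k *: X + X') Y Z p = k * cp_entry a X Y Z p + cp_entry a X' Y Z p.
Proof.
rewrite mulr_sumr -big_split; apply: eq_bigr => c _ /=.
by rewrite !mxE; ring.
Qed.

Lemma cp_entry_linY a X Z k Y Y' p :
  cp_entry a X (k *: Y + Y') Z p = k * cp_entry a X Y Z p + cp_entry a X Y' Z p.
Proof.
rewrite mulr_sumr -big_split; apply: eq_bigr => c _ /=.
by rewrite !mxE; ring.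
Qed.

Lemma cp_entry_linZ a X Y k Z Z' p :
  cp_entry a X Y (k *: Z + Z') p = k * cp_entry a X Y Z p + cp_entry a X Y Z' p.
Proof.
rewrite mulr_sumr -big_split; apply: eq_bigr => c _ /=.
by rewrite !mxE; ring.
Qed.

Lemma cp_entry_lina X Y Z k a a' p :
  cp_entry (k *: a + a') X Y Z p = k * cp_entry a X Y Z p + cp_entry a' X Y Z p.
Proof.
rewrite mulr_sumr -big_split; apply: eq_bigr => c _ /=.
by rewrite !mxE; ring.
Qed.

Lemma sum_mxtens m n (F : 'I_m * 'I_n -> R) :
  \sum_(t < m * n) F (mxtens_unindex t) = \sum_q F q.
Proof.
rewrite [RHS](reindex (@mxtens_unindex m n))//.
exists (@mxtens_index m n) => q _; [exact: mxtens_unindexK|exact: mxtens_indexK].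
Qed.

Lemma UmatE m n a (Y : 'M[R]_(m, r)) (Z : 'M[R]_(n, r)) c t :
  Umat a Y Z c t = a 0 c * (Z (mxtens_unindex t).1 c * Y (mxtens_unindex t).2 c).
Proof. by rewrite /Umat mul_diag_mx !mxE. Qed.

(** [X *m Umat a Y Z] is the unfolding of the tensor along its first index, with columns indexed by
    pairs [(k, j)]. The sum on the left is therefore that of [frob_mulmx], reindexed. *)
Lemma sum_cp_entryX a Y Z X :
  \sum_p cp_entry a X Y Z p ^+ 2 <=
    frob (Umat a Y Z *m (Umat a Y Z)^T) * frob X ^+ 2.
Proof.
apply: le_trans (frob_mulmx _ _); rewrite le_eqVlt; apply/orP; left; apply/eqP.
rewrite -(pair_bigA _ (fun q k => cp_entry a X Y Z (q, k) ^+ 2)) /=.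
rewrite -(pair_bigA _ (fun i j => \sum_k cp_entry a X Y Z (i, j, k) ^+ 2)) /=.
apply: eq_bigr => i _; rewrite exchange_big pair_bigA /=.
rewrite -(sum_mxtens (fun q => cp_entry a X Y Z (i, q.2, q.1) ^+ 2)).
apply: eq_bigr => t _; congr (_ ^+ 2); rewrite mxE; apply: eq_bigr => c _ /=.
by rewrite UmatE; ring.
Qed.

Lemma sum_cp_entryY a X Z Y :
  \sum_p cp_entry a X Y Z p ^+ 2 <=
    frob (Umat a X Z *m (Umat a X Z)^T) * frob Y ^+ 2.
Proof.
apply: le_trans (frob_mulmx _ _); rewrite le_eqVlt; apply/orP; left; apply/eqP.
rewrite -(pair_bigA _ (fun q k => cp_entry a X Y Z (q, k) ^+ 2)) /=.
rewrite -(pair_bigA _ (fun i j => \sum_k cp_entry a X Y Z (i, j, k) ^+ 2)) /=.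
rewrite exchange_big; apply: eq_bigr => j _; rewrite exchange_big pair_bigA /=.
rewrite -(sum_mxtens (fun q => cp_entry a X Y Z (q.2, j, q.1) ^+ 2)).
apply: eq_bigr => t _; congr (_ ^+ 2); rewrite mxE; apply: eq_bigr => c _ /=.
by rewrite UmatE; ring.
Qed.

Lemma sum_cp_entryZ a X Y Z :
  \sum_p cp_entry a X Y Z p ^+ 2 <=
    frob (Umat a X Y *m (Umat a X Y)^T) * frob Z ^+ 2.
Proof.
apply: le_trans (frob_mulmx _ _); rewrite le_eqVlt; apply/orP; left; apply/eqP.
rewrite -(pair_bigA _ (fun q k => cp_entry a X Y Z (q, k) ^+ 2)) /=.
rewrite exchange_big; apply: eq_bigr => k _ /=.
rewrite -(pair_bigA _ (fun i j => cp_entry a X Y Z (i, j, k) ^+ 2)) /=.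
rewrite exchange_big pair_bigA /=.
rewrite -(sum_mxtens (fun q => cp_entry a X Y Z (q.2, q.1, k) ^+ 2)).
apply: eq_bigr => t _; congr (_ ^+ 2); rewrite mxE; apply: eq_bigr => c _ /=.
by rewrite UmatE; ring.
Qed.

(** Here [a *m Qmat X Y Z] is the vectorized tensor itself. *)
Lemma sum_cp_entrya X Y Z a :
  \sum_p cp_entry a X Y Z p ^+ 2 <=
    frob (Qmat X Y Z *m (Qmat X Y Z)^T) * frob a ^+ 2.
Proof.
apply: le_trans (frob_mulmx _ _); rewrite le_eqVlt; apply/orP; left; apply/eqP.
rewrite big_ord1.
rewrite -(pair_bigA _ (fun q k => cp_entry a X Y Z (q, k) ^+ 2)) /=.
rewrite -(sum_mxtens (fun q => \sum_k cp_entry a X Y Z (q, k) ^+ 2)) pair_bigA /=.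
rewrite -(sum_mxtens (fun q => cp_entry a X Y Z (mxtens_unindex q.1, q.2) ^+ 2)).
apply: eq_bigr => t _; congr (_ ^+ 2); rewrite mxE; apply: eq_bigr => c _ /=.
by rewrite !mxE /= ffunE /= !mxE.
Qed.

End Blocks.

(** * Normalization and soft-thresholding steps *)

Section Steps.
Variables (R : realType) (m r : nat).
Implicit Types (M D : 'M[R]_(m, r)).

Lemma frob_colE M c : frob (col c M) = Num.sqrt (\sum_i M i c ^+ 2).
Proof.
congr Num.sqrt; apply: eq_bigr => i _.
by rewrite big_ord1 mxE.
Qed.

Lemma unit_colsP M : unit_cols M <-> forall c, \sum_i M i c ^+ 2 = 1.
Proof.
have s0 c : 0 <= \sum_i M i c ^+ 2 by apply: sumr_ge0 => i _; exact: sqr_ge0.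
split=> h c; have := h c; rewrite frob_colE; last by move=> ->; rewrite sqrtr1.
by move=> h1; rewrite -[LHS]sqr_sqrtr// h1 expr1n.
Qed.

Lemma frob_col_gt0 D c : col c D != 0 -> 0 < frob (col c D).
Proof.
move=> D0; rewrite lt_neqAle frob_ge0 andbT eq_sym frob_colE sqrtr_eq0 -ltNge.
rewrite lt_neqAle eq_sym sumr_ge0 ?andbT => [|i _]; last exact: sqr_ge0.
apply: contra D0; rewrite psumr_eq0 => [/allP h|i _]; last exact: sqr_ge0.
apply/eqP/colP => i; rewrite !mxE.
by have := h i (mem_index_enum i); rewrite sqrf_eq0 => /eqP.
Qed.

Lemma unit_cols_normalize D : nonzero_cols D -> unit_cols (normalize_cols D).
Proof.
move=> nD; apply/unit_colsP => c.
have f0 := frob_col_gt0 (nD c).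
under eq_bigr do rewrite mxE exprMn.
have f2 : \sum_i D i c ^+ 2 = frob (col c D) ^+ 2.
  by rewrite frob_colE sqr_sqrtr//; apply: sumr_ge0 => i _; exact: sqr_ge0.
by rewrite -mulr_suml exprVn f2 divff// expf_neq0// gt_eqF.
Qed.

(* Normalizing the columns of [D] projects them onto the sphere, so [M'] is at
   least as good as [M] for the quadratic model of [h] at [M]. *)
Lemma normalize_step (s d : R) h M (D := grad_step s d h M)
    (M' := normalize_cols D) :
  0 < s * d -> unit_cols M -> nonzero_cols D ->
  [/\ unit_cols M',
    exists nu : 'I_r -> R, forall i c,
      grad h M i c = s * d * (M i c - nu c * M' i c) &
    frob_dot (grad h M) (M' - M) + s * d / 2 * frob (M' - M) ^+ 2 <= 0].
Proof.
move=> sd0 uM nD; have uM' : unit_cols M' by exact: unit_cols_normalize.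
have gE i c : grad h M i c = s * d * (M i c - frob (col c D) * M' i c).
  have -> : frob (col c D) * M' i c = D i c.
    by rewrite mxE mulrC divfK// gt_eqF// frob_col_gt0.
  rewrite /D /grad_step; set G := grad h M.
  have e0 : s * d != 0 by rewrite gt_eqF.
  by rewrite !mxE; move: e0; set e := s * d => e0; field.
split=> //; first by exists (fun c => frob (col c D)).
rewrite sqr_frob /frob_dot exchange_big [X in _ * X]exchange_big /= mulr_sumr -big_split.
apply: sumr_le0 => c _ /=.
move/unit_colsP/(_ c): uM => uM; move/unit_colsP/(_ c): uM' => uM'.
set nu := frob (col c D).
have nu0 : 0 < nu by apply: frob_col_gt0.
set q := \sum_i M i c * M' i c.
have E2 : \sum_i (M' - M) i c ^+ 2 = 2 - 2 * q.
  transitivity (\sum_i M i c ^+ 2 + \sum_i M' i c ^+ 2 - 2 * q); last first.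
    by rewrite uM uM'; ring.
  rewrite mulr_sumr -big_split -sumrB; apply: eq_bigr => i _ /=.
  by rewrite !mxE; ring.
have q1 : q <= 1.
  have : 0 <= \sum_i (M' - M) i c ^+ 2 by apply: sumr_ge0 => i _; exact: sqr_ge0.
  by rewrite E2; lra.
have E1 : \sum_i grad h M i c * (M' - M) i c = s * d * ((1 + nu) * (q - 1)).
  transitivity (s * d * ((1 + nu) * q - \sum_i M i c ^+ 2 - nu * \sum_i M' i c ^+ 2)).
    rewrite !mulr_sumr -!sumrB mulr_sumr; apply: eq_bigr => i _.
    have -> : (M' - M) i c = M' i c - M i c by rewrite [LHS]mxE [X in _ + X]mxE.
    by rewrite gE -/nu; ring.
  by rewrite uM uM'; ring.
(* The two contributions add up to [s * d * nu * (q - 1)], where [q <= 1] is the inner product of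
   two unit columns. *)
rewrite E1 E2; have : 0 <= s * d * (nu * (1 - q)).
  by apply: mulr_ge0; [exact: ltW|apply: mulr_ge0; [exact: ltW|rewrite subr_ge0]].
lra.
Qed.

End Steps.

(** The subdifferential of the l1 norm without a case distinction: the sign where the entry of [a]
    is nonzero, anything in [[-1, 1]] where it is 0. *)
Definition l1_subgradient (R : realType) r (a v : 'rV[R]_r) :=
  forall c, `|v 0 c| <= 1 /\ v 0 c * a 0 c = `|a 0 c|.

Lemma le_l1_subgradient (R : realType) r (a v b : 'rV[R]_r) :
  l1_subgradient a v -> \sum_c v 0 c * (b 0 c - a 0 c) <= norm1 b - norm1 a.
Proof.
move=> h; rewrite /norm1 -sumrB; apply: ler_sum => c _.
have [v1 va] := h c; rewrite mulrBr va lerD2r.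
apply: le_trans (ler_norm _) _; rewrite normrM; apply: ler_piMl => //.
Qed.

(** The optimality condition of the proximal problem: the normalized residual [(t - p) / tau] is a
    subgradient of the absolute value at [p]. *)
Lemma soft_threshold_subgradient (R : realType) (tau t : R) : 0 < tau ->
  let p := soft_threshold tau t in
  `|(t - p) / tau| <= 1 /\ (t - p) / tau * p = `|p|.
Proof.
move=> tau0 p.
have tau_neq0 : tau != 0 by rewrite gt_eqF.
have [le|lt] := leP `|t| tau.
  have -> : p = 0 by rewrite /p /soft_threshold max_r ?mulr0// subr_le0.
  by rewrite subr0 mulr0 normr0 normrM normfV (gtr0_norm tau0) ler_pdivrMr// mul1r.
have -> : p = Num.sg t * (`|t| - tau).
  by rewrite /p /soft_threshold max_l// subr_ge0 ltW.
have t0 : t != 0 by apply: contraTneq lt => ->; rewrite normr0 -leNgt ltW.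
have -> : (t - Num.sg t * (`|t| - tau)) / tau = Num.sg t.
  have tE : Num.sg t * `|t| = t by rewrite mulr_sg_norm.
  by rewrite mulrBr tE opprB addrC subrK mulfK.
rewrite normr_sg t0 lexx; split=> //.
rewrite mulrA -expr2 sqr_sg t0 mul1r normrM normr_sg t0 mul1r.
by rewrite ger0_norm// subr_ge0 ltW.
Qed.

Lemma prox_step (R : realType) r (s d lambda : R) h (a : 'rV[R]_r)
    (a' := map_mx (soft_threshold (lambda / (s * d))) (grad_step s d h a)) :
  0 < s * d -> 0 < lambda ->
  exists v, l1_subgradient a' v /\
    forall c, grad h a 0 c = s * d * (a 0 c - a' 0 c) - lambda * v 0 c.
Proof.
move=> sd0 l0; pose tau := lambda / (s * d).
have tau0 : 0 < tau by rewrite divr_gt0.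
pose v : 'rV[R]_r := \row_c ((grad_step s d h a 0 c - a' 0 c) / tau).
have vE c : v 0 c = (grad_step s d h a 0 c - a' 0 c) / tau by rewrite mxE.
exists v; split=> c.
  by rewrite vE [a' 0 c]mxE; exact: soft_threshold_subgradient.
have [sd_neq0 l_neq0] : s * d != 0 /\ lambda != 0 by rewrite !gt_eqF.
have dE : grad_step s d h a 0 c = a 0 c - (s * d)^-1 * grad h a 0 c.
  by rewrite /grad_step; set G := grad h a; rewrite !mxE.
rewrite vE dE /tau; set x := a' 0 c; set e := s * d in sd_neq0 *.
by field; apply/andP.
Qed.

(** Convexity of the l1 norm yields the full coefficient [sd] on the squared step, against half of
    it for the nonconvex sphere blocks. *)
Lemma norm1_prox_le (R : realType) r (lambda sd : R) (a a' v g : 'rV[R]_r) :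
  0 < lambda -> l1_subgradient a' v ->
  (forall c, g 0 c = sd * (a 0 c - a' 0 c) - lambda * v 0 c) ->
  lambda * norm1 a' + frob_dot g (a' - a) + sd * frob (a' - a) ^+ 2 <=
  lambda * norm1 a.
Proof.
move=> l0 va gE.
have := le_l1_subgradient a va; rewrite -(ler_pM2l l0).
suff -> : frob_dot g (a' - a) = lambda * (\sum_c v 0 c * (a 0 c - a' 0 c))
    - sd * frob (a' - a) ^+ 2 by lra.
rewrite sqr_frob /frob_dot !big_ord1 !mulr_sumr -sumrB; apply: eq_bigr => c _.
by rewrite gE !mxE; ring.
Qed.

(** * Gradients of the objective *)

Section TameMatrix.
Variables (R : realType) (V : normedModType R) (m n : nat).
Implicit Types (G : V -> 'M[R]_(m, n)).

Lemma tame_mx_lipschitz G : (forall i j, tame (fun x => G x i j)) ->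
  forall B : R, exists C : R, 0 <= C /\ forall x y, `|x| <= B -> `|y| <= B ->
    `|G x| <= C /\ `|G y - G x| <= C * `|y - x|.
Proof.
move=> tG B.
have /choice[C hC] (q : 'I_m * 'I_n) := tame_lipschitz (tG q.1 q.2) B.
have C0 q : 0 <= C q by have [] := hC q.
have Cle q : C q <= \sum_q C q by rewrite (bigD1 q)//= lerDl sumr_ge0.
exists (\sum_q C q); split=> [|x y xB yB]; first exact: sumr_ge0.
split; apply/le_mx_norm => [|i j]; rewrite ?mulr_ge0 ?sumr_ge0//.
  by have [_ h] := hC (i, j); have [h1 _] := h x y xB yB; apply: le_trans h1 _.
have [_ h] := hC (i, j); have [_ h2] := h x y xB yB.
rewrite mxE [X in _ + X]mxE; apply: le_trans h2 _.
by rewrite ler_wpM2r.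
Qed.

Lemma le_frob (M : 'M[R]_(m, n)) : frob M <= (m * n)%:R * `|M|.
Proof.
rewrite -(ler_pXn2r (ltn0Sn 1)) ?nnegrE ?frob_ge0 ?mulr_ge0//.
have -> : ((m * n)%:R * `|M|) ^+ 2 = (m * n)%:R * ((m * n)%:R * `|M| ^+ 2).
  by rewrite exprMn expr2 mulrA.
rewrite sqr_frob pair_bigA /=.
have h : \sum_(p : 'I_m * 'I_n) M p.1 p.2 ^+ 2 <= (m * n)%:R * `|M| ^+ 2.
  have -> : (m * n)%:R * `|M| ^+ 2 = \sum_(p : 'I_m * 'I_n) `|M| ^+ 2.
    by rewrite sumr_const card_prod !card_ord mulr_natl.
  apply: ler_sum => p _; rewrite -real_normK ?num_real//.
  by rewrite ler_pXn2r ?nnegrE// mx_norm_entry.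
apply: le_trans h _; have [->|mn] := posnP (m * n)%N; first by rewrite !mul0r.
by rewrite ler_peMl ?mulr_ge0 ?exprn_ge0// ler1n.
Qed.

Lemma norm_frob_dot (M N : 'M[R]_(m, n)) :
  `|frob_dot M N| <= (m * n)%:R * (`|M| * `|N|).
Proof.
rewrite /frob_dot pair_bigA /=; apply: le_trans (ler_norm_sum _ _ _) _.
have -> : (m * n)%:R * (`|M| * `|N|) = \sum_(p : 'I_m * 'I_n) `|M| * `|N|.
  by rewrite sumr_const card_prod !card_ord mulr_natl.
apply: ler_sum => p _; rewrite normrM.
by apply: ler_pM => //; apply: mx_norm_entry.
Qed.

Lemma sqr_mx_norm_le (M : 'M[R]_(m, n)) : `|M| ^+ 2 <= frob M ^+ 2.
Proof.
rewrite ler_pXn2r ?nnegrE ?frob_ge0//; apply/le_mx_norm; first exact: frob_ge0.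
move=> i j; rewrite -sqrtr_sqr ler_wsqrtr// (bigD1 i)//= (bigD1 j)//= -addrA lerDl.
apply: addr_ge0; first by apply: sumr_ge0 => k _; exact: sqr_ge0.
by apply: sumr_ge0 => k _; apply: sumr_ge0 => l _; exact: sqr_ge0.
Qed.

End TameMatrix.

Lemma tame_step_const (R : realType) (V : normedModType R) m n
    (G : V -> 'M[R]_(m, n)) : (forall i j, tame (fun x => G x i j)) ->
  forall B : R, exists C : R, forall x, `|x| <= B -> step_const (G x) <= C.
Proof.
move=> tG B.
have tH i j : tame (fun x => (G x *m (G x)^T) i j).
  have [d td] : tame (fun x => \sum_k G x i k * G x j k).
    by apply: tame_sum => k; apply: tameM.
  exists d; apply: eq_taylor td => // x.
  by rewrite mxE; apply: eq_bigr => k _; rewrite mxE.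
have [C [C0 h]] := tame_mx_lipschitz tH B.
exists ((m * m)%:R * C + 1) => x xB; rewrite /step_const ge_max; apply/andP; split.
  apply: le_trans (le_frob _) _; apply: le_trans (_ : _ <= (m * m)%:R * C) _.
    by apply: ler_wpM2l => //; have [] := h x x xB xB.
  by rewrite lerDl.
by rewrite lerDr mulr_ge0.
Qed.

Section VariableSpace.
Variables (R : realType) (I J K r : nat).
Notation W := (var_space R I J K r).
Implicit Types (w u h : W).

Definition varX w : 'M[R]_(I, r) := w.1.1.1.
Definition varY w : 'M[R]_(J, r) := w.1.1.2.
Definition varZ w : 'M[R]_(K, r) := w.1.2.
Definition vara w : 'rV[R]_r := w.2.

Lemma var_normE w :
  `|w| = Num.max (Num.max (Num.max `|varX w| `|varY w|) `|varZ w|) `|vara w|.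
Proof.
have E (U V : normedModType R) (x : U * V) : `|x| = Num.max `|x.1| `|x.2|.
  exact: prod_normE.
case: w => [[[X Y] Z] a]; apply: etrans (E _ _ _) _; congr Num.max.
Qed.

Lemma le_var_norm w (e : R) : `|w| <= e <->
  [/\ `|varX w| <= e, `|varY w| <= e, `|varZ w| <= e & `|vara w| <= e].
Proof.
rewrite var_normE.
rewrite !ge_max; split=> [/andP[/andP[/andP[? ?] ?] ?]|[-> -> -> ->]//].
by split.
Qed.

Lemma norm_varX w : `|varX w| <= `|w|.
Proof. by have /le_var_norm[] := lexx `|w|. Qed.

Lemma norm_varY w : `|varY w| <= `|w|.
Proof. by have /le_var_norm[] := lexx `|w|. Qed.

Lemma norm_varZ w : `|varZ w| <= `|w|.
Proof. by have /le_var_norm[] := lexx `|w|. Qed.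

Lemma norm_vara w : `|vara w| <= `|w|.
Proof. by have /le_var_norm[] := lexx `|w|. Qed.

Lemma point_dotE u w : point_dot u w = frob_dot (varX u) (varX w) +
  frob_dot (varY u) (varY w) + frob_dot (varZ u) (varZ w) + frob_dot (vara u) (vara w).
Proof. by case: u => [[[? ?] ?] ?]; case: w => [[[? ?] ?] ?]. Qed.

(** The number of real unknowns; it compares the inner product with the maximum norms. *)
Definition nvars : R := (I * r + J * r + K * r + 1 * r)%:R.

Lemma norm_point_dot u w : `|point_dot u w| <= nvars * (`|u| * `|w|).
Proof.
have b m n (M N : 'M[R]_(m, n)) : `|M| <= `|u| -> `|N| <= `|w| ->
    `|frob_dot M N| <= (m * n)%:R * (`|u| * `|w|).
  move=> Mu Nw; apply: le_trans (norm_frob_dot _ _) _.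
  by apply: ler_wpM2l => //; apply: ler_pM.
have -> : nvars * (`|u| * `|w|) = (I * r)%:R * (`|u| * `|w|) + (J * r)%:R * (`|u| * `|w|)
    + (K * r)%:R * (`|u| * `|w|) + (1 * r)%:R * (`|u| * `|w|).
  by rewrite /nvars !natrM; ring.
rewrite point_dotE.
apply: le_trans (ler_normD _ _) _; apply: lerD; last by apply: b; exact: norm_vara.
apply: le_trans (ler_normD _ _) _; apply: lerD; last by apply: b; exact: norm_varZ.
apply: le_trans (ler_normD _ _) _; apply: lerD; last by apply: b; exact: norm_varY.
by apply: b; exact: norm_varX.
Qed.

Lemma sqr_norm_le_point_dot w : `|w| ^+ 2 <= point_dot w w.
Proof.
have fE m n (M : 'M[R]_(m, n)) : frob_dot M M = frob M ^+ 2.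
  by rewrite sqr_frob; apply: eq_bigr => i _; apply: eq_bigr.
rewrite point_dotE !fE.
have := sqr_mx_norm_le (varX w); have := sqr_mx_norm_le (varY w).
have := sqr_mx_norm_le (varZ w); have := sqr_mx_norm_le (vara w).
rewrite var_normE.
have p m n (M : 'M[R]_(m, n)) : 0 <= frob M ^+ 2 by exact: sqr_ge0.
have := p _ _ (varX w); have := p _ _ (varY w).
have := p _ _ (varZ w); have := p _ _ (vara w).
set x := `|varX w|; set y := `|varY w|; set z := `|varZ w|; set t := `|vara w|.
case: (leP (Num.max (Num.max x y) z) t) => _; first by lra.
case: (leP (Num.max x y) z) => _; first by lra.
by case: (leP x y) => _; lra.
Qed.

Lemma tame_X i c : tame (fun w => varX w i c).
Proof.
apply: tame_linear => [w|w w']; last by rewrite [LHS]mxE [X in _ + X]mxE.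
exact: le_trans (mx_norm_entry _ _ _) (norm_varX w).
Qed.

Lemma tame_Y i c : tame (fun w => varY w i c).
Proof.
apply: tame_linear => [w|w w']; last by rewrite [LHS]mxE [X in _ + X]mxE.
exact: le_trans (mx_norm_entry _ _ _) (norm_varY w).
Qed.

Lemma tame_Z i c : tame (fun w => varZ w i c).
Proof.
apply: tame_linear => [w|w w']; last by rewrite [LHS]mxE [X in _ + X]mxE.
exact: le_trans (mx_norm_entry _ _ _) (norm_varZ w).
Qed.

Lemma tame_a i c : tame (fun w => vara w i c).
Proof.
apply: tame_linear => [w|w w']; last by rewrite [LHS]mxE [X in _ + X]mxE.
exact: le_trans (mx_norm_entry _ _ _) (norm_vara w).
Qed.

Lemma tame_cp_entry (fa : W -> 'rV[R]_r) (fX : W -> 'M[R]_(I, r))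
    (fY : W -> 'M[R]_(J, r)) (fZ : W -> 'M[R]_(K, r)) p :
  (forall i c, tame (fun w => fa w i c)) -> (forall i c, tame (fun w => fX w i c)) ->
  (forall i c, tame (fun w => fY w i c)) -> (forall i c, tame (fun w => fZ w i c)) ->
  tame (fun w => cp_entry (fa w) (fX w) (fY w) (fZ w) p).
Proof.
move=> ta tX tY tZ; apply: tame_sum => c; apply: tameM => //.
by apply: tameM => //; apply: tameM.
Qed.

Lemma tame_Umat m n (fa : W -> 'rV[R]_r) (fY : W -> 'M[R]_(m, r))
    (fZ : W -> 'M[R]_(n, r)) i j :
  (forall i c, tame (fun w => fa w i c)) ->
  (forall i c, tame (fun w => fY w i c)) -> (forall i c, tame (fun w => fZ w i c)) ->
  tame (fun w => Umat (fa w) (fY w) (fZ w) i j).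
Proof.
move=> ta tY tZ.
have [d td] := tameM (ta 0 i) (tameM (tZ (mxtens_unindex j).1 i) (tY (mxtens_unindex j).2 i)).
by exists d; apply: eq_taylor td => // w; rewrite UmatE.
Qed.

Lemma tame_Qmat i j : tame (fun w => Qmat (varX w) (varY w) (varZ w) i j).
Proof.
pose p := mxtens_unindex j; pose q := mxtens_unindex p.1.
have [d td] := tameM (tameM (tame_X q.1 i) (tame_Y q.2 i)) (tame_Z p.2 i).
by exists d; apply: eq_taylor td => // w; rewrite !mxE /= ffunE /= !mxE.
Qed.

Variable A : tensor R I J K.

Definition obj w := objective A (varX w) (varY w) (varZ w) (vara w).
Definition cpw w := cp_entry (vara w) (varX w) (varY w) (varZ w).

Definition gradX w := grad (fun M => objective A M (varY w) (varZ w) (vara w)) (varX w).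
Definition gradY w := grad (fun M => objective A (varX w) M (varZ w) (vara w)) (varY w).
Definition gradZ w := grad (fun M => objective A (varX w) (varY w) M (vara w)) (varZ w).
Definition grada w := grad (fun b => objective A (varX w) (varY w) (varZ w) b) (vara w).

Lemma frob_dot_gradX w H : frob_dot (gradX w) H =
  - \sum_p (A p - cpw w p) * cp_entry (vara w) H (varY w) (varZ w) p.
Proof.
exact: (frob_dot_grad_quadratic (cp_entry_linX _ _ _)
  (fun M => objectiveE A M (varY w) (varZ w) (vara w)) (varX w) H).
Qed.

Lemma frob_dot_gradY w H : frob_dot (gradY w) H =
  - \sum_p (A p - cpw w p) * cp_entry (vara w) (varX w) H (varZ w) p.
Proof.
exact: (frob_dot_grad_quadratic (cp_entry_linY _ _ _)
  (fun M => objectiveE A (varX w) M (varZ w) (vara w)) (varY w) H).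
Qed.

Lemma frob_dot_gradZ w H : frob_dot (gradZ w) H =
  - \sum_p (A p - cpw w p) * cp_entry (vara w) (varX w) (varY w) H p.
Proof.
exact: (frob_dot_grad_quadratic (cp_entry_linZ _ _ _)
  (fun M => objectiveE A (varX w) (varY w) M (vara w)) (varZ w) H).
Qed.

Lemma frob_dot_grada w H : frob_dot (grada w) H =
  - \sum_p (A p - cpw w p) * cp_entry H (varX w) (varY w) (varZ w) p.
Proof.
exact: (frob_dot_grad_quadratic (cp_entry_lina _ _ _)
  (fun M => objectiveE A (varX w) (varY w) (varZ w) M) (vara w) H).
Qed.

Lemma tame_cpw p : tame (fun w => cpw w p).
Proof.
by apply: tame_cp_entry; [exact: tame_a|exact: tame_X|exact: tame_Y|exact: tame_Z].
Qed.

Lemma frob_dot_delta m n (M : 'M[R]_(m, n)) i j : frob_dot M (delta_mx i j) = M i j.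
Proof.
rewrite /frob_dot (bigD1 i)//= (bigD1 j)//= !mxE !eqxx mulr1 !big1 ?addr0//.
  by move=> k ki; rewrite big1// => l _; rewrite mxE (negbTE ki) mulr0.
by move=> l lj; rewrite mxE (negbTE lj) andbF mulr0.
Qed.

Lemma tame_grad_entry (T : W -> 'I_I * 'I_J * 'I_K -> R) :
  (forall p, tame (fun w => T w p)) -> tame (fun w => - \sum_p (A p - cpw w p) * T w p).
Proof.
move=> tT; apply: tameN; apply: tame_sum => p; apply: tameM => //.
by apply: tameD; [exact: tame_const|apply: tameN; exact: tame_cpw].
Qed.

Let tame_cst m n (M : 'M[R]_(m, n)) i j : tame (fun _ : W => M i j).
Proof. exact: tame_const. Qed.

(** Pairing the gradient with [delta_mx i c] writes each entry as an explicit polynomial in the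
    variables. *)
Lemma tame_gradX i c : tame (fun w => gradX w i c).
Proof.
have [d td] : tame (fun w => - \sum_p (A p - cpw w p) *
    cp_entry (vara w) (delta_mx i c) (varY w) (varZ w) p).
  apply: tame_grad_entry => p; apply: tame_cp_entry => //;
    by [exact: tame_a|exact: tame_Y|exact: tame_Z].
by exists d; apply: eq_taylor td => // w; rewrite -frob_dot_gradX frob_dot_delta.
Qed.

Lemma tame_gradY i c : tame (fun w => gradY w i c).
Proof.
have [d td] : tame (fun w => - \sum_p (A p - cpw w p) *
    cp_entry (vara w) (varX w) (delta_mx i c) (varZ w) p).
  apply: tame_grad_entry => p; apply: tame_cp_entry => //;
    by [exact: tame_a|exact: tame_X|exact: tame_Z].
by exists d; apply: eq_taylor td => // w; rewrite -frob_dot_gradY frob_dot_delta.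
Qed.

Lemma tame_gradZ i c : tame (fun w => gradZ w i c).
Proof.
have [d td] : tame (fun w => - \sum_p (A p - cpw w p) *
    cp_entry (vara w) (varX w) (varY w) (delta_mx i c) p).
  apply: tame_grad_entry => p; apply: tame_cp_entry => //;
    by [exact: tame_a|exact: tame_X|exact: tame_Y].
by exists d; apply: eq_taylor td => // w; rewrite -frob_dot_gradZ frob_dot_delta.
Qed.

Lemma tame_grada i c : tame (fun w => grada w i c).
Proof.
have [d td] : tame (fun w => - \sum_p (A p - cpw w p) *
    cp_entry (delta_mx i c) (varX w) (varY w) (varZ w) p).
  apply: tame_grad_entry => p; apply: tame_cp_entry => //;
    by [exact: tame_X|exact: tame_Y|exact: tame_Z].
by exists d; apply: eq_taylor td => // w; rewrite -frob_dot_grada frob_dot_delta.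
Qed.

Definition gradient w : W := (gradX w, gradY w, gradZ w, grada w).

Lemma taylor_cpw p : taylor (fun w => cpw w p) (fun w h =>
  cp_entry (vara w) (varX h) (varY w) (varZ w) p +
  cp_entry (vara w) (varX w) (varY h) (varZ w) p +
  cp_entry (vara w) (varX w) (varY w) (varZ h) p +
  cp_entry (vara h) (varX w) (varY w) (varZ w) p).
Proof.
have tX c : taylor (fun w => varX w p.1.1 c) (fun _ h => varX h p.1.1 c).
  apply: taylor_linear => [w|w w']; last by rewrite [LHS]mxE [X in _ + X]mxE.
  exact: le_trans (mx_norm_entry _ _ _) (norm_varX w).
have tY c : taylor (fun w => varY w p.1.2 c) (fun _ h => varY h p.1.2 c).
  apply: taylor_linear => [w|w w']; last by rewrite [LHS]mxE [X in _ + X]mxE.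
  exact: le_trans (mx_norm_entry _ _ _) (norm_varY w).
have tZ c : taylor (fun w => varZ w p.2 c) (fun _ h => varZ h p.2 c).
  apply: taylor_linear => [w|w w']; last by rewrite [LHS]mxE [X in _ + X]mxE.
  exact: le_trans (mx_norm_entry _ _ _) (norm_varZ w).
have ta c : taylor (fun w => vara w 0 c) (fun _ h => vara h 0 c).
  apply: taylor_linear => [w|w w']; last by rewrite [LHS]mxE [X in _ + X]mxE.
  exact: le_trans (mx_norm_entry _ _ _) (norm_vara w).
apply: eq_taylor (taylor_sum (fun c =>
  taylorM (ta c) (taylorM (taylorM (tX c) (tY c)) (tZ c)))) => // w h.
rewrite /cp_entry -!big_split; apply: eq_bigr => c _ /=; ring.
Qed.

Lemma taylor_obj : taylor obj (fun w h => point_dot (gradient w) h).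
Proof.
have tE p := taylorD (taylor_const W (A p)) (taylorZ (-1) (taylor_cpw p)).
apply: eq_taylor (taylorZ 2^-1 (taylor_sum (fun p => taylorM (tE p) (tE p)))) => w.
  rewrite /obj objectiveE; congr (_ * _); apply: eq_bigr => p _.
  by rewrite mulN1r expr2.
move=> h; rewrite point_dotE frob_dot_gradX frob_dot_gradY frob_dot_gradZ frob_dot_grada.
rewrite -!sumrN -!big_split mulr_sumr; apply: eq_bigr => p _ /=.
by rewrite mulN1r; field.
Qed.

End VariableSpace.

(** * Subgradients *)

(** Both columns have norm one, so expanding the square of the difference leaves only the cross
    term: chords of a sphere are tangential up to second order. *)
Lemma sphere_dot (R : realType) m r (M M' : 'M[R]_(m, r)) c :
  unit_cols M -> unit_cols M' ->
  \sum_i M i c * (M' - M) i c = - 2^-1 * \sum_i (M' - M) i c ^+ 2.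
Proof.
move=> /unit_colsP/(_ c) uM /unit_colsP/(_ c) uM'.
rewrite mulr_sumr; apply/eqP; rewrite -subr_eq0 -sumrB; apply/eqP.
transitivity (2^-1 * (\sum_i M' i c ^+ 2 - \sum_i M i c ^+ 2)).
  rewrite -sumrB mulr_sumr; apply: eq_bigr => i _.
  by rewrite !mxE; field.
by rewrite uM uM' subrr mulr0.
Qed.

(* Modulo a quadratic error, displacements along the spheres do not see the
   normal part [m c * M i c] of [U]. *)
Lemma normal_component (R : realType) m r (B C : R) :
  exists D : R, 0 <= D /\ forall (M M' U G : 'M[R]_(m, r)) (k : 'I_r -> R),
  `|M| <= B -> `|U| <= B -> `|G| <= C -> unit_cols M -> unit_cols M' ->
  (forall i c, U i c = G i c + k c * M i c) ->
  `|frob_dot U (M' - M) - frob_dot G (M' - M)| <= D * `|M' - M| ^+ 2.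
Proof.
pose k0 : R := \sum_(i < m) (`|B| + `|C|) * `|B|.
have k00 : 0 <= k0 by apply: sumr_ge0 => i _; rewrite mulr_ge0 ?addr_ge0.
exists (\sum_(c < r) k0 * \sum_(i < m) 1); split.
  by apply: sumr_ge0 => c _; rewrite mulr_ge0 ?sumr_ge0.
move=> M M' U G k MB UB GC uM uM' UE.
(* The multiplier is recovered by pairing [U - G] with the unit column of [M], hence is bounded by
   the data. *)
have kb c : `|k c| <= k0.
  have -> : k c = \sum_i (U i c - G i c) * M i c.
    transitivity (k c * \sum_i M i c ^+ 2).
      by have /unit_colsP -> := uM; rewrite mulr1.
    by rewrite mulr_sumr; apply: eq_bigr => i _; rewrite UE; ring.
  apply: le_trans (ler_norm_sum _ _ _) _; apply: ler_sum => i _.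
  rewrite normrM; apply: ler_pM => //.
    apply: le_trans (ler_normB _ _) _; apply: lerD.
      exact: le_trans (mx_norm_entry _ _ _) (le_trans UB (ler_norm _)).
    exact: le_trans (mx_norm_entry _ _ _) (le_trans GC (ler_norm _)).
  exact: le_trans (mx_norm_entry _ _ _) (le_trans MB (ler_norm _)).
set H := M' - M.
have -> : frob_dot U H - frob_dot G H = \sum_c k c * \sum_i M i c * H i c.
  rewrite /frob_dot -sumrB.
  under eq_bigr do rewrite -sumrB.
  rewrite exchange_big; apply: eq_bigr => c _ /=; rewrite mulr_sumr.
  by apply: eq_bigr => i _; rewrite UE; ring.
apply: le_trans (ler_norm_sum _ _ _) _; rewrite mulr_suml; apply: ler_sum => c _.
rewrite sphere_dot// -/H normrM -mulrA; apply: ler_pM => //.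
rewrite mulr_suml normrM normrN -[leRHS]mul1r; apply: ler_pM => //.
  by rewrite ger0_norm ?invr_ge0// invf_le1 ?ler1n.
apply: le_trans (ler_norm_sum _ _ _) _; apply: ler_sum => i _.
by rewrite normrX mul1r ler_pXn2r ?nnegrE// mx_norm_entry.
Qed.

Section Stationary.
Variables (R : realType) (I J K r : nat) (A : tensor R I J K) (lambda : R).
Notation W := (var_space R I J K r).
Implicit Types (w u : W).

Definition feasible w :=
  [/\ unit_cols (varX w), unit_cols (varY w) & unit_cols (varZ w)].

Definition Phi w := obj A w + lambda * norm1 (vara w).

Definition normal_form w u (v : 'rV[R]_r) (kX kY kZ : 'I_r -> R) :=
  [/\ forall i c, varX u i c = gradX A w i c + kX c * varX w i c,
      forall i c, varY u i c = gradY A w i c + kY c * varY w i c,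
      forall i c, varZ u i c = gradZ A w i c + kZ c * varZ w i c &
      forall c, vara u 0 c = grada A w 0 c + lambda * v 0 c].

(* Explicit elements [u] of the subdifferential of [Psi] at [w]; [kX], [kY], [kZ]
   are the multipliers of the sphere constraints. *)
Definition subgradient w u v := l1_subgradient (vara w) v /\
  exists kX kY kZ, normal_form w u v kX kY kZ.

(** The added sum cancels the part [lambda *: v] of [u], so only the smooth part is expanded. The l1
    term is handled later in two ways: by convexity for the Frechet inequality, by fixed signs for
    the slope. *)
Lemma subgradient_expansion (B : R) : exists C : R, 0 <= C /\
  forall w w' u v, `|w| <= B -> `|w'| <= B -> `|u| <= B ->
  feasible w -> feasible w' -> subgradient w u v ->
  `|obj A w' - obj A w - point_dot u (w' - w) +
     lambda * \sum_c v 0 c * (vara w' 0 c - vara w 0 c)| <= C * `|w' - w| ^+ 2.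
Proof.
have [C0 [C00 hC0]] := taylor_obj r A B.
have [CX [CX0 hX]] := tame_mx_lipschitz (G := @gradX R I J K r A) (tame_gradX A) B.
have [CY [CY0 hY]] := tame_mx_lipschitz (G := @gradY R I J K r A) (tame_gradY A) B.
have [CZ [CZ0 hZ]] := tame_mx_lipschitz (G := @gradZ R I J K r A) (tame_gradZ A) B.
have [DX [DX0 nX]] := normal_component I r B CX.
have [DY [DY0 nY]] := normal_component J r B CY.
have [DZ [DZ0 nZ]] := normal_component K r B CZ.
exists (C0 + DX + DY + DZ); split; first by rewrite !addr_ge0.
move=> w w' u v wB w'B uB [uX uY uZ] [uX' uY' uZ'] [_ [kX [kY [kZ [eX eY eZ ea]]]]].
have [_ _ h0] := hC0 w w' wB w'B.
have [gX _] := hX w w wB wB; have [gY _] := hY w w wB wB.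
have [gZ _] := hZ w w wB wB.
have := nX _ _ _ _ kX (le_trans (norm_varX w) wB) (le_trans (norm_varX u) uB) gX uX uX' eX.
have := nY _ _ _ _ kY (le_trans (norm_varY w) wB) (le_trans (norm_varY u) uB) gY uY uY' eY.
have := nZ _ _ _ _ kZ (le_trans (norm_varZ w) wB) (le_trans (norm_varZ u) uB) gZ uZ uZ' eZ.
have sq m n (M : 'M[R]_(m, n)) (D e : R) : 0 <= D -> `|M| <= `|w' - w| ->
    e <= D * `|M| ^+ 2 -> e <= D * `|w' - w| ^+ 2.
  by move=> D0 Mw /le_trans; apply; apply: ler_wpM2l => //; rewrite ler_pXn2r ?nnegrE.
move=> /(sq _ _ _ _ _ DZ0 (norm_varZ (w' - w))) bZ.
move=> /(sq _ _ _ _ _ DY0 (norm_varY (w' - w))) bY.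
move=> /(sq _ _ _ _ _ DX0 (norm_varX (w' - w))) bX.
rewrite point_dotE.
have -> : frob_dot (vara u) (vara (w' - w)) = frob_dot (grada A w) (vara (w' - w)) +
   lambda * \sum_c v 0 c * (vara w' 0 c - vara w 0 c).
  rewrite /frob_dot !big_ord1 mulr_sumr -big_split; apply: eq_bigr => c _ /=.
  have -> : vara (w' - w) 0 c = vara w' 0 c - vara w 0 c.
    by rewrite [LHS]mxE [X in _ + X]mxE.
  by rewrite ea; ring.
rewrite point_dotE in h0.
move: bX bY bZ h0.
rewrite -[varX (w' - w)]/(varX w' - varX w) -[varY (w' - w)]/(varY w' - varY w).
rewrite -[varZ (w' - w)]/(varZ w' - varZ w) -[vara (gradient A w)]/(grada A w).
rewrite -[varX (gradient A w)]/(gradX A w) -[varY (gradient A w)]/(gradY A w).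
rewrite -[varZ (gradient A w)]/(gradZ A w).
set e := `|w' - w| ^+ 2; set S := \sum_c _; set f' := obj A w'; set f := obj A w.
set x := frob_dot (varX u) _; set x' := frob_dot (gradX _ _) _.
set y := frob_dot (varY u) _; set y' := frob_dot (gradY _ _) _.
set z := frob_dot (varZ u) _; set z' := frob_dot (gradZ _ _) _.
set t' := frob_dot (grada _ _) _.
move=> bX bY bZ h0.
rewrite (_ : _ + _ = (f' - f - (x' + y' + z' + t')) - (x - x') - (y - y') - (z - z')); last by ring.
rewrite !mulrDl.
do 3! (apply: le_trans (ler_normB _ _) _; apply: lerD => //).
Qed.

Lemma PsiE w : feasible w -> Psi A lambda w = (Phi w)%:E.
Proof.
case: w => [[[X Y] Z] a] [uX uY uZ]; rewrite /Psi /indicator !asboolT//.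
by rewrite !adde0.
Qed.

Lemma Psi_infeasible w : ~ feasible w -> Psi A lambda w = +oo%E.
Proof.
case: w => [[[X Y] Z] a] nf; rewrite /Psi /indicator.
by case: asboolP => uX; case: asboolP => uY; case: asboolP => uZ //; case: nf.
Qed.

(** At infeasible [y] the quotient is infinite. At feasible [y] the expansion and convexity of the
    l1 norm leave only a quadratic error, which is negligible against the Euclidean distance because
    that dominates the norm. *)
Lemma frechet_subgradient w u v : 0 < lambda -> feasible w -> subgradient w u v ->
  frechet_subdiff (@point_dot R I J K r) (Psi A lambda) w u.
Proof.
have alg1 (C e x y : R) : 0 <= C -> 0 <= x -> x <= y -> (C + 1) * x <= e ->
    C * x ^+ 2 <= e * y.
  move=> C0 x0 xy Ce.
  have e0 : 0 <= e by apply: le_trans Ce; rewrite mulr_ge0 ?addr_ge0.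
  by have := ler_wpM2r x0 Ce; have := ler_wpM2l e0 xy; have := sqr_ge0 x; lra.
have alg2 (a b S T1 T2 l p q E : R) : - q <= a - b - p + l * S ->
    l * S <= l * (T1 - T2) -> q <= E -> - E <= a + l * T1 - (b + l * T2) - p by lra.
move=> l0 fw su; split; first by rewrite PsiE.
rewrite PsiE//.
have [C [C0 hC]] := subgradient_expansion (Num.max (`|w| + 1) `|u|).
rewrite limf_einfE; apply/lee_subgt0Pr => e e0; rewrite sub0e.
(* The 1 keeps [y] in the ball where the expansion holds; the other bound makes
   [(C + 1) * |y - w| <= e]. *)
pose d := Num.min 1 (e / (C + 1)).
have C10 : 0 < C + 1 by rewrite ltr_wpDl.
have d0 : 0 < d by rewrite lt_min ltr01 divr_gt0.
suff key y : `|y - w| < d -> y != w -> ((- e)%:E <=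
    (Psi A lambda y - (Phi w)%:E - (point_dot u (y - w))%:E) *
    ((Num.sqrt (point_dot (y - w) (y - w)))^-1)%:E)%E.
  apply: le_trans (ereal_sup_ubound _); last first.
    exists [set y | `|y - w| < d /\ y != w]; last by reflexivity.
    have : nbhs w [set y | `|y - w| < d].
      by apply: filterS (nbhsx_ballx w d d0) => y; rewrite -ball_normE /= distrC.
    by apply: filterS => y yd yw.
  by apply: le_ereal_inf_tmp => _ [y [yd yw] <-]; exact: key.
move=> yd yw.
have yw0 : 0 < `|y - w| by rewrite normr_gt0 subr_eq0.
have sq := sqr_norm_le_point_dot (y - w).
set D := point_dot (y - w) (y - w) in sq *.
have ND : `|y - w| <= Num.sqrt D.
  by rewrite -[leLHS]ger0_norm// -sqrtr_sqr; exact: ler_wsqrtr.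
have D0 : 0 < Num.sqrt D by apply: lt_le_trans ND.
have [fy|nfy] := pselect (feasible y); last first.
  by rewrite Psi_infeasible// addye// gt0_mulye ?lte_fin ?invr_gt0// leey.
rewrite PsiE// -!EFinB -EFinM lee_fin.
rewrite ler_pdivlMr// mulNr.
have yB : `|y| <= Num.max (`|w| + 1) `|u|.
  rewrite le_max -(subrK w y) addrC; apply/orP; left.
  apply: le_trans (ler_normD _ _) _; rewrite lerD2l.
  by apply: ltW; apply: lt_le_trans yd _; rewrite ge_min lexx.
have wB : `|w| <= Num.max (`|w| + 1) `|u| by rewrite le_max lerDl ler01.
have uB : `|u| <= Num.max (`|w| + 1) `|u| by rewrite le_max lexx orbT.
have := hC w y u v wB yB uB fw fy su; rewrite ler_norml => /andP[h _].
have [va _] := su.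
have := le_l1_subgradient (vara y) va; rewrite -(ler_pM2l l0) => h'.
have hq : C * `|y - w| ^+ 2 <= e * Num.sqrt D.
  have Ce : (C + 1) * `|y - w| <= e.
    rewrite mulrC -ler_pdivlMr//; apply: ltW; apply: lt_le_trans yd _.
    by rewrite ge_min lexx orbT.
  exact: alg1.
exact: alg2 h h' hq.
Qed.

(** The sign condition makes the l1 norm linear between [w] and [w'], so the subgradient inequality
    for it becomes an equality and [u] bounds the growth of [Phi] from above as well. *)
Lemma slope_of_subgradient (B : R) : 0 < lambda -> exists L : R, 0 <= L /\
  forall w w' u v, `|w| <= B -> `|w'| <= B -> `|u| <= B ->
  feasible w -> feasible w' -> subgradient w u v ->
  (forall c, `|vara w' 0 c| = Num.sg (vara w 0 c) * vara w' 0 c) ->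
  Phi w' - Phi w <= (nvars R I J K r * `|u|) * `|w' - w| + L * `|w' - w| ^+ 2.
Proof.
have alg (a b p l S T q g : R) : a - b - p + l * (S - T) <= q -> p <= g ->
    a + l * S - (b + l * T) <= g + q by lra.
move=> l0; have [L [L0 hL]] := subgradient_expansion B.
exists L; split=> // w w' u v wB w'B uB fw fw' su sg.
have := hL w w' u v wB w'B uB fw fw' su.
have := norm_point_dot u (w' - w).
have -> : \sum_c v 0 c * (vara w' 0 c - vara w 0 c) = norm1 (vara w') - norm1 (vara w).
  rewrite /norm1 -sumrB; apply: eq_bigr => c _.
  have [hv _] := su; have [_ va] := hv c.
  rewrite mulrBr va; congr (_ - _); rewrite sg.
  (* Where the entry of [w] is 0 the value of [v] is undetermined, but the sign condition forces the
     entry of [w'] to be 0 too. *)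
  have [a0|a0] := eqVneq (vara w 0 c) 0.
    have := sg c; rewrite a0 sgr0 mul0r => /eqP; rewrite normr_eq0 => /eqP ->.
    by rewrite !mulr0.
  by congr (_ * _); apply: (mulIf a0); rewrite va normrEsg.
rewrite mulrA !ler_norml => /andP[_ h1] /andP[_ h2].
exact: alg h2 h1.
Qed.

End Stationary.

(** * One step of the algorithm *)

Lemma frob_dot_self (R : realType) m n (M : 'M[R]_(m, n)) : frob_dot M M = frob M ^+ 2.
Proof. by rewrite sqr_frob; apply: eq_bigr => i _; apply: eq_bigr. Qed.

Lemma step_const_ge1 (R : realType) m n (M : 'M[R]_(m, n)) : 1 <= step_const M.
Proof. by rewrite /step_const le_max lexx orbT. Qed.

Lemma frob_le_step_const (R : realType) m n (M : 'M[R]_(m, n)) :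
  frob (M *m M^T) <= step_const M.
Proof. by rewrite /step_const le_max lexx. Qed.

Lemma block_descent (R : realType) (m r q : nat) (P : finType) (A : P -> R)
    (T : 'M[R]_(m, r) -> P -> R) (h : 'M[R]_(m, r) -> R) (U : 'M[R]_(r, q))
    (s : R) (M M' : 'M[R]_(m, r)) :
  (forall k M N p, T (k *: M + N) p = k * T M p + T N p) ->
  (forall M, h M = 2^-1 * \sum_p (A p - T M p) ^+ 2) ->
  (forall H, \sum_p T H p ^+ 2 <= frob (U *m U^T) * frob H ^+ 2) -> 1 < s ->
  h M' <= h M + frob_dot (grad h M) (M' - M)
    + step_const U / 2 * frob (M' - M) ^+ 2.
Proof.
move=> linT hE Tb s1; rewrite (quadratic_step linT hE M M') lerD2l mulrAC mulrC.
rewrite ler_pM2r ?invr_gt0//; apply: le_trans (Tb _) _.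
by apply: ler_wpM2r; [exact: sqr_ge0|exact: frob_le_step_const].
Qed.

Lemma le_sum4 (R : realType) (x y z t : R) : 0 <= x -> 0 <= y -> 0 <= z -> 0 <= t ->
  [/\ x <= x + y + z + t, y <= x + y + z + t, z <= x + y + z + t & t <= x + y + z + t].
Proof. by move=> x0 y0 z0 t0; split; lra. Qed.

Section LratStep.
Variables (R : realType) (I J K r : nat) (A : tensor R I J K) (lambda s : R).
Notation W := (var_space R I J K r).
Implicit Types (w u : W).
Hypotheses (lambda_gt0 : 0 < lambda) (s_gt1 : 1 < s).

Lemma sqr_norm_le_frob w w' : `|w' - w| ^+ 2 <=
  frob (varX w' - varX w) ^+ 2 + frob (varY w' - varY w) ^+ 2 +
  frob (varZ w' - varZ w) ^+ 2 + frob (vara w' - vara w) ^+ 2.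
Proof. by rewrite -!frob_dot_self; have := sqr_norm_le_point_dot (w' - w); rewrite point_dotE. Qed.

Lemma le_var_normB w w' (e : R) : `|w' - w| <= e <->
  [/\ `|varX w' - varX w| <= e, `|varY w' - varY w| <= e,
      `|varZ w' - varZ w| <= e & `|vara w' - vara w| <= e].
Proof. exact: le_var_norm. Qed.

Let step_gt0 m n (M : 'M[R]_(m, n)) : 0 < s * step_const M.
Proof.
by apply: mulr_gt0; [exact: lt_trans s_gt1|exact: lt_le_trans (step_const_ge1 M)].
Qed.

(** In a sphere block the model loses [s * d / 2] times the squared step and the curvature gives
    back at most [d / 2]. Since [d >= 1], the net factor is at least [(s - 1) / 2], independently of
    the iterate; the [alpha] block does better still. *)
Lemma lrat_step_descent w w' : feasible w -> lrat_step A lambda s w w' ->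
  feasible w' /\ Phi A lambda w' + (s - 1) / 2 * `|w' - w| ^+ 2 <= Phi A lambda w.
Proof.
case: w => [[[X Y] Z] a]; case: w' => [[[X' Y'] Z'] a'].
move=> [/= uX uY uZ] [[nD EX] [nE EY] [nF EZ] Ea].
have [uX' _ dX] := normalize_step (step_gt0 _) uX nD.
have [uY' _ dY] := normalize_step (step_gt0 _) uY nE.
have [uZ' _ dZ] := normalize_step (step_gt0 _) uZ nF.
have [v [va gE]] := prox_step (fun b => objective A X' Y' Z' b) a (step_gt0 (Qmat X' Y' Z')) lambda_gt0.
rewrite -EX in uX' dX; rewrite -EY in uY' dY; rewrite -EZ in uZ' dZ.
rewrite -Ea in va gE.
have da := norm1_prox_le lambda_gt0 va gE.
split=> //.
have bX := block_descent X X' (cp_entry_linX a Y Z)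
  (fun M => objectiveE A M Y Z a) (sum_cp_entryX a Y Z) s_gt1.
have bY := block_descent Y Y' (cp_entry_linY a X' Z)
  (fun M => objectiveE A X' M Z a) (sum_cp_entryY a X' Z) s_gt1.
have bZ := block_descent Z Z' (cp_entry_linZ a X' Y')
  (fun M => objectiveE A X' Y' M a) (sum_cp_entryZ a X' Y') s_gt1.
have ba := block_descent a a' (cp_entry_lina X' Y' Z')
  (fun M => objectiveE A X' Y' Z' M) (sum_cp_entrya X' Y' Z') s_gt1.
have := sqr_norm_le_frob (X, Y, Z, a) (X', Y', Z', a').
move: bX bY bZ ba dX dY dZ da.
have := step_const_ge1 (Umat a Y Z); set d1 := step_const (Umat a Y Z).
have := step_const_ge1 (Umat a X' Z); set d2 := step_const (Umat a X' Z).
have := step_const_ge1 (Umat a X' Y'); set d3 := step_const (Umat a X' Y').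
have := step_const_ge1 (Qmat X' Y' Z'); set d4 := step_const (Qmat X' Y' Z').
have key (d F g h h' : R) : 1 <= d -> 0 <= F -> h' <= h + g + d / 2 * F ->
    g + s * d / 2 * F <= 0 -> h' + (s - 1) / 2 * F <= h.
  move=> d1_ F0 h1 h2.
  have : 0 <= (s - 1) * (d - 1) * F.
    by apply: mulr_ge0 => //; apply: mulr_ge0; rewrite subr_ge0 ?(ltW s_gt1).
  lra.
have key' (d F g h h' p p' : R) : 1 <= d -> 0 <= F -> h' <= h + g + d / 2 * F ->
    p' + g + s * d * F <= p -> h' + p' + (s - 1) / 2 * F <= h + p.
  move=> d1_ F0 h1 h2.
  have := mulr_ge0 (ltW (lt_trans ltr01 s_gt1)) (mulr_ge0 (le_trans ler01 d1_) F0).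
  have : 0 <= (s - 1) * (d - 1) * F.
    by apply: mulr_ge0 => //; apply: mulr_ge0; rewrite subr_ge0 ?(ltW s_gt1).
  lra.
have sum4 (e F1 F2 F3 F4 g0 g1 g2 g3 g4 p p' : R) : e <= F1 + F2 + F3 + F4 ->
    g1 + (s - 1) / 2 * F1 <= g0 -> g2 + (s - 1) / 2 * F2 <= g1 ->
    g3 + (s - 1) / 2 * F3 <= g2 -> g4 + p' + (s - 1) / 2 * F4 <= g3 + p ->
    g4 + p' + (s - 1) / 2 * e <= g0 + p.
  have c0 : 0 < (s - 1) / 2 by rewrite divr_gt0 ?subr_gt0.
  by rewrite -(ler_pM2l c0); lra.
move=> h4 h3 h2 h1 bX bY bZ ba dX dY dZ da hn.
have kX := key _ _ _ _ _ h1 (sqr_ge0 _) bX dX.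
have kY := key _ _ _ _ _ h2 (sqr_ge0 _) bY dY.
have kZ := key _ _ _ _ _ h3 (sqr_ge0 _) bZ dZ.
have ka := key' _ _ _ _ _ _ _ h4 (sqr_ge0 _) ba da.
exact: sum4 hn kX kY kZ ka.
Qed.

(** Each update satisfies its optimality condition with the gradient at a partially updated point.
    Moving that gradient to [w'] costs a Lipschitz constant times the step. *)
Lemma lrat_step_subgradient (B : R) : exists b : R, 0 <= b /\
  forall w w', `|w| <= B -> `|w'| <= B -> feasible w -> lrat_step A lambda s w w' ->
  exists u v, subgradient A lambda w' u v /\ `|u| <= b * `|w' - w|.
Proof.
have [CX [CX0 hX]] := tame_mx_lipschitz (G := @gradX R I J K r A) (tame_gradX A) B.
have [CY [CY0 hY]] := tame_mx_lipschitz (G := @gradY R I J K r A) (tame_gradY A) B.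
have [CZ [CZ0 hZ]] := tame_mx_lipschitz (G := @gradZ R I J K r A) (tame_gradZ A) B.
have [Ca [Ca0 ha]] := tame_mx_lipschitz (G := @grada R I J K r A) (tame_grada A) B.
have [D1 hD1] := tame_step_const (G := fun w : W => Umat (vara w) (varY w) (varZ w))
  (fun i j => tame_Umat i j (@tame_a _ _ _ _ _) (@tame_Y _ _ _ _ _) (@tame_Z _ _ _ _ _)) B.
have [D2 hD2] := tame_step_const (G := fun w : W => Umat (vara w) (varX w) (varZ w))
  (fun i j => tame_Umat i j (@tame_a _ _ _ _ _) (@tame_X _ _ _ _ _) (@tame_Z _ _ _ _ _)) B.
have [D3 hD3] := tame_step_const (G := fun w : W => Umat (vara w) (varX w) (varY w))
  (fun i j => tame_Umat i j (@tame_a _ _ _ _ _) (@tame_X _ _ _ _ _) (@tame_Y _ _ _ _ _)) B.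
have [D4 hD4] := tame_step_const (G := fun w : W => Qmat (varX w) (varY w) (varZ w))
  (@tame_Qmat _ _ _ _ _) B.
have s0 : 0 < s by exact: lt_trans s_gt1.
(* Lipschitz constants for the differences of gradients, and [s] times bounds on the step constants
   for the displacement terms. *)
pose b := (CX + CY + CZ + Ca) + s * (`|D1| + `|D2| + `|D3| + `|D4|).
exists b; split; first by rewrite !addr_ge0 ?mulr_ge0 ?addr_ge0// ltW.
move=> w w' wB w'B.
case: w w' wB w'B => [[[X Y] Z] a] [[[X' Y'] Z'] a'].
set w : W := (X, Y, Z, a); set w' : W := (X', Y', Z', a').
move=> wB w'B [uX uY uZ] [[nD EX] [nE EY] [nF EZ] Ea].
pose w1 : W := (X', Y, Z, a); pose w2 : W := (X', Y', Z, a); pose w3 : W := (X', Y', Z', a).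
have [_ [nuX gX] _] := normalize_step (step_gt0 _) uX nD.
have [_ [nuY gY] _] := normalize_step (step_gt0 _) uY nE.
have [_ [nuZ gZ] _] := normalize_step (step_gt0 _) uZ nF.
have [v [va ga]] := prox_step (fun b => objective A X' Y' Z' b) a (step_gt0 (Qmat X' Y' Z')) lambda_gt0.
rewrite -EX in gX; rewrite -EY in gY; rewrite -EZ in gZ.
rewrite -Ea in va ga.
have [/le_var_norm[bX bY bZ ba] /le_var_norm[bX' bY' bZ' ba']] := (wB, w'B).
have w1B : `|w1| <= B by apply/le_var_norm; split.
have w2B : `|w2| <= B by apply/le_var_norm; split.
have w3B : `|w3| <= B by apply/le_var_norm; split.
set e := `|w' - w|.
have e0 : 0 <= e by exact: normr_ge0.
have /le_var_normB[eX eY eZ ea] : `|w' - w| <= e by [].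
have z0 m n (M : 'M[R]_(m, n)) : `|M - M| <= e by rewrite subrr normr0.
have e1 : `|w' - w1| <= e.
  by apply/le_var_normB; split; [exact: z0|exact: eY|exact: eZ|exact: ea].
have e2 : `|w' - w2| <= e.
  by apply/le_var_normB; split; [exact: z0|exact: z0|exact: eZ|exact: ea].
have e3 : `|w' - w3| <= e.
  by apply/le_var_normB; split; [exact: z0|exact: z0|exact: z0|exact: ea].
pose d1 := s * step_const (Umat a Y Z); pose d2 := s * step_const (Umat a X' Z).
pose d3 := s * step_const (Umat a X' Y'); pose d4 := s * step_const (Qmat X' Y' Z').
(* Substituting the step equations for the old gradients leaves the gradient at [w'] plus columnwise
   multiples of the new matrices, with factors [d * (nu - 1)], and plus [lambda *: v] in the last
   block. *)
pose u : W := (gradX A w' - gradX A w + d1 *: (X - X'),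
  gradY A w' - gradY A w1 + d2 *: (Y - Y'),
  gradZ A w' - gradZ A w2 + d3 *: (Z - Z'),
  grada A w' - grada A w3 + d4 *: (a - a')).
have entryE m n (G G' M M' : 'M[R]_(m, n)) d i j :
    (G' - G + d *: (M - M')) i j = G' i j - G i j + d * (M i j - M' i j).
  by rewrite !mxE.
have normalE (g' g d x x' nu : R) : g = d * (x - nu * x') ->
    g' - g + d * (x - x') = g' + d * (nu - 1) * x' by move=> ->; ring.
have proxE (g' g y z : R) : g = y - z -> g' - g + y = g' + z by move=> ->; ring.
exists u, v; split.
  split=> //; exists (fun c => d1 * (nuX c - 1)), (fun c => d2 * (nuY c - 1)), (fun c => d3 * (nuZ c - 1)).
  split=> [i c|i c|i c|c].
  - exact: etrans (entryE _ _ _ _ _ _ _ _ _) (normalE _ _ _ _ _ _ (gX i c)).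
  - exact: etrans (entryE _ _ _ _ _ _ _ _ _) (normalE _ _ _ _ _ _ (gY i c)).
  - exact: etrans (entryE _ _ _ _ _ _ _ _ _) (normalE _ _ _ _ _ _ (gZ i c)).
  - exact: etrans (entryE _ _ _ _ _ _ _ _ _) (proxE _ _ _ _ (ga c)).
have bound m n (G G' M M' : 'M[R]_(m, n)) (C D d x : R) : 0 <= C -> 0 < d -> 0 <= x ->
    `|G' - G| <= C * x -> x <= e -> `|M' - M| <= e -> d <= s * `|D| ->
    C <= CX + CY + CZ + Ca -> `|D| <= `|D1| + `|D2| + `|D3| + `|D4| ->
    `|G' - G + d *: (M - M')| <= b * e.
  move=> C0 d0 x0 hG xe hM dD Cle Dle; apply: le_trans (ler_normD _ _) _.
  rewrite mulrDl; apply: lerD.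
    by apply: le_trans hG _; apply: ler_pM.
  rewrite normrZ (gtr0_norm d0) distrC; apply: ler_pM => //; first exact: ltW.
  by apply: le_trans dD _; rewrite ler_pM2l.
have sD (m n : nat) (M : 'M[R]_(m, n)) D : step_const M <= D -> s * step_const M <= s * `|D|.
  by move=> MD; rewrite ler_pM2l// (le_trans MD)// ler_norm.
have n1 := normr_ge0 D1; have n2 := normr_ge0 D2.
have n3 := normr_ge0 D3; have n4 := normr_ge0 D4.
have [c1 c2 c3 c4] := le_sum4 CX0 CY0 CZ0 Ca0.
have [k1 k2 k3 k4] := le_sum4 n1 n2 n3 n4.
apply/le_var_norm; split.
- have [_ h] := hX w w' wB w'B.
  exact: (bound I r (gradX A w) (gradX A w') X X' CX D1 d1 `|w' - w| CX0
    (step_gt0 _) (normr_ge0 _) h (lexx _) eX (sD _ _ _ _ (hD1 w wB)) c1 k1).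
- have [_ h] := hY w1 w' w1B w'B.
  exact: (bound J r (gradY A w1) (gradY A w') Y Y' CY D2 d2 `|w' - w1| CY0
    (step_gt0 _) (normr_ge0 _) h e1 eY (sD _ _ _ _ (hD2 w1 w1B)) c2 k2).
- have [_ h] := hZ w2 w' w2B w'B.
  exact: (bound K r (gradZ A w2) (gradZ A w') Z Z' CZ D3 d3 `|w' - w2| CZ0
    (step_gt0 _) (normr_ge0 _) h e2 eZ (sD _ _ _ _ (hD3 w2 w2B)) c3 k3).
- have [_ h] := ha w3 w' w3B w'B.
  exact: (bound 1%N r (grada A w3) (grada A w') a a' Ca D4 d4 `|w' - w3| Ca0
    (step_gt0 _) (normr_ge0 _) h e3 ea (sD _ _ _ _ (hD4 w3 w3B)) c4 k4).
Qed.

Lemma unit_cols_norm_le1 m (M : 'M[R]_(m, r)) : unit_cols M -> `|M| <= 1.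
Proof.
move=> /unit_colsP uM; apply/le_mx_norm => // i c.
rewrite -(ler_pXn2r (ltn0Sn 1)) ?nnegrE// expr1n -normrX ger0_norm ?sqr_ge0//.
by rewrite -(uM c) (bigD1 i)//= lerDl sumr_ge0// => j _; exact: sqr_ge0.
Qed.

Lemma obj_ge0 w : 0 <= obj A w.
Proof. by rewrite /obj /objective mulr_ge0 ?invr_ge0// sqr_ge0. Qed.

Lemma norm1_le_Phi w : norm1 (vara w) <= Phi A lambda w / lambda.
Proof. by rewrite ler_pdivlMr// mulrC /Phi lerDr obj_ge0. Qed.

Lemma Phi_ge0 w : 0 <= Phi A lambda w.
Proof.
by rewrite /Phi addr_ge0 ?obj_ge0// mulr_ge0 ?(ltW lambda_gt0)// sumr_ge0.
Qed.

(** Unit columns bound the three matrices. The penalty bounds [alpha], because [lambda * norm1] is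
    at most [Phi], which never exceeds its initial value. *)
Lemma lrat_sequence_bounds (omega : nat -> W) : lrat_sequence A lambda s omega ->
  [/\ forall n, feasible (omega n),
    forall n, Phi A lambda (omega n.+1) + (s - 1) / 2 * `|omega n.+1 - omega n| ^+ 2
      <= Phi A lambda (omega n) &
    exists B : R, forall n, `|omega n| <= B].
Proof.
move=> [w0 st].
have fw n : feasible (omega n).
  elim: n => [|n ih]; first by move: w0; case: (omega 0%N) => [[[? ?] ?] ?].
  by have [] := lrat_step_descent ih (st n).
have ds n : Phi A lambda (omega n.+1) + (s - 1) / 2 * `|omega n.+1 - omega n| ^+ 2
      <= Phi A lambda (omega n) by have [] := lrat_step_descent (fw n) (st n).
split=> //; exists (1 + Phi A lambda (omega 0%N) / lambda) => n.
have P0 := Phi_ge0 (omega 0%N).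
have le1 : 1 <= 1 + Phi A lambda (omega 0%N) / lambda.
  by rewrite lerDl divr_ge0// ltW.
have [uX uY uZ] := fw n.
apply/le_var_norm; split; try by apply: le_trans le1; exact: unit_cols_norm_le1.
have Pn : Phi A lambda (omega n) <= Phi A lambda (omega 0%N).
  elim: n {uX uY uZ} => // n ih; apply: le_trans ih; apply: le_trans (ds n).
  by rewrite lerDl mulr_ge0 ?exprn_ge0// divr_ge0// subr_ge0 ltW.
apply: le_trans (_ : norm1 (vara (omega n)) <= _).
  apply/le_mx_norm => [|i c]; first by apply: sumr_ge0.
  by rewrite ord1 /norm1 (bigD1 c)//= lerDl sumr_ge0.
apply: le_trans (norm1_le_Phi _) _.
by rewrite -[leLHS]add0r; apply: lerD => //; rewrite ler_pM2r ?invr_gt0.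
Qed.

End LratStep.

(** * Strata *)

Definition rowpoly (R : realType) n (f : 'rV[R]_n -> R) :=
  polyfun (fun w : nat -> R => f (\row_k w k)).

Section BasicClosed.
Variables (R : realType) (n : nat).
Implicit Types (f g : 'rV[R]_n -> R) (C : set 'rV[R]_n).

Lemma rowpoly_coord k : rowpoly (fun x : 'rV[R]_n => x 0 k).
Proof. by apply: eq_polyfun (polyfun_var R k) => w; rewrite mxE. Qed.

Lemma polyfun_continuous (p : (nat -> R) -> R) : polyfun p ->
  continuous (fun x : 'rV[R]_n => p (fun i => if insub i is Some k then x 0 k else 0)).
Proof.
elim=> [i|c|p1 p2 _ h1 _ h2|p1 p2 _ h1 _ h2].
- by case: insubP => [k _ _|_]; [exact: coord_continuous|exact: cst_continuous].
- exact: cst_continuous.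
- by move=> x; exact: (cvgD (h1 x) (h2 x)).
- by move=> x; exact: (cvgM (h1 x) (h2 x)).
Qed.

Lemma rowpoly_continuous f : rowpoly f -> continuous f.
Proof.
move=> /polyfun_continuous.
rewrite (_ : (fun x => _) = f)//; apply/funext => x.
by rewrite (_ : \row_k _ = x) //; apply/rowP => k; rewrite mxE valK.
Qed.

Definition basic_closed C :=
  definable (fun w : nat -> R => C (\row_k w k)) /\ closed C.

Lemma basic_closed_le f g : rowpoly f -> rowpoly g ->
  basic_closed [set x | f x <= g x].
Proof.
move=> pf pg; split; first exact: definable_le.
by apply: closed_le_fun; exact: rowpoly_continuous.
Qed.

Lemma basic_closedI C D : basic_closed C -> basic_closed D -> basic_closed (C `&` D).
Proof.
by move=> [dC cC] [dD cD]; split; [exact: definable_and|exact: closedI].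
Qed.

Lemma basic_closed_eq f g : rowpoly f -> rowpoly g ->
  basic_closed [set x | f x = g x].
Proof.
move=> pf pg.
rewrite (_ : [set x | f x = g x] = [set x | f x <= g x] `&` [set x | g x <= f x]).
  by apply: basic_closedI; exact: basic_closed_le.
apply/seteqP; split=> x /=; first by move=> ->.
by move=> [h1 h2]; apply/eqP; rewrite eq_le h1.
Qed.

Lemma basic_closed_all (T : finType) (C : T -> set 'rV[R]_n) :
  (forall i, basic_closed (C i)) -> basic_closed [set x | forall i, C i x].
Proof.
move=> bC; split.
  by apply: (definable_all (P := fun i w => C i (\row_k w k))) => i; have [] := bC i.
rewrite (_ : [set x | forall i, C i x] = \bigcap_(i in [set: T]) C i).
  by apply: closed_bigI => i _; have [] := bC i.
by apply/seteqP; split=> x h i; [move=> _|]; apply: h.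
Qed.

End BasicClosed.

Section Strata.
Variables (R : realType) (I J K r : nat) (A : tensor R I J K) (lambda : R).
Notation W := (var_space R I J K r).
Notation n := (I * r + J * r + K * r + r)%N.
Implicit Types (w u : W) (x : 'rV[R]_n).

Definition decode x : W :=
  (vec_mx (lsubmx (lsubmx (lsubmx x))), vec_mx (rsubmx (lsubmx (lsubmx x))),
   vec_mx (rsubmx (lsubmx x)), rsubmx x).

Definition encode w : 'rV[R]_n :=
  row_mx (row_mx (row_mx (mxvec (varX w)) (mxvec (varY w))) (mxvec (varZ w))) (vara w).

Lemma encodeK w : decode (encode w) = w.
Proof.
case: w => [[[X Y] Z] a]; rewrite /decode /encode.
by rewrite !row_mxKl !row_mxKr !mxvecK.
Qed.

Lemma decodeX x i c : varX (decode x) i c =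
  x 0 (lshift r (lshift (K * r) (lshift (J * r) (mxvec_index i c)))).
Proof. by rewrite !mxE. Qed.

Lemma decodeY x i c : varY (decode x) i c =
  x 0 (lshift r (lshift (K * r) (rshift (I * r) (mxvec_index i c)))).
Proof. by rewrite !mxE. Qed.

Lemma decodeZ x i c : varZ (decode x) i c =
  x 0 (lshift r (rshift (I * r + J * r) (mxvec_index i c))).
Proof. by rewrite !mxE. Qed.

Lemma decodea x c : vara (decode x) 0 c = x 0 (rshift (I * r + J * r + K * r) c).
Proof. by rewrite mxE. Qed.

Lemma decodeB x y : decode (x - y) = decode x - decode y.
Proof. by rewrite /decode !linearB. Qed.

Lemma norm_decode x : `|decode x| <= `|x|.
Proof.
apply/le_var_norm; split; apply/le_mx_norm => // i c.
- by rewrite decodeX mx_norm_entry.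
- by rewrite decodeY mx_norm_entry.
- by rewrite decodeZ mx_norm_entry.
- by rewrite ord1 decodea mx_norm_entry.
Qed.

Lemma norm_encode w : `|encode w| <= `|w|.
Proof.
apply/le_mx_norm => // i j; rewrite ord1 {i}.
case: (split_ordP j) => {}j ->; rewrite /encode ?row_mxEr ?row_mxEl; last first.
  exact: le_trans (mx_norm_entry _ _ _) (norm_vara w).
case: (split_ordP j) => {}j ->; rewrite ?row_mxEr ?row_mxEl; last first.
  by case/mxvec_indexP: j => k c; rewrite mxvecE; exact: le_trans (mx_norm_entry _ _ _) (norm_varZ w).
case: (split_ordP j) => {}j ->; rewrite ?row_mxEr ?row_mxEl; case/mxvec_indexP: j => k c; rewrite mxvecE.
  exact: le_trans (mx_norm_entry _ _ _) (norm_varX w).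
exact: le_trans (mx_norm_entry _ _ _) (norm_varY w).
Qed.

(* A pair of booleans [(p, q)] codes the sign [p - q]. *)
Definition sign_of (t : {ffun 'I_r -> bool * bool}) c : R := (t c).1%:R - (t c).2%:R.

Definition sign_pattern (a : 'rV[R]_r) : {ffun 'I_r -> bool * bool} :=
  [ffun c => (0 < a 0 c, a 0 c < 0)].

Lemma sign_of_pattern a c : sign_of (sign_pattern a) c = Num.sg (a 0 c).
Proof.
rewrite /sign_of ffunE /=; case: (ltgtP (a 0 c) 0) => [a0|a0|->].
- by rewrite sub0r ltr0_sg.
- by rewrite subr0 gtr0_sg.
- by rewrite subrr sgr0.
Qed.

Definition unit_sums m (f : 'rV[R]_n -> 'M[R]_(m, r)) : set 'rV[R]_n :=
  [set x | forall c, \sum_i f x i c ^+ 2 = 1].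

(** The last two conditions express [|alpha| = sign * alpha] by polynomials: the square identity
    forces an entry to vanish where the sign is 0 and is automatic elsewhere. Signs are weak, so
    each stratum is closed and strata overlap. *)
Definition stratum (B : R) t : set 'rV[R]_n :=
  [set x : 'rV[R]_n | forall k, - B <= x 0 k] `&`
  [set x : 'rV[R]_n | forall k, x 0 k <= B] `&`
  (unit_sums (fun x => varX (decode x)) `&` unit_sums (fun x => varY (decode x)) `&`
   unit_sums (fun x => varZ (decode x))) `&`
  [set x | forall c, 0 <= sign_of t c * vara (decode x) 0 c] `&`
  [set x | forall c, (sign_of t c * vara (decode x) 0 c) ^+ 2 = vara (decode x) 0 c ^+ 2].

Lemma rowpolyX i c : rowpoly (fun x => varX (decode x) i c).
Proof. by rewrite (funext (fun x => decodeX x i c)); exact: rowpoly_coord. Qed.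

Lemma rowpolyY i c : rowpoly (fun x => varY (decode x) i c).
Proof. by rewrite (funext (fun x => decodeY x i c)); exact: rowpoly_coord. Qed.

Lemma rowpolyZ i c : rowpoly (fun x => varZ (decode x) i c).
Proof. by rewrite (funext (fun x => decodeZ x i c)); exact: rowpoly_coord. Qed.

Lemma rowpolya c : rowpoly (fun x => vara (decode x) 0 c).
Proof. by rewrite (funext (fun x => decodea x c)); exact: rowpoly_coord. Qed.

Lemma rowpoly_const (c : R) : rowpoly (fun _ : 'rV[R]_n => c).
Proof. exact: polyfun_const. Qed.

Lemma basic_closed_unit_sums m (f : 'rV[R]_n -> 'M[R]_(m, r)) :
  (forall i c, rowpoly (fun x => f x i c)) -> basic_closed (unit_sums f).
Proof.
move=> pf; apply: (basic_closed_all (C := fun c => [set x | \sum_i f x i c ^+ 2 = 1])) => c.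
apply: basic_closed_eq; last exact: rowpoly_const.
apply: polyfun_sum => i _.
by apply: polyfunX; exact: pf.
Qed.

Lemma basic_closed_stratum B t : basic_closed (stratum B t).
Proof.
have ps c : rowpoly (fun x => sign_of t c * vara (decode x) 0 c).
  by apply: polyfunM; [exact: rowpoly_const|exact: rowpolya].
apply: basic_closedI.
  apply: basic_closedI.
    apply: basic_closedI.
      apply: basic_closedI.
        apply: (basic_closed_all (C := fun k => [set x : 'rV[R]_n | - B <= x 0 k])) => k.
        by apply: basic_closed_le; [exact: rowpoly_const|exact: rowpoly_coord].
      apply: (basic_closed_all (C := fun k => [set x : 'rV[R]_n | x 0 k <= B])) => k.
      by apply: basic_closed_le; [exact: rowpoly_coord|exact: rowpoly_const].
    apply: basic_closedI; last exact: basic_closed_unit_sums rowpolyZ.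
    apply: basic_closedI; [exact: basic_closed_unit_sums rowpolyX|exact: basic_closed_unit_sums rowpolyY].
  apply: (basic_closed_all (C := fun c => [set x | 0 <= sign_of t c * vara (decode x) 0 c])) => c.
  by apply: basic_closed_le => //; exact: rowpoly_const.
apply: (basic_closed_all (C := fun c =>
  [set x | (sign_of t c * vara (decode x) 0 c) ^+ 2 = vara (decode x) 0 c ^+ 2])) => c.
by apply: basic_closed_eq; apply: polyfunX => //; [exact: ps|exact: rowpolya].
Qed.

Lemma stratumP B t x : 0 <= B -> stratum B t x <->
  [/\ `|x| <= B, feasible (decode x) &
    forall c, `|vara (decode x) 0 c| = sign_of t c * vara (decode x) 0 c].
Proof.
move=> B0; split.
  move=> [[[[l1 l2] [[uX uY] uZ]] s1] s2]; split.
  - by apply/le_mx_norm => // i k; rewrite ord1 ler_norml l1 l2.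
  - by split; apply/unit_colsP.
  - move=> c; have := s2 c => /(congr1 Num.sqrt); rewrite !sqrtr_sqr => <-.
    by rewrite ger0_norm// s1.
move=> [xB [/unit_colsP uX /unit_colsP uY /unit_colsP uZ] s].
have h k : - B <= x 0 k /\ x 0 k <= B.
  by apply/andP; rewrite -ler_norml; apply: le_trans xB; exact: mx_norm_entry.
split; last by move=> c; rewrite -s -normrX ger0_norm// sqr_ge0.
split; last by move=> c; rewrite -s.
split; first by split=> k; have [] := h k.
exact: (conj (conj uX uY) uZ).
Qed.

Lemma compact_stratum B t : 0 <= B -> compact (stratum B t).
Proof.
move=> B0; apply: bounded_closed_compact; last by have [] := basic_closed_stratum B t.
exists B; split; first exact: num_real.
by move=> e Be x /stratumP-/(_ B0)[xB _ _]; apply: le_trans xB (ltW Be).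
Qed.

Definition stratum_objective (psi : R) t x : R :=
  obj A (decode x) + lambda * (\sum_c sign_of t c * vara (decode x) 0 c) - psi.

Lemma rowpoly_stratum_objective psi t : rowpoly (stratum_objective psi t).
Proof.
apply: polyfunB; last exact: rowpoly_const.
apply: polyfunD.
  apply: (eq_polyfun (p := fun v => 2^-1 * \sum_p
    (A p - cpw (decode (\row_k v k)) p) ^+ 2)) => [v|].
    by rewrite /obj objectiveE.
  apply: polyfunM; first exact: polyfun_const.
  apply: polyfun_sum => p _; apply: polyfunX; apply: polyfunB; first exact: polyfun_const.
  apply: polyfun_sum => c _; apply: polyfunM; first exact: rowpolya.
  apply: polyfunM; last exact: rowpolyZ.
  by apply: polyfunM; [exact: rowpolyX|exact: rowpolyY].
apply: polyfunM; first exact: polyfun_const.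
apply: polyfun_sum => c _; apply: polyfunM; first exact: polyfun_const.
exact: rowpolya.
Qed.

Lemma stratum_objectiveE B psi t x : 0 <= B -> stratum B t x ->
  stratum_objective psi t x = Phi A lambda (decode x) - psi.
Proof.
move=> B0 /stratumP-/(_ B0)[_ _ s]; rewrite /stratum_objective /Phi /norm1.
by under [in RHS]eq_bigr do rewrite s.
Qed.

(** A point is placed in the stratum of its own sign pattern, where its subgradient bounds the
    slope. Subtracting [psi] moves the level of interest to 0. *)
Lemma kl_inequality (B psi : R) : 0 <= B -> 0 < lambda -> exists t0 phi,
  [/\ 0 < t0, forall t, 0 < t -> t < t0 -> 0 <= phi t,
    forall a b, 0 < a -> a <= b -> b < t0 -> phi a <= phi b &
    forall w u v a, feasible w -> `|w| <= B -> `|u| <= B ->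
      subgradient A lambda w u v -> 0 < a -> a <= Phi A lambda w - psi ->
      Phi A lambda w - psi < t0 -> Phi A lambda w - psi - a <=
      nvars R I J K r * `|u| * (phi (Phi A lambda w - psi) - phi a)].
Proof.
move=> B0 l0; have [L [L0 hL]] := @slope_of_subgradient R I J K r A lambda B l0.
pose N := nvars R I J K r.
have N0 : 0 <= N by rewrite /N /nvars ler0n.
(* The cap [N * B] admits every slope [N * |u|] that can occur with [|u| <= B]. *)
have /choice[q hq] t : exists q : R * (R -> R), [/\ 0 < q.1,
    forall s, 0 < s -> s < q.1 -> 0 <= q.2 s,
    forall a b, 0 < a -> a <= b -> b < q.1 -> q.2 a <= q.2 b &
    forall x g a, slope (stratum B t) (stratum_objective psi t) L g x ->
      0 <= g -> g <= N * B -> 0 < a -> a <= stratum_objective psi t x ->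
      stratum_objective psi t x < q.1 ->
      stratum_objective psi t x - a <= g * (q.2 (stratum_objective psi t x) - q.2 a)].
  have pF := rowpoly_stratum_objective psi t.
  have [dK _] := basic_closed_stratum B t.
  have [t0 [phi h]] := desingularization (N * B) (compact_stratum (t := t) B0) dK
    (rowpoly_continuous pF) pF L0.
  by exists (t0, phi).
have [t0 [t00 ht0]] : exists t0, 0 < t0 /\ forall t, t0 < (q t).1.
  apply: near0_ex; apply: near0_all => t; exists (q t).1.
  by have [] := hq t.
exists t0, (fun s => \sum_t (q t).2 s); split=> //.
- move=> s s0 st; apply: sumr_ge0 => t _.
  by have [_ h _ _] := hq t; apply: h => //; apply: lt_trans (ht0 t).
- move=> a b a0 ab bt; apply: ler_sum => t _.
  by have [_ _ h _] := hq t; apply: h => //; apply: lt_trans (ht0 t).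
move=> w u v a fw wB uB su a0 aP Pt.
pose t := sign_pattern (vara w); pose x := encode w.
have Kx : stratum B t x.
  apply/stratumP => //; rewrite encodeK; split=> //.
    exact: le_trans (norm_encode w) wB.
  by move=> c; rewrite sign_of_pattern -normrEsg.
have Fx := stratum_objectiveE psi B0 Kx; rewrite encodeK in Fx.
have sl : slope (stratum B t) (stratum_objective psi t) L (N * `|u|) x.
  split=> // x' Kx'; rewrite Fx (stratum_objectiveE psi B0 Kx').
  have /stratumP-/(_ B0)[xB fx s] := Kx'.
  have dx : `|decode x' - w| <= `|x' - x|.
    by rewrite -{1}(encodeK w) -decodeB norm_decode.
  have -> : Phi A lambda (decode x') - psi - (Phi A lambda w - psi) =
    Phi A lambda (decode x') - Phi A lambda w by ring.
  apply: le_trans (hL w (decode x') u v wB (le_trans (norm_decode _) xB) uB fw fx su _) _.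
    by move=> c; rewrite s sign_of_pattern.
  apply: lerD; first by apply: ler_wpM2l => //; rewrite mulr_ge0.
  by apply: ler_wpM2l => //; rewrite ler_pXn2r ?nnegrE.
have gB : N * `|u| <= N * B by apply: ler_wpM2l.
have g0 : 0 <= N * `|u| by rewrite mulr_ge0.
have [_ _ _ h] := hq t.
have := h x _ a sl g0 gB a0; rewrite Fx => /(_ aP (lt_trans Pt (ht0 t))) /le_trans; apply.
(* Functions of the other strata are nondecreasing, so their increments can only enlarge the
   right-hand side. *)
apply: ler_wpM2l => //; rewrite -sumrB (bigD1 t)//= lerDl sumr_ge0// => t' _.
rewrite subr_ge0; have [_ _ h' _] := hq t'; apply: h' => //.
exact: lt_trans (ht0 t').
Qed.

End Strata.

(** * Convergence *)

(* By AM-GM the hypothesis gives [2 D (n+1) <= D n + C (phi n - phi (n+1))],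
   which telescopes. *)
Lemma finite_length (R : realType) (D phi : nat -> R) (C : R) :
  (forall n, 0 <= D n) -> (forall n, 0 <= phi n) -> 0 <= C ->
  (forall n, phi n.+1 <= phi n) ->
  (forall n, D n.+1 ^+ 2 <= C * D n * (phi n - phi n.+1)) ->
  forall m, \sum_(k < m) D k <= D 0%N + D 0%N + C * phi 0%N.
Proof.
move=> D0 p0 C0 dp h.
have step n : 2 * D n.+1 <= D n + C * (phi n - phi n.+1).
  have d0 : 0 <= C * (phi n - phi n.+1) by rewrite mulr_ge0 ?subr_ge0.
  have := h n; rewrite mulrAC; set e := C * _ in d0 * => he.
  have : (2 * D n.+1) ^+ 2 <= (D n + e) ^+ 2.
    by have := sqr_ge0 (D n - e); nra.
  by rewrite ler_pXn2r// nnegrE; [apply: mulr_ge0|apply: addr_ge0].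
have H m : \sum_(k < m) D k.+1 + D m + C * phi m <= D 0%N + C * phi 0%N.
  elim: m => [|m ih]; first by rewrite big_ord0 add0r.
  rewrite big_ord_recr /=; move: ih (step m); set S := \sum_(k < m) _; lra.
case=> [|m].
  by rewrite big_ord0; apply: addr_ge0; [apply: addr_ge0|apply: mulr_ge0].
have := H m; rewrite big_ord_recl /=; have := D0 m; have := mulr_ge0 C0 (p0 m).
lra.
Qed.

Lemma finite_length_cvg (R : realType) (V : completeNormedModType R) (x : nat -> V) (C : R) :
  (forall m, \sum_(k < m) `|x k.+1 - x k| <= C) -> cvg (x @ \oo).
Proof.
move=> h.
have c : cvgn (series (fun k => x k.+1 - x k)).
  apply: normed_cvg; apply: nondecreasing_is_cvgn.
    by apply: nondecreasing_series => k _ _; exact: normr_ge0.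
  exists C => _ [m _ <-]; apply: le_trans (h m).
  by rewrite -(big_mkord xpredT (fun k => `|x k.+1 - x k|)).
have -> : x = (fun m => x 0%N + series (fun k => x k.+1 - x k) m).
  by apply/funext => m; rewrite /series /= telescope_sumr// subrKC.
by apply: is_cvgD => //; exact: is_cvg_cst.
Qed.

Lemma tame_continuous (R : realType) (V : normedModType R) (g : V -> R) :
  tame g -> continuous g.
Proof.
move=> tg x; have [C [C0 hC]] := tame_lipschitz tg (`|x| + 1).
apply/cvgrPdist_lt => e e0.
pose d := Num.min 1 (e / (C + 1)).
have C1 : 0 < C + 1 by rewrite ltr_wpDl.
have d0 : 0 < d by rewrite lt_min ltr01 divr_gt0.
apply: filterS (nbhsx_ballx x d d0) => y; rewrite -ball_normE /= lt_min => /andP[xy1 xy2].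
have yx : `|y| <= `|x| + 1.
  rewrite -(subrK x y) addrC; apply: le_trans (ler_normD _ _) _.
  by rewrite lerD2l distrC ltW.
have xx : `|x| <= `|x| + 1 by rewrite lerDl.
have [_ h] := hC y x yx xx; apply: le_lt_trans h _.
rewrite ltr_pdivlMr// mulrC in xy2; apply: le_lt_trans xy2.
by rewrite ler_wpM2r// lerDl.
Qed.

HB.instance Definition _ (R : realType) (m n : nat) := Complete.on 'M[R]_(m, n).

Section Convergence.
Variables (R : realType) (I J K r : nat) (A : tensor R I J K) (lambda : R).
Notation W := (var_space R I J K r).

Lemma var_space_cvg (omega : nat -> W) (C : R) :
  (forall m, \sum_(k < m) `|omega k.+1 - omega k| <= C) ->
  exists w : W, omega @ \oo --> w.
Proof.
move=> h.
have part (V : completeNormedModType R) (f : W -> V) :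
    (forall k, `|f (omega k.+1) - f (omega k)| <= `|omega k.+1 - omega k|) ->
    cvg ((f \o omega) @ \oo).
  move=> fb; apply: (finite_length_cvg (C := C)) => m.
  by apply: le_trans (h m); apply: ler_sum => k _; exact: fb.
have cX := part 'M[R]_(I, r) (@varX R I J K r) (fun k => norm_varX (omega k.+1 - omega k)).
have cY := part 'M[R]_(J, r) (@varY R I J K r) (fun k => norm_varY (omega k.+1 - omega k)).
have cZ := part 'M[R]_(K, r) (@varZ R I J K r) (fun k => norm_varZ (omega k.+1 - omega k)).
have ca := part 'rV[R]_r (@vara R I J K r) (fun k => norm_vara (omega k.+1 - omega k)).
exists (lim ((@varX R I J K r \o omega) @ \oo), lim ((@varY R I J K r \o omega) @ \oo),
  lim ((@varZ R I J K r \o omega) @ \oo), lim ((@vara R I J K r \o omega) @ \oo)).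
have -> : omega = (fun k => (varX (omega k), varY (omega k), varZ (omega k), vara (omega k))).
  by apply/funext => k; case: (omega k) => [[[]]].
exact: (cvg_pair (cvg_pair (cvg_pair cX cY) cZ) ca).
Qed.

Lemma continuous_Phi : continuous (@Phi R I J K r A lambda).
Proof.
have cO : continuous (@obj R I J K r A).
  exact: (tame_continuous (g := @obj R I J K r A) (ex_intro _ _ (taylor_obj r A))).
have cN : continuous (fun w : W => norm1 (vara w)).
  have cs (q : seq 'I_r) : continuous (fun w : W => \sum_(c <- q) `|vara w 0 c|).
    elim: q => [|c q ih].
      rewrite (_ : (fun w => _) = fun=> 0); first exact: cst_continuous.
      by apply/funext => w; rewrite big_nil.
    rewrite (_ : (fun w => _) = fun w => `|vara w 0 c| + \sum_(c <- q) `|vara w 0 c|).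
      have ca : continuous (fun w : W => `|vara w 0 c|).
        by move=> w; apply: cvg_norm; exact: (tame_continuous (g := fun w : W => vara w 0 c) (@tame_a R I J K r 0 c)).
      by move=> w; exact: (cvgD (ca w) (ih w)).
    by apply/funext => w; rewrite big_cons.
  exact: cs.
by move=> w; exact: (cvgD (cO w) (cvgM (cvg_cst lambda) (cN w))).
Qed.

Lemma closed_feasible (omega : nat -> W) w : omega @ \oo --> w ->
  (forall n, feasible (omega n)) -> feasible w.
Proof.
move=> cw fw.
have key m (f : W -> 'M[R]_(m, r)) : (forall i c, tame (fun w => f w i c)) ->
    (forall n, unit_cols (f (omega n))) -> unit_cols (f w).
  move=> tf uf; apply/unit_colsP => c.
  pose g w := \sum_i f w i c * f w i c.
  have tg : tame g by apply: tame_sum => i; apply: tameM.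
  have c1 : g \o omega @ \oo --> g w by apply: continuous_cvg => //; exact: tame_continuous.
  have E : g \o omega = fun=> 1.
    apply/funext => n; have /unit_colsP/(_ c) <- := uf n.
    by apply: eq_bigr => i _; rewrite expr2.
  rewrite E in c1; under eq_bigr do rewrite expr2.
  exact/esym/(cvg_unique _ (cvg_cst (1 : R)) c1).
split.
- by apply: key => [|n]; [exact: tame_X|have [] := fw n].
- by apply: key => [|n]; [exact: tame_Y|have [] := fw n].
- by apply: key => [|n]; [exact: tame_Z|have [] := fw n].
Qed.

End Convergence.

(** * Finite length and criticality of the limit *)

Section CriticalLimit.
Variables (R : realType) (I J K r : nat) (A : tensor R I J K) (lambda s : R).
Notation W := (var_space R I J K r).
Hypotheses (lambda_gt0 : 0 < lambda) (s_gt1 : 1 < s).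
Variable omega : nat -> W.
Hypothesis lrat : lrat_sequence A lambda s omega.

Let gap n := `|omega n.+1 - omega n|.

(** The shift matters: step [n] yields a subgradient at the iterate [n.+1]. *)
Lemma lrat_subgradients : exists b : R, 0 <= b /\ exists us vs, forall n,
  subgradient A lambda (omega n.+1) (us n) (vs n) /\ `|us n| <= b * gap n.
Proof.
have [fw _ [B hB]] := lrat_sequence_bounds lambda_gt0 s_gt1 lrat.
have [b [b0 hb]] := @lrat_step_subgradient R I J K r A lambda s lambda_gt0 s_gt1 B.
exists b; split=> //.
have /choice[uv huv] n : exists uv : W * 'rV[R]_r,
    subgradient A lambda (omega n.+1) uv.1 uv.2 /\ `|uv.1| <= b * gap n.
  have [_ st] := lrat.
  by have [u [v h]] := hb _ _ (hB n) (hB n.+1) (fw n) (st n); exists (u, v).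
by exists (fun n => (uv n).1), (fun n => (uv n).2).
Qed.

(** Descent bounds the square of a gap by a drop of [Phi]; the Kurdyka-Lojasiewicz inequality bounds
    that drop by the previous gap times a drop of [phi]. This is the recursion of
    [finite_length]. *)
Lemma lrat_finite_length : exists C : R, forall m, \sum_(k < m) gap k <= C.
Proof.
have [fw ds [B hB]] := lrat_sequence_bounds lambda_gt0 s_gt1 lrat.
have [b [b0 [us [vs hus]]]] := lrat_subgradients.
have gap0 n : 0 <= gap n by exact: normr_ge0.
pose P n := Phi A lambda (omega n).
pose kappa := (s - 1) / 2.
have kappa0 : 0 < kappa by rewrite divr_gt0 ?subr_gt0.
have dP n : P n.+1 <= P n.
  by apply: le_trans (ds n); rewrite lerDl mulr_ge0 ?exprn_ge0// ltW.
have dP' m n : (m <= n)%N -> P n <= P m.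
  by move=> mn; rewrite -(subnKC mn); elim: (n - m)%N => [|k ih]; rewrite ?addn0// addnS (le_trans (dP _)).
suff [n0 [C hC]] : exists n0 C, forall m, \sum_(k < m) gap (n0 + k)%N <= C.
  exists (\sum_(k < n0) gap k + C) => m.
  apply: le_trans (_ : \sum_(k < n0 + m) gap k <= _).
    by rewrite addnC big_split_ord /= lerDl sumr_ge0.
  by rewrite big_split_ord /= lerD2l; exact: hC.
pose psi := inf (range P).
have lbP : has_lbound (range P) by exists 0 => _ [n _ <-]; exact: Phi_ge0.
have psi_le n : psi <= P n by apply: ge_inf => //; exists n.
have hi : has_inf (range P) by split=> //; exists (P 0%N), 0%N.
(* If the infimum is attained, descent leaves no room for any further step. Otherwise all values lie
   strictly above it, as the positivity conditions on levels require. *)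
have [[n0 n0P]|nP] := pselect (exists n0, P n0 <= psi).
  exists n0, 0 => m; rewrite big1// => k _.
  have e1 : P (n0 + k)%N <= psi by apply: le_trans n0P; apply: dP'; rewrite leq_addr.
  have := ds (n0 + k)%N; rewrite -/kappa -/(gap _) -/(P _) -/(P _) => e2.
  have e3 := psi_le (n0 + k).+1.
  have : kappa * gap (n0 + k)%N ^+ 2 <= 0.
    by rewrite -(lerD2l (P (n0 + k).+1)) addr0; apply: le_trans e2 (le_trans e1 e3).
  by rewrite pmulr_rle0// => e4; apply/eqP; rewrite -sqrf_eq0 eq_le e4 sqr_ge0.
have P_gt n : psi < P n by rewrite ltNge; apply/negP => h; apply: nP; exists n.
(* One radius for both the iterates and the subgradients, a gap being at most [2 * |B|]. *)
pose B' := `|B| + b * (2 * `|B|).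
have B'0 : 0 <= B' by rewrite addr_ge0 ?mulr_ge0.
have wB n : `|omega n| <= B'.
  apply: le_trans (hB n) _; apply: le_trans (ler_norm B) _.
  by rewrite lerDl !mulr_ge0.
have uB n : `|us n| <= B'.
  have [_ h] := hus n; apply: le_trans h _.
  apply: le_trans (_ : _ <= b * (2 * `|B|)) _; last by rewrite lerDr.
  apply: ler_wpM2l => //; apply: le_trans (ler_normB _ _) _.
  rewrite mulr_natl mulr2n; apply: lerD; exact: le_trans (hB _) (ler_norm B).
have [t0 [phi [t00 phi0 phi_le kl]]] := @kl_inequality R I J K r A lambda B' psi B'0 lambda_gt0.
have [_ [n0 _ <-] n0P] := inf_adherent t00 hi; rewrite -/psi in n0P.
(* The successor index is that of the iterate carrying the subgradient [us (n0 + n)]. *)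
pose rho n := P (n0 + n).+1 - psi.
have rho0 n : 0 < rho n by rewrite subr_gt0.
have rhot n : rho n < t0.
  rewrite ltrBlDl; apply: le_lt_trans n0P; apply: dP'.
  by rewrite -addnS leq_addr.
have rho_le n : rho n.+1 <= rho n by rewrite lerD2r addnS dP.
have N0 : 0 <= nvars R I J K r by rewrite /nvars ler0n.
exists n0; eexists => m.
apply: (@finite_length R (fun n => gap (n0 + n)%N) (fun n => phi (rho n))
  (nvars R I J K r * b / kappa)) => [n|n||n|n].
- exact: gap0.
- exact: phi0.
- by apply: divr_ge0; [exact: mulr_ge0|exact: ltW].
- exact: phi_le.
have [su ub] := hus (n0 + n)%N.
(* Taking the next level as [a] makes the left-hand side the drop of [Phi] over one step. *)
have := kl _ _ _ (rho n.+1) (fw _) (wB _) (uB _) su (rho0 _) (rho_le n) (rhot n).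
rewrite -/(P _) -/(rho n) => h.
have d0 : 0 <= phi (rho n) - phi (rho n.+1) by rewrite subr_ge0 phi_le.
have := ds (n0 + n.+1)%N; rewrite -/kappa -/(gap _) -/(P _) -/(P _) => e2.
have e3 : kappa * gap (n0 + n.+1)%N ^+ 2 <= rho n - rho n.+1.
  by rewrite /rho !addnS in e2 *; rewrite opprB addrA subrK lerBrDl.
have e4 : nvars R I J K r * `|us (n0 + n)%N| * (phi (rho n) - phi (rho n.+1)) <=
    nvars R I J K r * (b * gap (n0 + n)%N) * (phi (rho n) - phi (rho n.+1)).
  by apply: ler_wpM2r => //; apply: ler_wpM2l.
have := le_trans e3 (le_trans h e4).
rewrite -(ler_pM2l (_ : 0 < kappa^-1)) ?invr_gt0// mulKf ?gt_eqF// => /le_trans; apply.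
by rewrite le_eqVlt; apply/orP; left; apply/eqP; ring.
Qed.

(** The shifted iterates witness the limiting subdifferential. Their subgradients are bounded by
    gaps, which tend to 0 because the sequence converges; their values converge because all iterates
    and the limit are feasible, where [Psi] is the continuous function [Phi]. *)
Lemma lrat_cvg_critical : exists w : W, omega @ \oo --> w /\
  critical_point (@point_dot R I J K r) (Psi A lambda) w.
Proof.
have [C hC] := lrat_finite_length.
have [w cw] := var_space_cvg hC.
exists w; split=> //.
have [fw _ _] := lrat_sequence_bounds lambda_gt0 s_gt1 lrat.
have [b [b0 [us [vs hus]]]] := lrat_subgradients.
have fw' := closed_feasible cw fw.
have cw1 : (fun k => omega k.+1) @ \oo --> w by rewrite cvg_shiftS.
split; first by rewrite PsiE.
exists (fun k => omega k.+1), us; split=> //.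
- rewrite PsiE//.
  rewrite (_ : (fun k => _) = (fun k => (Phi A lambda (omega k.+1))%:E)); last first.
    by apply/funext => k; rewrite PsiE.
  apply: cvg_EFin; first by near=> k.
  by apply: continuous_cvg => //; exact: continuous_Phi.
- by move=> k; have [su _] := hus k; exact: frechet_subgradient lambda_gt0 (fw _) su.
have cB : (fun k => omega k.+1 - omega k) @ \oo --> w - w by exact: cvgB.
have cgap : gap @ \oo --> `|w - w| by exact: cvg_norm.
have cb : (fun k => b * gap k) @ \oo --> b * `|w - w|.
  by apply: cvgM => //; exact: cvg_cst.
rewrite subrr normr0 mulr0 in cb.
apply: norm_cvg0; apply: (squeeze_cvgr _ (cvg_cst (0 : R)) cb).
by near=> k; have [_ ub] := hus k; rewrite normr_ge0 ub.
Unshelve. all: by end_near.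
Qed.

End CriticalLimit.

Theorem theorem4p6 (R : realType) (I J K r : nat) (A : tensor R I J K)
  (lambda s : R) (omega : nat -> var_space R I J K r)
  (r_gt0 : (0 < r)%N) (rank_le : (tensor_rank A <= r)%N)
  (lambda_gt0 : 0 < lambda) (s_gt1 : 1 < s)
  (lrat : lrat_sequence A lambda s omega) :
  exists omega_star : var_space R I J K r,
    omega @ \oo --> omega_star /\
    critical_point (@point_dot R I J K r) (Psi A lambda) omega_star.
Proof. exact: (lrat_cvg_critical lambda_gt0 s_gt1 lrat). Qed.
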